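(* Assume $k(c)<0$ for all $c\in[0,1]$. Then $U\equiv W$ on $\mathbb R\times[0,1]$. Moreover, for $(x,c)\in\mathbb R\times[0,1)$, with $\tau_*:=\inf\{t\ge0:X^x_t\ge\gamma(c)\}$, the control $\nu^*_t:=0$ for $t\le\tau_*$ and $\nu^*_t:=1-c$ for $t>\tau_*$ belongs to $\mathcal S_c$ and is optimal: $\mathcal J_{x,c}(\nu^* )=U(x,c)$.
   Context: Let $(\Omega,\mathcal F,\mathsf P)$ be complete with a standard Brownian motion $B$ and its $\mathsf P$-augmented natural filtration $\mathbb F$. Fix $\theta,\sigma,\mu,\lambda>0$; $X^x$ solves $dX^x_t=\theta(\mu-X^x_t)dt+\sigma dB_t$, $X^x_0=x$. $\Phi\in C^2(\mathbb R)$ nonincreasing, strictly convex, $\Phi(1)=0$. $\mathcal S_c$: nondecreasing, left-continuous, $\mathbb F$-adapted $\nu\ge0$ with $\nu_0=0$, $c+\nu_t\le1$ for all $t$ a.s.; $\mathcal J_{x,c}(\nu):=\mathsf E[\int_0^\infty e^{-\lambda s}\lambda X^x_s\Phi(c+\nu_s)ds+\int_0^\infty e^{-\lambda s}X^x_sd\nu_s]$; $U(x,c):=\inf_{\nu\in\mathcal S_c}\mathcal J_{x,c}(\nu)$. $k(c):=\lambda+\theta+\lambda\Phi'(c)$; $\zeta(c):=(\lambda+\theta)(1-c)-\lambda\Phi(c)$; $\overline x_0(c):=\theta\mu\Phi(c)/\zeta(c)$, $c\in[0,1)$. $\psi_\lambda(x):=e^{\frac{\theta(x-\mu)^2}{2\sigma^2}}D_{-\lambda/\theta}\big(-\frac{(x-\mu)\sqrt{2\theta}}{\sigma}\big)$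 with $D_\alpha(z)=\frac{e^{-z^2/4}}{\Gamma(-\alpha)}\int_0^\infty t^{-\alpha-1}e^{-t^2/2-zt}dt$. $\gamma(c)$ is the unique solution in $(\overline x_0(c),\infty)$ of $\psi_\lambda(x)/\psi'_\lambda(x)=x-\overline x_0(c)$. $W(x,c):=\frac{\psi_\lambda(x)}{\psi_\lambda(\gamma(c))}\big[\gamma(c)(1-c)-\lambda\Phi(c)(\frac{\gamma(c)-\mu}{\lambda+\theta}+\frac\mu\lambda)\big]+\lambda\Phi(c)\big[\frac{x-\mu}{\lambda+\theta}+\frac\mu\lambda\big]$ for $x<\gamma(c)$, $W(x,c):=x(1-c)$ for $x\ge\gamma(c)$ ($c\in[0,1)$), and $W(x,1):=0$. *)

(* Defs.v *)
From HB Require Import structures.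
From mathcomp Require Import all_boot all_order all_algebra.
From mathcomp Require Import all_classical all_reals all_analysis.
Set Implicit Arguments. Unset Strict Implicit. Unset Printing Implicit Defensive.
Import Order.TTheory GRing.Theory Num.Theory.
Import numFieldNormedType.Exports.
Local Open Scope classical_set_scope.
Local Open Scope ring_scope.

Section Defs.
Context {R : realType} {d : measure_display} {T : measurableType d}.
Implicit Types (P : probability T R).

Definition mutually_independent P n (Y : 'I_n -> T -> R) : Prop :=
  (forall i, measurable_fun setT (Y i)) /\
  forall A : 'I_n -> set R, (forall i, measurable (A i)) ->
    P (\bigcap_(i in [set: 'I_n]) (Y i @^-1` A i)) =
    (\prod_(i < n) fine (P (Y i @^-1` A i)))%:E.

Definition standard_BM P (B : R -> T -> R) : Prop :=
  [/\ forall w, B 0 w = 0,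
      forall w, {within `[0, +oo[, continuous (fun t => B t w)},
      forall t, 0 <= t -> measurable_fun setT (B t),
      (forall (n : nat) (t : nat -> R), 0 <= t 0%N ->
          (forall k, (k < n)%N -> t k < t k.+1) ->
          mutually_independent P
            (fun i : 'I_n => fun w => B (t i.+1) w - B (t i) w)) &
      (forall s t, 0 <= s -> s < t -> forall A, measurable A ->
          P ((fun w => B t w - B s w) @^-1` A) =
          normal_prob 0 (Num.sqrt (t - s)) A)].

Definition natural_gen (B : R -> T -> R) (t : R) : set (set T) :=
  [set E | exists s (A : set R), [/\ 0 <= s, s <= t, measurable A &
                                     E = B s @^-1` A]].

Definition aug_filtration P (B : R -> T -> R) (t : R) : set (set T) :=
  <<s natural_gen B t `|` P.-negligible >>.

Definition admissible P (B : R -> T -> R) (c : R) (nu : R -> T -> R) : Prop :=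
  [/\ (forall w s t, 0 <= s -> s <= t -> nu s w <= nu t w),
      (forall w t, 0 < t -> (fun s => nu s w) @ t^'- --> nu t w),
      (forall t, 0 <= t -> forall A, measurable A ->
                  aug_filtration P B t (nu t @^-1` A)),
      (forall w t, 0 <= t -> 0 <= nu t w) &
      ((forall w, nu 0 w = 0) /\
       {ae P, forall w, forall t, 0 <= t -> c + nu t w <= 1})].

Definition RS_sum (f v : R -> R) (Tm : R) (n : nat) : R :=
  \sum_(k < n) f (k%:R * Tm / n%:R) *
               (v (k.+1%:R * Tm / n%:R) - v (k%:R * Tm / n%:R)).

Definition stieltjes_int (f v : R -> R) : R :=
  limn (fun m : nat => limn (fun n : nat => RS_sum f v m%:R n)).

Definition Jcost P (X : R -> R -> T -> R) (lam : R) (Phi : R -> R)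
    (x c : R) (nu : R -> T -> R) : \bar R :=
  (\int[P]_w
     ((\int[lebesgue_measure]_(s in `[0%R, +oo[)
          (expR (- (lam * s)) * lam * X x s w * Phi (c + nu s w))%:E)
      + (stieltjes_int (fun s => expR (- (lam * s)) * X x s w)
                       (fun s => nu s w))%:E))%E.

Definition Uvalue P B X lam Phi (x c : R) : \bar R :=
  ereal_inf [set Jcost P X lam Phi x c nu | nu in admissible P B c].

Definition tau_star (X : R -> R -> T -> R) (x g : R) (w : T) : \bar R :=
  ereal_inf [set t%:E | t in [set t | 0 <= t /\ g <= X x t w]].

Definition nu_star (X : R -> R -> T -> R) (x c g : R) : R -> T -> R :=
  fun t w => if (t%:E <= tau_star X x g w)%E then 0 else 1 - c.

End Defs.

Section Deterministic.
Context {R : realType}.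

(** Gamma function and parabolic cylinder function D_alpha. *)
Definition Gamma (a : R) : R :=
  Rintegral lebesgue_measure `]0, +oo[ (fun t => powR t (a - 1) * expR (- t)).

Definition Dpc (alpha z : R) : R :=
  expR (- (z ^+ 2 / 4)) / Gamma (- alpha) *
  Rintegral lebesgue_measure `]0, +oo[
    (fun t => powR t (- alpha - 1) * expR (- (t ^+ 2 / 2) - z * t)).

Variables (theta sigma mu lam : R) (Phi : R -> R).

Definition psi_lam (x : R) : R :=
  expR (theta * (x - mu) ^+ 2 / (2 * sigma ^+ 2)) *
  Dpc (- (lam / theta)) (- ((x - mu) * Num.sqrt (2 * theta) / sigma)).

Definition kfun (c : R) : R := lam + theta + lam * derive1 Phi c.
Definition zeta (c : R) : R := (lam + theta) * (1 - c) - lam * Phi c.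
Definition xbar0 (c : R) : R := theta * mu * Phi c / zeta c.

(** gamma(c): the (unique) solution in (xbar0 c, +oo) of psi/psi' = x - xbar0 c. *)
Definition gam (c : R) : R :=
  xget 0 [set x | xbar0 c < x /\
                  psi_lam x / derive1 psi_lam x = x - xbar0 c].

Definition Wfun (x c : R) : R :=
  if c == 1 then 0
  else if x < gam c then
    psi_lam x / psi_lam (gam c) *
      (gam c * (1 - c) - lam * Phi c * ((gam c - mu) / (lam + theta) + mu / lam))
    + lam * Phi c * ((x - mu) / (lam + theta) + mu / lam)
  else x * (1 - c).

End Deterministic.

(* Main.v *)
(** The reward accounting is done by Abel summation.  With [A y = E \int_0^oo e^{-lam s} X^y_s ds] (the resolvent),
    put [gain q y = y (1 - q) - lam Phi(q) A(y)]: the cost of spending all remaining fuel now minus that of never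
    spending any.  On the dyadic grid of mesh [2^-j], the expected cost of a control with level [q_k = c + nu_(t_k)] is
      [lam Phi(c) A(x) + sum_k e^{-lam t_(k+1)} E[gain q_k Y_(k+1) - gain q_(k+1) Y_(k+1)]]
    up to a terminal term of size [e^{-lam j / 2}].  For fixed [q], optimal stopping of [- gain q] is governed by
    [gam q]; let [saving q] be its value function, so that [W x c = lam Phi(c) A(x) - saving c x].  It is the minimal
    excessive majorant, and [k < 0] makes [gain + saving] nonincreasing in [q] and nonnegative; hence
    [gain q - gain q' >= saving q' - saving q] for [q <= q'], the sum telescopes, and every control costs at least [W].
    For [nu_star] the only loss is the overshoot of [gam c] on the grid, which vanishes as the mesh tends to 0.
    No stochastic calculus is needed: the equation is solved pathwise, its one-step noise is gaussian and
    independent of the past, and [E psi(Y_(t+h)) = e^{lam h} psi(Y_t)] is a gaussian identity for the parabolic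
    cylinder integral.  The passage to the limit is dominated by [sup_t e^{-lam t / 2} |X_t|], which is integrable. *)
Require Import Defs.
From HB Require Import structures.
From mathcomp Require Import all_boot all_order all_algebra.
From mathcomp Require Import all_classical all_reals all_analysis.
From mathcomp Require Import measurable_realfun.
From mathcomp Require Import ring lra.
Set Implicit Arguments.
Unset Strict Implicit.
Unset Printing Implicit Defensive.
Import Order.TTheory GRing.Theory Num.Theory.
Import numFieldNormedType.Exports.
Local Open Scope classical_set_scope.
Local Open Scope ring_scope.

(** * Independence *)

(** [gain q] is affine in the state, with root [xbar0 q] and slope zeta q / (lam + theta). Since
    zeta' = -k > 0 and zeta 1 = 0, the slope is negative below q = 1, so - [gain q] is a positive
    multiple of y - xbar0 q. The equation for gamma is the first-order condition for maximizing (y -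
    xbar0) / psi; equivalently, a multiple of psi is tangent to y - xbar0 at gamma, and convexity of
    psi gives the comparisons through tangent lines. Monotonicity in q has two sources: - zeta
    decreases, and so does xbar0, by convexity of Phi and Phi 1 = 0. Two obstacles shape the rest.
    Controls are only left-continuous and the filtration is merely augmented, so everything is read
    on grids: the fuel spent in a cell is priced at its right end, where the old and the new level
    are both known, and conditioning is integration against an independent noise. Moreover psi grows
    faster than linearly, whereas the envelope of |X| dominates linear growth only; the overshoot of
    gamma is therefore cut at distance 1, the near part being dominated and the far part costing
    O(h^2) per cell, hence O(j 2^-j) in all. *)

Lemma EFin_cvg {R : realType} {I : Type} {F : set_system I} {FF : Filter F}
  (f : I -> R) (a : R) : f @ F --> a -> (f x)%:E @[x --> F] --> a%:E.
Proof. by move=> fa; apply: cvg_EFin => //; exact: nearW. Qed.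

Section independence.
Context {R : realType} {d : measure_display} {T : measurableType d}.
Variable P : probability T R.
Local Open Scope ereal_scope.

Definition indep_sys (A B : set (set T)) : Prop :=
  forall E F, A E -> B F -> P (E `&` F) = P E * P F.

Lemma sub_sigma_measurable (A : set (set T)) :
  A `<=` measurable -> <<s A >> `<=` measurable.
Proof.
move=> AM; apply: smallest_sub => //.
exact: sigma_algebra_measurable.
Qed.

(** Dynkin's pi-lambda argument with F frozen; [indep_sigma] applies it once in each argument. *)
Lemma indep_sigma_l (A : set (set T)) (F : set T) : setI_closed A ->
  A `<=` measurable -> measurable F ->
  (forall E, A E -> P (E `&` F) = P E * P F) ->
  forall E, <<s A >> E -> P (E `&` F) = P E * P F.
Proof.
move=> AI AM mF AF.
have Ff : P F \is a fin_num by exact: fin_num_measure.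
suff: <<s A >> `<=` [set E | measurable E /\ P (E `&` F) = P E * P F].
  by move=> H E /H[].
apply: lambda_system_subset => //; last by move=> E AE; split; [exact: AM|exact: AF].
apply/dynkin_lambda_system; split.
- by split => //; rewrite setTI probability_setT mul1e.
- move=> E [mE EF]; split; first exact: measurableC.
  rewrite probability_setC// muleBl ?mul1e//.
  rewrite -EF; apply/eqP; rewrite eq_sym sube_eq//; last first.
    apply: fin_num_adde_defl; apply: fin_num_measure; exact: measurableI.
  apply/eqP; rewrite -measureU//.
  + by rewrite -setIUl setUC setUv setTI.
  + by apply: measurableI => //; apply: measurableC.
  + exact: measurableI.
  + by rewrite setIACA setICl set0I.
- move=> G tG GH; have mG n : measurable (G n) by have [] := GH n.
  split; first exact: bigcupT_measurable.
  rewrite setI_bigcupl !measure_bigcup//=; last 2 first.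
  + by move=> n _; apply: measurableI.
  + exact: trivIset_setIr.
  rewrite [RHS]muleC -(fineK Ff) -nneseriesZl//; apply: eq_eseriesr => n _.
  by have [_ ->] := GH n; rewrite fineK// muleC.
Qed.

Lemma indep_sigma (A B : set (set T)) :
  setI_closed A -> setI_closed B -> A `<=` measurable -> B `<=` measurable ->
  indep_sys A B -> indep_sys <<s A >> <<s B >>.
Proof.
move=> AI BI AM BM AB E F sE sF.
have mE := sub_sigma_measurable AM sE.
rewrite setIC muleC; apply: (@indep_sigma_l B) => // {sF}F BF.
rewrite setIC muleC; apply: (@indep_sigma_l A) => //; first exact: BM.
by move=> {mE sE}E AE; exact: AB.
Qed.

(** The joint law and the product of the marginal laws agree on rectangles, hence everywhere, and
    Tonelli separates the two variables. This freezing of the first variable plays the part of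
    conditional expectation throughout. *)
Lemma indep_fubini d1 d2 (T1 : measurableType d1) (T2 : measurableType d2)
    (X1 : T -> T1) (X2 : T -> T2) (f : T1 * T2 -> \bar R) :
  measurable_fun setT X1 -> measurable_fun setT X2 ->
  (forall A B, measurable A -> measurable B ->
     P (X1 @^-1` A `&` X2 @^-1` B) = P (X1 @^-1` A) * P (X2 @^-1` B)) ->
  measurable_fun setT f -> (forall x, 0 <= f x) ->
  \int[P]_w f (X1 w, X2 w) = \int[P]_w \int[P]_v f (X1 w, X2 v).
Proof.
move=> mX1 mX2 X12 mf f0.
pose X1' := mfun_Sub (mem_set mX1); pose X2' := mfun_Sub (mem_set mX2).
have mX12 : measurable_fun setT (fun w => (X1 w, X2 w)) by exact: measurable_fun_pair.
pose X' := mfun_Sub (mem_set mX12).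
rewrite -[LHS]/(\int[P]_w (f \o X') w) -[LHS]ge0_integral_distribution//.
transitivity (\int[distribution P X1' \x distribution P X2']_z f z).
  apply: eq_measure_integral => A mA _; apply/esym.
  by apply: product_measure_unique => // B C mB mC; exact: X12.
rewrite fubini_tonelli1// ge0_integral_distribution//=; last 2 first.
  exact: measurable_fun_fubini_tonelli_F.
  by move=> x; apply: integral_ge0.
apply: eq_integral => w _; rewrite /fubini_F/= ge0_integral_distribution//.
exact: measurableT_comp.
Qed.

(** Retyping the domain with the sigma-algebra generated by G makes the closure properties of
    measurable functions apply to adaptedness as they stand. *)
Definition meas_wrt (G : set (set T)) d' (T' : measurableType d') (f : T -> T') : Prop :=
  measurable_fun [set: g_sigma_algebraType G] (f : g_sigma_algebraType G -> T').

Lemma meas_wrtE (G : set (set T)) d' (T' : measurableType d') (f : T -> T') :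
  meas_wrt G f <-> forall A, measurable A -> <<s G >> (f @^-1` A).
Proof.
split=> [mf A mA|mf _ A mA]; last by rewrite setTI; exact: mf.
by have := mf measurableT A mA; rewrite setTI.
Qed.

Lemma meas_wrt_sub (G H : set (set T)) d' (T' : measurableType d') (f : T -> T') :
  G `<=` <<s H >> -> meas_wrt G f -> meas_wrt H f.
Proof.
move=> GH /meas_wrtE mf; apply/meas_wrtE => A mA.
have : <<s G >> `<=` <<s H >>.
  by apply: smallest_sub => //; exact: smallest_sigma_algebra.
by apply; exact: mf.
Qed.

Lemma meas_wrt_measurable (G : set (set T)) d' (T' : measurableType d') (f : T -> T') :
  G `<=` measurable -> meas_wrt G f -> measurable_fun setT f.
Proof.
move=> GM /meas_wrtE mf _ A mA; rewrite setTI.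
by apply: (sub_sigma_measurable GM); exact: mf.
Qed.

Lemma indep_sys_fubini (G H : set (set T)) d1 d2 (T1 : measurableType d1)
    (T2 : measurableType d2) (X1 : T -> T1) (X2 : T -> T2) (f : T1 * T2 -> \bar R) :
  G `<=` measurable -> H `<=` measurable -> indep_sys <<s G >> <<s H >> ->
  meas_wrt G X1 -> meas_wrt H X2 ->
  measurable_fun setT f -> (forall x, 0 <= f x) ->
  \int[P]_w f (X1 w, X2 w) = \int[P]_w \int[P]_v f (X1 w, X2 v).
Proof.
move=> GM HM GH m1 m2 mf f0; apply: indep_fubini => //.
- exact: meas_wrt_measurable m1.
- exact: meas_wrt_measurable m2.
- by move=> A B mA mB; apply: GH; [exact: (meas_wrtE _ _).1|exact: (meas_wrtE _ _).1].
Qed.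

(** Uniform integrability from bounded second moments: Fatou gives one inequality, truncation the
    other. It carries exponential moments from Riemann sums to their limits. *)
Lemma expectation_cvg_bounded_L2 (Y_ : nat -> T -> R) (Y : T -> R)
    (m_ : nat -> R) (m C : R) :
  (forall n, measurable_fun setT (Y_ n)) -> (forall n w, (0 <= Y_ n w)%R) ->
  (forall w, Y_ ^~ w @ \oo --> Y w) ->
  (forall n, \int[P]_w (Y_ n w)%:E = (m_ n)%:E) ->
  (forall n, \int[P]_w (Y_ n w ^+ 2)%:E <= C%:E) ->
  m_ @ \oo --> m ->
  \int[P]_w (Y w)%:E = m%:E.
Proof.
move=> mY_ Y0_ cY iY iY2 cm.
have mY : measurable_fun setT Y by exact: (measurable_fun_cvg mY_).
have Y0 w : (0 <= Y w)%R.
  by apply: (ler_cvg_to (cvg_cst 0%R) (cY w)); exact: nearW.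
have cY' w : (Y_ n w)%:E @[n --> \oo] --> (Y w)%:E by exact: EFin_cvg.
have cm' : (m_ n)%:E @[n --> \oo] --> m%:E by exact: EFin_cvg.
have iYE : (fun n => \int[P]_w (Y_ n w)%:E) = (fun n => (m_ n)%:E) by apply/funext.
apply/eqP; rewrite eq_le; apply/andP; split.
  have := @fatou _ _ _ P _ measurableT (fun n w => (Y_ n w)%:E)
    (fun n => (measurable_EFinP _ _).2 (mY_ n)) (fun n w _ => Y0_ n w).
  rewrite iYE is_cvg_limn_einfE; last by apply/cvg_ex; exists m%:E.
  rewrite (cvg_lim _ cm')//; apply: le_trans; rewrite le_eqVlt; apply/orP; left; apply/eqP.
  apply: eq_integral => w _; rewrite is_cvg_limn_einfE ?(cvg_lim _ (cY' w))//.
(* Min(Y_n, L) converges boundedly, and the part cut off satisfies Y_n <= Y_n^2 / L, so it costs at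
   most C / L. *)
have key L : (0 < L)%R -> m%:E <= \int[P]_w (Y w)%:E + (C / L)%:E.
  move=> L0; have Li : (0 <= L^-1)%R by rewrite invr_ge0 ltW.
  have mmin n : measurable_fun setT (fun w => (Num.min (Y_ n w) L)%:E).
    by apply/measurable_EFinP; apply: measurable_minr.
  have mminY : measurable_fun setT (fun w => (Num.min (Y w) L)%:E).
    by apply/measurable_EFinP; apply: measurable_minr.
  have cmin w : setT w -> (Num.min (Y_ n w) L)%:E @[n --> \oo] --> (Num.min (Y w) L)%:E.
    move=> _; apply: EFin_cvg.
    move/cvgrPdist_le: (cY w) => H; apply/cvgrPdist_le => e e0.
    move: (H e e0); apply: filterS => n; apply: le_trans.
    rewrite !minEle; case: (lerP (Y w) L); case: (lerP (Y_ n w) L) => h1 h2 //.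
    - by rewrite !ler0_norm; lra.
    - by rewrite !ger0_norm; lra.
    - by rewrite subrr normr0.
  have := @dominated_cvg _ _ _ P _ measurableT _ _ (cst L%:E) mmin cmin.
  move=> /(_ (fun _ _ => isT) (finite_measure_integrable_cst P L measurableT)) H.
  have {}H : \int[P]_w (Num.min (Y_ n w) L)%:E + (C / L)%:E @[n --> \oo] --> \int[P]_w (Num.min (Y w) L)%:E + (C / L)%:E.
    apply: cvgeD; [by rewrite fin_num_adde_defl| |exact: cvg_cst].
    apply: H => n w _; rewrite gee0_abs; last by rewrite lee_fin le_min Y0_ ltW.
    by rewrite lee_fin ge_min lexx orbT.
  apply: (@le_trans _ _ (\int[P]_w (Num.min (Y w) L)%:E + (C / L)%:E)); last first.
    rewrite leeD2r//; apply: ge0_le_integral => //.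
    - by move=> w _; rewrite lee_fin le_min Y0 ltW.
    - exact/measurable_EFinP.
    - by move=> w _; rewrite lee_fin ge_min lexx.
  apply: (lee_cvg_to cm' H); apply: nearW => n.
  rewrite -iY.
  apply: (@le_trans _ _ (\int[P]_w ((Num.min (Y_ n w) L)%:E + (L^-1)%:E * (Y_ n w ^+ 2)%:E))).
    apply: ge0_le_integral => //.
    - by move=> w _; rewrite lee_fin.
    - exact/measurable_EFinP.
    - apply: emeasurable_funD => //; apply/measurable_EFinP.
      by apply: measurable_funM => //; apply: measurable_funX.
    - move=> w _; rewrite -EFinM -EFinD lee_fin minEle; case: ifPn => [_|].
        by rewrite lerDl mulr_ge0// sqr_ge0.
      rewrite -ltNge => LY; rewrite ler_wpDl ?(ltW L0)//.
      by rewrite mulrC ler_pdivlMr// expr2 ler_wpM2l// ltW.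
  rewrite ge0_integralD//=; last 3 first.
  - by move=> w _; rewrite lee_fin le_min Y0_ ltW.
  - by move=> w _; rewrite lee_fin mulr_ge0// sqr_ge0.
  - apply/measurable_EFinP.
    by apply: measurable_funM => //; apply: measurable_funX.
  rewrite leeD2l// ge0_integralZl//=; last 2 first.
  - by apply/measurable_EFinP; apply: measurable_funX.
  - by move=> w _; rewrite lee_fin sqr_ge0.
  by rewrite mulrC EFinM lee_wpmul2l// lee_fin.
apply/lee_addgt0Pr => e e0.
have C0 : (0 <= C)%R.
  by rewrite -lee_fin; apply: le_trans (iY2 0%N); apply: integral_ge0 => w _; rewrite lee_fin sqr_ge0.
(* The level (C + 1) / e makes C / L at most e and stays positive when C = 0. *)
apply: (le_trans (key ((C + 1) / e)%R _)); first by rewrite divr_gt0// ltr_pwDr.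
rewrite leeD2l// lee_fin invf_div mulrA ler_pdivrMr ?ltr_pwDr//.
by rewrite mulrDr mulr1 mulrC lerDl ltW.
Qed.
End independence.

(** * Gaussian exponential moments *)

Section density.
Context {R : realType} {d : measure_display} {T : measurableType d}.
Variables (mu nu : {measure set T -> \bar R}) (p : T -> R).
Hypothesis mp : measurable_fun setT p.
Hypothesis p0 : forall x, 0 <= p x.
Hypothesis nuE : forall A, measurable A -> nu A = (\int[mu]_(x in A) (p x)%:E)%E.
Local Open Scope ereal_scope.
Import HBNNSimple.

Let integral_density_nnsfun (f : {nnsfun T >-> R}) :
  \int[nu]_x (f x)%:E = \int[mu]_x ((f x)%:E * (p x)%:E).
Proof.
under [LHS]eq_integral do rewrite fimfunE -fsumEFin//.
rewrite [LHS]ge0_integral_fsum//; last 2 first.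
  - by move=> r; exact/measurable_EFinP/measurableT_comp.
  - by move=> n x _; rewrite EFinM nnfun_muleindic_ge0.
under [RHS]eq_integral.
  move=> x xD; rewrite fimfunE -fsumEFin// muleC ge0_mule_fsumr; last first.
    by move=> r; rewrite EFinM nnfun_muleindic_ge0.
  over.
rewrite [RHS]ge0_integral_fsum//; last 2 first.
  - move=> r; apply: emeasurable_funM; first exact/measurable_EFinP.
    by apply/measurable_EFinP; do 2 apply/measurableT_comp => //.
  - move=> n x _; rewrite EFinM mule_ge0//; last by rewrite nnfun_muleindic_ge0.
    by rewrite lee_fin.
apply: eq_fsbigr => r _.
under [RHS]eq_integral do rewrite EFinM muleCA.
have mA : measurable (f @^-1` [set r]) by [].
have [->|r0] := eqVneq r 0%R.
  under eq_integral do rewrite mul0r.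
  by under [RHS]eq_integral do rewrite mul0e; rewrite !integral0.
have [r0'|r0'] := ltP r 0%R.
  have -> : f @^-1` [set r] = set0.
    by apply/seteqP; split => // x /= fr; move: r0'; rewrite -fr ltNge fun_ge0.
  under eq_integral do rewrite indic0 mulr0.
  by under [RHS]eq_integral do rewrite indic0 mule0 mule0; rewrite !integral0.
rewrite [RHS]ge0_integralZl//; last 2 first.
- by apply: emeasurable_funM; apply/measurable_EFinP.
- by move=> x _; rewrite mule_ge0// lee_fin.
under [LHS]eq_integral do rewrite EFinM.
rewrite ge0_integralZl//; last by apply/measurable_EFinP.
rewrite integral_indic// setIT nuE// integral_mkcond; congr (_ * _).
apply: eq_integral => x _; rewrite patchE indicE; case: ifPn => _.
  by rewrite mule1.
by rewrite mule0.
Qed.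

Lemma ge0_integral_density (f : T -> \bar R) :
  measurable_fun setT f -> (forall x, 0 <= f x) ->
  \int[nu]_x f x = \int[mu]_x (f x * (p x)%:E).
Proof.
move=> mf f0.
pose f_ := nnsfun_approx measurableT mf.
transitivity (lim (\int[nu]_x (f_ n x)%:E @[n --> \oo])).
  rewrite -monotone_convergence//=.
  - apply: eq_integral => ? /[!inE] xD; apply/esym/cvg_lim => //=.
    exact: cvg_nnsfun_approx.
  - by move=> n; exact/measurable_EFinP/measurable_funTS.
  - by move=> n x _; rewrite lee_fin.
  - by move=> x _ a b ab; rewrite lee_fin; exact/lefP/nd_nnsfun_approx.
rewrite (_ : (fun _ => _) = (fun n => \int[mu]_x ((f_ n x)%:E * (p x)%:E))); last first.
  by apply/funext => n; rewrite integral_density_nnsfun.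
rewrite -monotone_convergence//=.
- apply: eq_integral => x _; apply/cvg_lim => //.
  apply: cvgeZr => //; exact: cvg_nnsfun_approx.
- by move=> n; apply: emeasurable_funM; exact/measurable_EFinP/measurable_funTS.
- by move=> n x _; rewrite mule_ge0// lee_fin.
- move=> x _ a b ab; rewrite lee_wpmul2r ?lee_fin//; exact/lefP/nd_nnsfun_approx.
Qed.
End density.

(** Completing the square: exp(c x) times the density of mean m is a constant times the density of
    mean m + c s^2. *)
Lemma normal_mgf {R : realType} (m s c : R) : s != 0 ->
  (\int[normal_prob m s]_x (expR (c * x))%:E =
   (expR (c * m + c ^+ 2 * s ^+ 2 / 2))%:E)%E.
Proof.
move=> s0.
rewrite (@ge0_integral_density _ _ _ lebesgue_measure _ (normal_pdf m s))//=; last 3 first.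
- exact: measurable_normal_pdf.
- exact: normal_pdf_ge0.
- by apply/measurable_EFinP; apply: measurableT_comp => //; apply: measurable_funM.
transitivity (\int[lebesgue_measure]_x ((expR (c * m + c ^+ 2 * s ^+ 2 / 2))%:E *
  (normal_pdf (m + c * s ^+ 2) s x)%:E))%E.
  apply: eq_integral => x _; rewrite -!EFinM; congr EFin.
  rewrite !normal_pdfE//= mulrCA [RHS]mulrCA; congr (_ * _).
  rewrite /normal_fun -!expRD; congr expR.
  by field.
rewrite ge0_integralZl//=; last 2 first.
- by apply/measurable_EFinP; exact: measurable_normal_pdf.
- by move=> x _; rewrite lee_fin normal_pdf_ge0.
by rewrite integral_normal_pdf// mule1.
Qed.

(** * Continuity on the half-line and dyadic approximation of times *)

Lemma within_itvcy_cvg_seq {R : realType} (f : R -> R) (u : nat -> R) (l : R) :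
  {within `[0, +oo[, continuous f} -> (forall n, 0 <= u n) ->
  u @ \oo --> l -> (fun n => f (u n)) @ \oo --> f l.
Proof.
move=> cf u0 ul.
have l0 : 0 <= l by apply: (ler_cvg_to (cvg_cst 0) ul); exact: nearW.
have /= := cf l; rewrite /continuous_at => H.
apply: (cvg_comp _ _ _ H).
have Al : `[0, +oo[%classic l by rewrite /= in_itv/= andbT.
move=> A /=; rewrite {1}/nbhs/= -(nbhs_subspace_in Al) => H'.
have := ul _ H'; apply: (@filterS _ \oo _ (u @^-1` _)) => n /= h; apply: h.
by rewrite in_itv/= andbT.
Qed.

(** The approximants are dyadic fractions of s itself, so they stay in the grids of [0, s] on which
    independence is first established; s = 0 is separate because the index is read off from r /
    s. *)
Lemma dyadic_grid_cvg {R : realType} (s r : R) : 0 <= r -> r <= s ->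
  exists k : nat -> nat, (forall n, (k n <= 2 ^ n)%N) /\
    (fun n => s * (k n)%:R / (2 ^ n)%:R) @ \oo --> r.
Proof.
move=> r0 rs; have [s0|s0] := eqVneq s 0.
  exists (fun=> 0%N); split => //.
  have -> : r = 0 by apply/eqP; rewrite eq_le r0 -s0 rs.
  rewrite s0 (_ : (fun _ => _) = (fun=> 0)); first exact: cvg_cst.
  by apply/funext => n; rewrite !mul0r.
have sp : 0 < s by rewrite lt_neqAle eq_sym s0 (le_trans r0).
have N0 n : 0 < (2 ^ n)%:R :> R by rewrite ltr0n expn_gt0.
pose k n := Num.truncn (r / s * (2 ^ n)%:R).
have kP n : (k n)%:R <= r / s * (2 ^ n)%:R < (k n).+1%:R.
  by apply: truncn_itv; rewrite mulr_ge0// ?divr_ge0// ltW.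
exists k; split.
  move=> n; rewrite -(ler_nat R); have /andP[+ _] := kP n.
  move/le_trans; apply; rewrite ler_piMl ?(ltW (N0 _))//.
  by rewrite ler_pdivrMr// mul1r.
have H n : `|r - s * (k n)%:R / (2 ^ n)%:R| <= s * (2^-1) ^+ n.
  have /andP[k1 k2] := kP n.
  rewrite ger0_norm.
    rewrite lerBlDl exprVn -natrX -mulrDl ler_pdivlMr//.
    have -> : r * (2 ^ n)%:R = s * (r / s * (2 ^ n)%:R) by field.
    by rewrite -[X in _ <= _ + X]mulr1 -mulrDr ler_pM2l// natr1 ltW.
  rewrite subr_ge0 ler_pdivrMr//.
  by rewrite mulrC -ler_pdivlMr// mulrAC.
apply/cvgrPdist_le => e e0.
have /cvgrPdist_le/(_ e e0) : (fun n => s * (2^-1) ^+ n) @ \oo --> s * 0.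
  apply: cvgM; first exact: cvg_cst.
  by apply: cvg_expr; rewrite ger0_norm ?invr_ge0// invf_lt1// ltr1n.
apply: filterS => n; rewrite mulr0 sub0r normrN => h.
by apply: (le_trans (H n)); apply: le_trans h; rewrite ler_norm.
Qed.

(** * Independence of Brownian past and future *)

Section blocks.
Context {R : realType} {d : measure_display} {T : measurableType d}.
Variable P : probability T R.

Definition gen_by I (D : set I) (Y : I -> T -> R) : set (set T) :=
  [set E | exists i A, [/\ D i, measurable A & E = Y i @^-1` A]].

Lemma gen_by_meas I (D : set I) (Y : I -> T -> R) i : D i -> meas_wrt (gen_by D Y) (Y i).
Proof.
by move=> Di; apply/meas_wrtE => A mA; apply: sub_sigma_algebra; exists i, A.
Qed.

Lemma gen_by_sub I (D : set I) (Y : I -> T -> R) (G : set (set T)) :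
  (forall i, D i -> meas_wrt G (Y i)) -> gen_by D Y `<=` <<s G >>.
Proof. by move=> H _ [i [A [Di mA ->]]]; exact: (meas_wrtE _ _).1 (H i Di) A mA. Qed.

Lemma gen_by_measurable I (D : set I) (Y : I -> T -> R) :
  (forall i, D i -> measurable_fun setT (Y i)) -> gen_by D Y `<=` measurable.
Proof.
by move=> mY _ [i [A [Di mA ->]]]; rewrite -[X in measurable X]setTI; exact: mY.
Qed.

Definition rect n (Y : 'I_n -> T -> R) : set (set T) :=
  [set E | exists A : 'I_n -> set R, (forall i, measurable (A i)) /\
     E = \bigcap_(i in [set: 'I_n]) (Y i @^-1` A i)].

Lemma rect_setI n (Y : 'I_n -> T -> R) : setI_closed (rect Y).
Proof.
move=> E F [A [mA ->]] [C [mC ->]]; exists (fun i => A i `&` C i); split.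
  by move=> i; exact: measurableI.
rewrite -bigcapI; by apply: eq_bigcapr => i _; rewrite preimage_setI.
Qed.

Lemma rect_measurable n (Y : 'I_n -> T -> R) :
  (forall i, measurable_fun setT (Y i)) -> rect Y `<=` measurable.
Proof.
move=> mY _ [A [mA ->]]; apply: fin_bigcap_measurable; first exact: finite_finset.
by move=> i _; rewrite -[X in measurable X]setTI; exact: mY.
Qed.

Lemma gen_by_rect n (Y : 'I_n -> T -> R) : gen_by setT Y `<=` rect Y.
Proof.
move=> _ [i [A [_ mA ->]]]; exists (fun j => if j == i then A else setT); split.
  by move=> j; case: ifP.
apply/seteqP; split => w /= Hw; last by have := Hw i I; rewrite /= eqxx.
by move=> j _ /=; case: ifPn => // /eqP ->.
Qed.

(** Rectangles over a block form a pi-system generating its sigma-algebra, and the intersection of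
    one rectangle from each block is a rectangle over all m + p coordinates. *)
Lemma indep_blocks m p (Y : 'I_(m + p) -> T -> R) : mutually_independent P Y ->
  indep_sys P <<s gen_by setT (fun i => Y (lshift p i)) >>
              <<s gen_by setT (fun j => Y (rshift m j)) >>.
Proof.
move=> [mY YI].
have H : indep_sys P <<s rect (fun i => Y (lshift p i)) >>
                     <<s rect (fun j => Y (rshift m j)) >>.
  apply: indep_sigma.
  - exact: rect_setI.
  - exact: rect_setI.
  - by apply: rect_measurable => i; exact: mY.
  - by apply: rect_measurable => i; exact: mY.
  move=> _ _ [A [mA ->]] [C [mC ->]].
  pose D (A : 'I_m -> set R) (C : 'I_p -> set R) k := match fintype.split k with inl i => A i | inr j => C j end.
  have DE A' C' : (\bigcap_(i in [set: 'I_m]) (Y (lshift p i) @^-1` A' i)) `&`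
      (\bigcap_(j in [set: 'I_p]) (Y (rshift m j) @^-1` C' j)) =
      \bigcap_(k in [set: 'I_(m + p)]) (Y k @^-1` D A' C' k).
    apply/seteqP; split => w /=.
      move=> [H1 H2] k _ /=; rewrite /D; case: splitP => j kj.
        have -> : k = lshift p j by exact/val_inj.
        exact: H1.
      have -> : k = rshift m j by exact/val_inj.
      exact: H2.
    move=> H; split => j _ /=.
      by have := H (lshift p j) I; rewrite /D/= -[lshift p j]/(unsplit (inl j)) unsplitK.
    by have := H (rshift m j) I; rewrite /D/= -[rshift m j]/(unsplit (inr j)) unsplitK.
  have mD A' C' : (forall i, measurable (A' i)) -> (forall j, measurable (C' j)) ->
      forall k, measurable (D A' C' k).
    by move=> mA' mC' k; rewrite /D; case: splitP.
  have PD A' C' : (forall i, measurable (A' i)) -> (forall j, measurable (C' j)) ->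
    P ((\bigcap_(i in [set: 'I_m]) (Y (lshift p i) @^-1` A' i)) `&`
      (\bigcap_(j in [set: 'I_p]) (Y (rshift m j) @^-1` C' j))) =
    ((\prod_(i < m) fine (P (Y (lshift p i) @^-1` A' i))) *
     (\prod_(j < p) fine (P (Y (rshift m j) @^-1` C' j))))%:E.
    move=> mA' mC'; rewrite DE YI; last exact: mD.
    congr EFin; rewrite big_split_ord/=; congr (_ * _); apply: eq_bigr => j _.
      by rewrite /D -[lshift p j]/(unsplit (inl j)) unsplitK.
    by rewrite /D -[rshift m j]/(unsplit (inr j)) unsplitK.
  rewrite PD//.
  (* Letting the other block be unconstrained in [PD] yields the product formula for each block
     alone. *)
  have bT q (Z : 'I_q -> T -> R) : \bigcap_(i in [set: 'I_q]) (Z i @^-1` setT) = setT.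
    by apply/seteqP; split.
  have pT q (Z : 'I_q -> T -> R) : \prod_(i < q) fine (P (Z i @^-1` setT)) = 1 :> R.
    by rewrite big1// => i _; rewrite preimage_setT probability_setT.
  have -> : P (\bigcap_(i in [set: 'I_m]) (Y (lshift p i) @^-1` A i)) =
      (\prod_(i < m) fine (P (Y (lshift p i) @^-1` A i)))%:E.
    by have := PD A (fun=> setT) mA (fun=> measurableT); rewrite bT pT setIT mulr1.
  have -> : P (\bigcap_(i in [set: 'I_p]) (Y (rshift m i) @^-1` C i)) =
      (\prod_(i < p) fine (P (Y (rshift m i) @^-1` C i)))%:E.
    by have := PD (fun=> setT) C (fun=> measurableT) mC; rewrite bT pT setTI mul1r.
  by rewrite EFinM.
have sub (A C : set (set T)) : A `<=` C -> <<s A >> `<=` <<s C >>.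
  by move=> AC; exact: sub_smallest2r.
move=> E F EA FC; apply: H.
  by apply: sub EA; exact: gen_by_rect.
by apply: sub FC; exact: gen_by_rect.
Qed.
End blocks.

Section brownian_independence.
Context {R : realType} {d : measure_display} {T : measurableType d}.
Variables (P : probability T R) (B : R -> T -> R).
Hypothesis cP : measure_is_complete P.
Hypothesis hB : standard_BM P B.

Let mB t : 0 <= t -> measurable_fun setT (B t).
Proof. by case: hB => _ _ + _ _; exact. Qed.

(** Since B starts at 0, the early values are sums of early increments, and B(t_(m+k)) - B(t_m) is a
    sum of late ones; the block split applies to the increments. *)
Lemma BM_blocks_indep (t : nat -> R) (m p : nat) :
  t 0%N = 0 -> (forall k, (k < m + p)%N -> t k < t k.+1) ->
  indep_sys P <<s gen_by [set k | (k <= m)%N] (fun k => B (t k)) >>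
    <<s gen_by [set k | (k <= p)%N] (fun k w => B (t (m + k)%N) w - B (t m) w) >>.
Proof.
move=> t0 tlt; have [B0 _ _ BI _] := hB.
have := @indep_blocks _ _ _ P m p _ (BI (m + p)%N t _ tlt).
rewrite t0 lexx => /(_ isT) H.
set GL := gen_by _ _ in H; set GR := gen_by _ _ in H.
have sub (A C : set (set T)) : A `<=` <<s C >> -> <<s A >> `<=` <<s C >>.
  by move=> AC; apply: smallest_sub => //; exact: smallest_sigma_algebra.
move=> E F EA FC; apply: H.
  apply: sub EA; apply: gen_by_sub => k /= km.
  elim: k km => [_|k IH km].
    have -> : B (t 0%N) = cst 0 by apply/funext => w; rewrite t0 B0.
    exact: measurable_cst.
  have -> : B (t k.+1) = (fun w => B (t k) w + (B (t k.+1) w - B (t k) w)).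
    by apply/funext => w; rewrite addrC subrK.
  apply: measurable_funD; first exact: (IH (ltnW _)).
  exact: (@gen_by_meas _ _ _ _ _ _ (Ordinal km)).
apply: sub FC; apply: gen_by_sub => k /= kp.
elim: k kp => [_|k IH kp].
  rewrite addn0; under eq_fun do rewrite subrr.
  exact: measurable_cst.
have -> : (fun w => B (t (m + k.+1)%N) w - B (t m) w) =
   (fun w => (B (t (m + k)%N) w - B (t m) w) + (B (t (m + k).+1) w - B (t (m + k)%N) w)).
  by apply/funext => w; rewrite addnS; ring.
apply: measurable_funD; first exact: (IH (ltnW _)).
exact: (@gen_by_meas _ _ _ _ _ _ (Ordinal kp)).
Qed.

Definition future_gen (s h : R) : set (set T) :=
  gen_by [set r | s <= r <= s + h] (fun r w => B r w - B s w).

(** These are exactly the generators of [aug_filtration], so the adaptedness clause of [admissible]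
    reads as [meas_wrt] of this family. *)
Definition past_gen (s : R) : set (set T) := natural_gen B s `|` P.-negligible.

Lemma past_gen_measurable s : past_gen s `<=` measurable.
Proof.
move=> E [[r [A [r0 rs mA ->]]]|]; last exact: cP.
by rewrite -[X in measurable X]setTI; exact: mB.
Qed.

Lemma future_gen_measurable s h : 0 <= s -> future_gen s h `<=` measurable.
Proof.
move=> s0; apply: gen_by_measurable => r /= /andP[sr _].
by apply: measurable_funB; apply: mB => //; exact: le_trans sr.
Qed.

Let pastD s n := gen_by [set k | (k <= 2 ^ n)%N] (fun k => B (s * k%:R / (2 ^ n)%:R)).
Let futD s h n := gen_by [set k | (k <= 2 ^ n)%N]
  (fun k w => B (s + h * k%:R / (2 ^ n)%:R) w - B s w).

Let N0 n : 0 < (2 ^ n)%:R :> R. Proof. by rewrite ltr0n expn_gt0. Qed.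

Lemma dyadic_indep s h n : 0 <= s -> 0 < h ->
  indep_sys P <<s pastD s n >> <<s futD s h n >>.
Proof.
(* For s = 0 the past grid collapses to one point, since the grid times must increase strictly. *)
move=> s0 h0; pose m := if s == 0 then 0%N else (2 ^ n)%N.
(* One grid glues 2^n steps across [0, s] to 2^n steps across [s, s + h]; the pivot m sits at time
   s. *)
pose t k := if (k <= m)%N then s * k%:R / (2 ^ n)%:R
            else s + h * (k - m)%:R / (2 ^ n)%:R.
have tm : t m = s.
  rewrite /t leqnn /m; case: eqP => [->|_]; first by rewrite !mul0r.
  by rewrite mulfK// gt_eqF.
have tmk k : t (m + k)%N = s + h * k%:R / (2 ^ n)%:R.
  rewrite /t addKn; case: ifPn => // mk.
  have -> : k = 0%N by move: mk; rewrite -{2}[m]addn0 leq_add2l leqn0 => /eqP.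
  by rewrite addn0 -[LHS]/(s * m%:R / (2 ^ n)%:R); move: tm; rewrite /t leqnn => ->; rewrite mulr0 mul0r addr0.
have := @BM_blocks_indep t m (2 ^ n)%N.
have t0 : t 0%N = 0 by rewrite /t leq0n mulr0 mul0r.
have tlt k : (k < m + 2 ^ n)%N -> t k < t k.+1.
  move=> kmn; have [km|mk] := ltnP k m.
    rewrite /t km (ltnW km) ltr_pM2r ?invr_gt0// ltr_pM2l ?ltr_nat//.
    rewrite lt_neqAle s0 andbT eq_sym.
    by move: km; rewrite /m; case: eqP.
  rewrite -(subnKC mk) -addnS !tmk ltrD2l ltr_pM2r ?invr_gt0// ltr_pM2l// ltr_nat//.
move=> /(_ t0 tlt) H.
have sub (A C : set (set T)) : A `<=` <<s C >> -> <<s A >> `<=` <<s C >>.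
  by move=> AC; apply: smallest_sub => //; exact: smallest_sigma_algebra.
move=> E F EA FC; apply: H.
  apply: sub EA; apply: gen_by_sub => k /= kn.
  have [s00|sn0] := eqVneq s 0.
    have -> : s * k%:R / (2 ^ n)%:R = t 0%N by rewrite t0 s00 !mul0r.
    exact: (@gen_by_meas _ _ _ _ _ (fun k => B (t k)) 0%N).
  have mE : m = (2 ^ n)%N by rewrite /m (negbTE sn0).
  have -> : s * k%:R / (2 ^ n)%:R = t k by rewrite /t mE kn.
  by apply: (@gen_by_meas _ _ _ _ _ (fun k => B (t k)) k); rewrite /= mE.
apply: sub FC; apply: gen_by_sub => k /= kn.
have -> : (fun w => B (s + h * k%:R / (2 ^ n)%:R) w - B s w) =
  (fun w => B (t (m + k)%N) w - B (t m) w) by rewrite tmk tm.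
exact: (@gen_by_meas _ _ _ _ _ (fun k w => B (t (m + k)%N) w - B (t m) w) k).
Qed.

(** Dyadic events at level n increase with n, so their union is a pi-system and [dyadic_indep]
    passes to it; null events are independent of everything, and path continuity recovers the
    remaining times. *)
Lemma BM_indep s h : 0 <= s -> 0 < h ->
  indep_sys P <<s past_gen s >> <<s future_gen s h >>.
Proof.
move=> s0 h0; have [B0 cB _ _ _] := hB.
have sub (A C : set (set T)) : A `<=` <<s C >> -> <<s A >> `<=` <<s C >>.
  by move=> AC; apply: smallest_sub => //; exact: smallest_sigma_algebra.
have dbl (x : R) k n j : x * (k * 2 ^ j)%:R / (2 ^ (n + j))%:R = x * k%:R / (2 ^ n)%:R.
  rewrite expnD !natrM invfM mulrA -!mulrA; congr (_ * (_ * _)).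
  by rewrite mulrC -mulrA mulVf ?mulr1// gt_eqF.
have dle k n j : (k <= 2 ^ n)%N -> (k * 2 ^ j <= 2 ^ (n + j))%N.
  by move=> kn; rewrite expnD leq_mul2r kn orbT.
have pmono n j : <<s pastD s n >> `<=` <<s pastD s (n + j) >>.
  apply: sub; apply: gen_by_sub => k /= kn; rewrite -(dbl s k n j).
  apply: (@gen_by_meas _ _ _ _ _ (fun k => B (s * k%:R / (2 ^ (n + j))%:R))).
  exact: dle.
have fmono n j : <<s futD s h n >> `<=` <<s futD s h (n + j) >>.
  apply: sub; apply: gen_by_sub => k /= kn; rewrite -(dbl h k n j).
  apply: (@gen_by_meas _ _ _ _ _ (fun k w => B (s + h * k%:R / (2 ^ (n + j))%:R) w - B s w)).
  exact: dle.
(* Null events join the generators already here: a subset of a null event is null, so closure under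
   intersection survives. *)
pose A := (\bigcup_n <<s pastD s n >>) `|` P.-negligible.
pose C := \bigcup_n <<s futD s h n >>.
have sI (G : set (set T)) E F : <<s G >> E -> <<s G >> F -> <<s G >> (E `&` F).
  by move=> GE GF; exact: (@measurableI _ (g_sigma_algebraType G)).
have mpast n : <<s pastD s n >> `<=` measurable.
  apply: sub_sigma_measurable; apply: gen_by_measurable => k _.
  by apply: mB; rewrite divr_ge0// mulr_ge0.
have mfut n : <<s futD s h n >> `<=` measurable.
  apply: sub_sigma_measurable; apply: gen_by_measurable => k _.
  by apply: measurable_funB; apply: mB => //; rewrite addr_ge0// divr_ge0// mulr_ge0// ltW.
have AI : setI_closed A.
  move=> E F [[n _ En]|En] [[j _ Fj]|Fj].
  - left; exists (n + j)%N => //; apply: sI; first exact: pmono.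
    by rewrite addnC; exact: fmono || exact: pmono.
  - by right; apply: negligibleS Fj => w [].
  - by right; apply: negligibleS En => w [].
  - by right; apply: negligibleS En => w [].
have CI : setI_closed C.
  move=> E F [n _ En] [j _ Fj]; exists (n + j)%N => //; apply: sI; first exact: fmono.
  by rewrite addnC; exact: fmono.
have Am : A `<=` measurable by move=> E [[n _ /mpast]|/cP].
have Cm : C `<=` measurable by move=> E [n _ /mfut].
have AC : indep_sys P A C.
  move=> E F [[n _ En]|En] [j _ Fj].
    apply: (@dyadic_indep s h (n + j)) => //; first exact: pmono.
    by rewrite addnC; exact: fmono.
  have PE : P E = 0%E by apply/negligibleP => //; exact: cP.
  rewrite PE mul0e; apply/negligibleP; last by apply: negligibleS En => w [].
  by apply: measurableI; [exact: cP|exact: mfut Fj].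
have H := indep_sigma AI CI Am Cm AC.
move=> E F PE FF; apply: H.
  apply: sub PE => {}E [[r [D [r0 rs mD ->]]]|nE]; last first.
    by apply: sub_sigma_algebra; right.
  apply: (meas_wrtE _ _).1 _ D mD.
  have [k [kn kr]] := dyadic_grid_cvg r0 rs.
  apply: (@measurable_fun_cvg _ (g_sigma_algebraType A) _ setT (fun n => B (s * (k n)%:R / (2 ^ n)%:R))).
    move=> n; apply: (@meas_wrt_sub _ _ (pastD s n)); last first.
      by apply: (@gen_by_meas _ _ _ _ _ (fun k => B (s * k%:R / (2 ^ n)%:R))); exact: kn.
    move=> G Gn; apply: sub_sigma_algebra; left; exists n => //.
    exact: sub_sigma_algebra.
  move=> w _; apply: (@within_itvcy_cvg_seq _ (B^~ w)) => // n.
  by rewrite divr_ge0// mulr_ge0.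
apply: sub FF; apply: gen_by_sub => r /= /andP[sr rsh].
have r0' : 0 <= r - s by rewrite subr_ge0.
have rs' : r - s <= h by rewrite lerBlDl.
have [k [kn kr]] := dyadic_grid_cvg r0' rs'.
apply: (@measurable_fun_cvg _ (g_sigma_algebraType C) _ setT (fun n w => B (s + h * (k n)%:R / (2 ^ n)%:R) w - B s w)).
  move=> n; apply: (@meas_wrt_sub _ _ (futD s h n)); last first.
    by apply: (@gen_by_meas _ _ _ _ _ (fun k w => B (s + h * k%:R / (2 ^ n)%:R) w - B s w)); exact: kn.
  move=> G Gn; apply: sub_sigma_algebra; exists n => //.
  exact: sub_sigma_algebra.
move=> w _; apply: cvgB; last exact: cvg_cst.
apply: (@within_itvcy_cvg_seq _ (B^~ w)) => //.
  by move=> n; rewrite addr_ge0// divr_ge0// mulr_ge0// ltW.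
rewrite -[r](subrKC s); apply: cvgD => //; exact: cvg_cst.
Qed.
End brownian_independence.

(** * The Ornstein-Uhlenbeck process: pathwise solution and one-step noise *)

Lemma within_itvcyP_eps {R : realType} (f : R -> R) : {within `[0, +oo[, continuous f} ->
  forall x e, 0 <= x -> 0 < e -> exists2 dl, 0 < dl & forall y, 0 <= y -> `|y - x| < dl -> `|f y - f x| < e.
Proof.
move=> cf x e x0 e0.
have /= := cf x; rewrite /continuous_at => /cvgrPdist_lt/(_ _ e0).
have Al : `[0, +oo[%classic x by rewrite /= in_itv/= andbT.
rewrite {1}/nbhs/= -(nbhs_subspace_in Al) => -[dl /= dl0 H].
exists dl => // y y0 yx; rewrite distrC.
apply: (H y); first by rewrite /= distrC.
by rewrite /= in_itv/= y0.
Qed.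

(** Local moduli are glued by compactness of [0, Tm]; only a is confined there, so b may lie beyond
    the right end. *)
Lemma unif_cont_segment {R : realType} (f : R -> R) (Tm e : R) :
  {within `[0, +oo[, continuous f} -> 0 < e ->
  exists2 dl, 0 < dl & forall a b, 0 <= a -> a <= Tm -> 0 <= b -> `|a - b| < dl ->
    `|f a - f b| < e.
Proof.
move=> cf e0.
have /compact_near_coveringP := @segment_compact R 0 Tm.
pose Q (i a : R) := 0 <= a -> forall b, 0 <= b -> `|a - b| < i -> `|f a - f b| < e.
move=> /(_ R (0^'+) Q) H.
have [] : \forall i \near 0^'+, `[0, Tm]%classic `<=` Q i.
  apply: H => a /=; rewrite in_itv/= => /andP[a0 aT].
  have e2 : 0 < e / 2 by rewrite divr_gt0.
  have [dl dl0 Hdl] := within_itvcyP_eps cf a0 e2.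
  have dl2 : 0 < dl / 2 by rewrite divr_gt0.
  exists ([set y | `|a - y| < dl / 2], [set i | i < dl / 2]).
    split => /=; first by exists (dl / 2).
    by exists (dl / 2) => //= i /=; rewrite sub0r normrN => /ltr_normlW + _.
  move=> [y i] /= [ay idl] y0 b b0 yb.
  have h1 : `|f y - f a| < e / 2 by apply: Hdl => //; rewrite distrC (lt_trans ay)// ltr_pdivrMr// ltr_pMr// ltr1n.
  have h2 : `|f b - f a| < e / 2.
    apply: Hdl => //; rewrite distrC -(subrK y a) -addrA.
    rewrite (le_lt_trans (ler_normD _ _))// [ltRHS]splitr ltrD//.
    exact: lt_trans idl.
  rewrite -(subrK (f a) (f y)) -addrA (le_lt_trans (ler_normD _ _))// [ltRHS]splitr ltrD//.
  by rewrite distrC.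
move=> dl /= dl0 Hd; exists (dl / 2); first by rewrite divr_gt0.
move=> a b a0 aT b0 ab.
apply: (Hd (dl / 2)) => //=.
- by rewrite sub0r normrN gtr0_norm ?divr_gt0// ltr_pdivrMr// ltr_pMr// ltr1n.
- by rewrite divr_gt0.
- by rewrite in_itv/= a0.
Qed.

Lemma cont_bounded_segment {R : realType} (f : R -> R) (Tm : R) :
  {within `[0, +oo[, continuous f} ->
  exists2 M, 0 < M & forall a, 0 <= a -> a <= Tm -> `|f a| <= M.
Proof.
move=> cf; have [T0|T0] := leP 0 Tm; last first.
  by exists 1 => // a a0 aT; have := le_lt_trans (le_trans a0 aT) T0; rewrite ltxx.
have cf' : {within `[0, Tm], continuous (fun x => `|f x|)}.
  move=> x; apply: cvg_norm.
  have : {within `[0, Tm], continuous f}.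
    by apply: continuous_subspaceW cf => y /=; rewrite !in_itv/= => /andP[->].
  by move/(_ x).
have [c _ Hc] := EVT_max T0 cf'.
exists (`|f c| + 1); first by rewrite ltr_wpDl.
by move=> a a0 aT; rewrite (le_trans (Hc a _)) ?in_itv/= ?a0// lerDl.
Qed.

Lemma cont_integrable_segment {R : realType} (f : R -> R) (Tm : R) :
  {within `[0, +oo[, continuous f} ->
  lebesgue_measure.-integrable `[0, Tm] (EFin \o f).
Proof.
move=> cf; apply: continuous_compact_integrable; first exact: segment_compact.
by apply: continuous_subspaceW cf => y /=; rewrite !in_itv/= => /andP[->].
Qed.

Lemma Rintegral_osc {R : realType} (f : R -> R) (a b c e : R) :
  lebesgue_measure.-integrable `[0, b] (EFin \o f) -> 0 <= a -> a <= b -> 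
  (forall r, a < r -> r <= b -> `|f r - c| <= e) ->
  `|Rintegral lebesgue_measure `[0, b] f - Rintegral lebesgue_measure `[0, a] f
     - c * (b - a)| <= e * (b - a).
Proof.
move=> fi a0 ab fc.
rewrite Rintegral_itvB// ?bnd_simp//.
have mab : measurable (`]a, b] : set R) by [].
have leb : fine (lebesgue_measure (`]a, b] : set R)) = b - a.
  rewrite lebesgue_measure_itv/= lte_fin; case: ltP => //= ba.
  by have -> : a = b by [apply/eqP; rewrite eq_le ab ba]; rewrite subrr.
have fi' : lebesgue_measure.-integrable `]a, b] (EFin \o f).
  apply: integrableS fi => // r /=; rewrite !in_itv/= => /andP[/ltW ar ->].
  by rewrite (le_trans a0 ar).
have ci k : lebesgue_measure.-integrable (`]a, b] : set R) (EFin \o cst k).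
  have : lebesgue_measure.-integrable `[0, b] (EFin \o cst k : R -> \bar R).
    by apply: cont_integrable_segment => x; exact: cst_continuous.
  apply: integrableS => // r /=; rewrite !in_itv/= => /andP[/ltW ar ->].
  by rewrite (le_trans a0 ar).
have -> : c * (b - a) = \int[lebesgue_measure]_(x in `]a, b]) (cst c x).
  by rewrite Rintegral_cst// leb.
rewrite -RintegralB//.
have ifc : lebesgue_measure.-integrable `]a, b] (EFin \o (fun t => f t - cst c t)).
  rewrite (_ : _ \o _ = ((EFin \o f) \- (EFin \o cst c))%E).
    by apply: integrableB => //; exact: ci.
  by apply/funext => t; rewrite /= EFinB.
apply: (le_trans (le_normr_Rintegral _ _)) => //.
rewrite -leb -Rintegral_cst//.
apply: le_Rintegral => //.
- have := integrable_abse ifc; by congr (integrable _ _); apply/funext.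
- exact: (ci e).
- by move=> r /=; rewrite in_itv/= => /andP[? ?]; exact: fc.
Qed.

Lemma expR_taylor2 {R : realType} (z : R) : 0 <= z -> z <= 2^-1 ->
  `|expR z - 1 - z| <= 2 * z ^+ 2.
Proof.
move=> z0 z1; have h1 := expR_ge1Dx z; have h2 := expR_ge1Dx (- z).
rewrite ger0_norm; last by rewrite -addrA -opprD subr_ge0.
have h3 : expR z * expR (- z) = 1 by rewrite -expRD subrr expR0.
have e0 := expR_gt0 z.
have h4 : expR z * (1 - z) <= expR z * expR (- z) by rewrite ler_pM2l.
nra.
Qed.

Lemma cvg_pow2V {R : realType} (c : R) : (fun n => c / (2 ^ n)%:R) @ \oo --> (0 : R).
Proof.
rewrite -(mulr0 c); apply: cvgM; first exact: cvg_cst.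
rewrite (_ : (fun _ => _) = (fun n => (2^-1) ^+ n)).
  by apply: cvg_expr; rewrite ger0_norm ?invr_ge0// invf_lt1// ltr1n.
by apply/funext => n; rewrite exprVn natrX.
Qed.

(** Left-point Riemann sum, on 2^n cells, of the Wiener integral of sigma exp(-theta (h - r))
    against b(s + r): the noise in the variation-of-constants formula. *)
Definition ou_sum {R : realType} (theta sigma s h : R) (b : R -> R) (n : nat) : R :=
  \sum_(j < 2 ^ n) sigma * expR (- (theta * (h - h * j%:R / (2 ^ n)%:R))) *
     (b (s + h * (j.+1)%:R / (2 ^ n)%:R) - b (s + h * j%:R / (2 ^ n)%:R)).

(** The integrand is smooth and deterministic, so the argument is pathwise: with the integrating
    factor, the left-over of the solution formula telescopes, and each term differs from that of
    [ou_sum] by a second-order Taylor error plus an oscillation of the drift. *)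
Lemma ou_sum_cvg {R : realType} (y b : R -> R) (theta sigma mu x s h : R) :
  0 < theta -> {within `[0, +oo[, continuous y} ->
  (forall t, 0 <= t -> y t = x +
     Rintegral lebesgue_measure `[0, t] (fun r => theta * (mu - y r)) + sigma * b t) ->
  0 <= s -> 0 < h ->
  ou_sum theta sigma s h b @ \oo --> y (s + h) - (mu + (y s - mu) * expR (- (theta * h))).
Proof.
move=> th0 cy sde s0 h0.
have cf : {within `[0, +oo[, continuous (fun r => theta * (mu - y r))}.
  by move=> r; apply: cvgM; [exact: cvg_cst|apply: cvgB; [exact: cvg_cst|exact: cy]].
have cy' : {within `[0, +oo[, continuous (fun r => y r - mu)}.
  by move=> r; apply: cvgB; [exact: cy|exact: cvg_cst].
have [M M0 yM] := cont_bounded_segment (s + h) cy'.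
pose f r := theta * (mu - y r).
apply/cvgrPdist_le => e e0.
(* Summed over 2^n cells of length h / 2^n, an oscillation [ep] contributes e / 2; the Taylor errors
   get the other half. *)
pose ep := e / (2 * h).
have ep0 : 0 < ep by rewrite divr_gt0// mulr_gt0.
have [dl dl0 uc] := unif_cont_segment (s + h) cf ep0.
have /cvgrPdist_lt/(_ dl dl0) n1 := cvg_pow2V h.
have /cvgrPdist_le/(_ (2^-1)) n2 := cvg_pow2V (theta * h).
have /cvgrPdist_le/(_ (e / 2)) n3 := cvg_pow2V (2 * theta ^+ 2 * h ^+ 2 * M).
have e2 : 0 < e / 2 by rewrite divr_gt0.
have i2 : 0 < 2^-1 :> R by rewrite invr_gt0.
move: n1 (n2 i2) (n3 e2); apply: filterS3 => n n1 {}n2 {}n3.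
have N0 : 0 < (2 ^ n)%:R :> R by rewrite ltr0n expn_gt0.
have N0' : (2 ^ n)%:R != 0 :> R by rewrite gt_eqF.
pose N := (2 ^ n)%:R : R; pose dt := h / N.
have dt0 : 0 < dt by rewrite divr_gt0.
have dtdl : dt < dl.
  have : `|0 - h / N| < dl by exact: n1.
  by rewrite sub0r normrN ger0_norm ?ltW.
have thdt : theta * dt <= 2^-1.
  have : `|0 - theta * h / N| <= 2^-1 by exact: n2.
  by rewrite sub0r normrN ger0_norm ?mulrA// ?divr_ge0 ?mulr_ge0// ltW.
have err : 2 * theta ^+ 2 * h ^+ 2 * M / N <= e / 2.
  have : `|0 - 2 * theta ^+ 2 * h ^+ 2 * M / N| <= e / 2 by exact: n3.
  by apply: le_trans; rewrite sub0r normrN ler_norm.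
pose u (j : nat) := h * j%:R / N.
pose E (j : nat) := expR (- (theta * (h - u j))).
have uS j : u j.+1 = u j + dt by rewrite /u -natr1 mulrDr mulr1 mulrDl.
have u0 j : 0 <= u j by rewrite divr_ge0 ?(ltW N0)// mulr_ge0// ltW.
have uN : u (2 ^ n)%N = h by rewrite /u mulfK.
have uh j : (j <= 2 ^ n)%N -> u j <= h.
  by move=> jn; rewrite -uN ler_pM2r ?invr_gt0// ler_pM2l// ler_nat.
have tele : y (s + h) - (mu + (y s - mu) * expR (- (theta * h))) =
    \sum_(j < 2 ^ n) (E j.+1 * (y (s + u j.+1) - mu) - E j * (y (s + u j) - mu)).
  rewrite -(big_mkord xpredT (fun j => E j.+1 * (y (s + u j.+1) - mu) - E j * (y (s + u j) - mu))).
  rewrite (telescope_sumr (fun j => E j * (y (s + u j) - mu)))// /E uN.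
  by rewrite /u mulr0 mul0r addr0 subr0 subrr mulr0 oppr0 expR0 mul1r mulrC opprD addrA.
rewrite tele /ou_sum -sumrB.
apply: (le_trans (ler_norm_sum _ _ _)).
apply: (@le_trans _ _ (\sum_(j < 2 ^ n) (2 * theta ^+ 2 * dt ^+ 2 * M + ep * dt))); last first.
  rewrite sumr_const card_ord -[leLHS]mulr_natr -/N.
  have -> : (2 * theta ^+ 2 * dt ^+ 2 * M + ep * dt) * N =
     2 * theta ^+ 2 * h ^+ 2 * M / N + e / 2.
    by rewrite /ep /dt; field; rewrite N0' gt_eqF.
  by rewrite [leRHS]splitr lerD2r.
apply: ler_sum => j _; have jn := ltn_ord j.
have Ej : E j.+1 = E j * expR (theta * dt).
  by rewrite /E uS -expRD; congr expR; ring.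
have E1 : E j <= 1.
  by rewrite -expR0 ler_expR oppr_le0 mulr_ge0 ?subr_ge0 ?uh ?(ltW th0)// ltnW.
have E0 : 0 <= E j by exact: expR_ge0.
set y1 := y (s + u j.+1); set y0 := y (s + u j).
pose a0 := s + u j; pose a1 := s + u j.+1.
have a00 : 0 <= a0 by rewrite addr_ge0.
have a01 : a0 <= a1 by rewrite lerD2l uS lerDl ltW.
have a10 : 0 <= a1 by exact: le_trans a01.
have a1h : a1 <= s + h by rewrite lerD2l uh.
have a10E : a1 - a0 = dt by rewrite /a1 /a0 uS; ring.
have osc : `|Rintegral lebesgue_measure `[0, a1] f - Rintegral lebesgue_measure `[0, a0] f
     - f a1 * (a1 - a0)| <= ep * (a1 - a0).
  apply: Rintegral_osc => //; first exact: cont_integrable_segment.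
  move=> r ar ra; apply/ltW/uc => //; [exact: le_trans (ltW ar)|exact: le_trans a1h|].
  rewrite distrC ger0_norm ?subr_ge0// (le_lt_trans _ dtdl)// -a10E.
  by rewrite lerD2l lerN2 ltW.
have S0 := sde _ a00; have S1 := sde _ a10.
rewrite -/f in S0 S1.
set I0 := Rintegral _ _ _ in S0 osc; set I1 := Rintegral _ _ _ in S1 osc.
(* Taking the drift at the right end makes its contribution cancel the first-order term of the
   exponential, leaving exp(z) - 1 - z. *)
have -> : E j.+1 * (y1 - mu) - E j * (y0 - mu) -
   sigma * E j * (b (s + u j.+1) - b (s + u j)) =
   E j * ((expR (theta * dt) - 1 - theta * dt) * (y1 - mu) + (I1 - I0 - f a1 * (a1 - a0))).
  rewrite Ej a10E /f -/y1.
  have -> : sigma * E j * (b (s + u j.+1) - b (s + u j)) = E j * (sigma * b a1 - sigma * b a0) by rewrite /a1 /a0; ring.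
  have -> : sigma * b a1 = y1 - x - I1 by rewrite /y1 S1; ring.
  have -> : sigma * b a0 = y0 - x - I0 by rewrite /y0 S0; ring.
  by ring.
rewrite normrM (ger0_norm E0).
apply: (le_trans (ler_piMl (normr_ge0 _) E1)).
apply: (le_trans (ler_normD _ _)); apply: lerD; last first.
  by rewrite -a10E.
rewrite normrM.
have t2 := expR_taylor2 (ltW (mulr_gt0 th0 dt0)) thdt.
have -> : 2 * theta ^+ 2 * dt ^+ 2 * M = (2 * (theta * dt) ^+ 2) * M by ring.
by apply: ler_pM => //; exact: yM.
Qed.

Lemma expR_cvg {R : realType} {I : Type} {F : set_system I} {FF : Filter F}
  (f : I -> R) (l : R) : f @ F --> l -> expR (f x) @[x --> F] --> expR l.
Proof. by move=> fl; apply: (cvg_comp f expR fl); exact: continuous_expR. Qed.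

Section ou_noise.
Context {R : realType} {d : measure_display} {T : measurableType d}.
Variables (P : probability T R) (B : R -> T -> R).
Hypothesis cP : measure_is_complete P.
Hypothesis hB : standard_BM P B.
Variables (theta sigma mu x : R) (Y : R -> T -> R).
Hypothesis th0 : 0 < theta.
Hypothesis cY : forall w, {within `[0, +oo[, continuous (fun t => Y t w)}.
Hypothesis sdeY : forall w t, 0 <= t ->
  Y t w = x + Rintegral lebesgue_measure `[0, t] (fun s => theta * (mu - Y s w)) + sigma * B t w.

Definition ou_noise s h w := Y (s + h) w - (mu + (Y s w - mu) * expR (- (theta * h))).
Let xi := ou_noise.

Let mB t : 0 <= t -> measurable_fun setT (B t).
Proof. by case: hB => _ _ + _ _; exact. Qed.

Let N0 n : 0 < (2 ^ n)%:R :> R. Proof. by rewrite ltr0n expn_gt0. Qed.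

Let ug (h : R) n (j : nat) : (j <= 2 ^ n)%N -> 0 < h -> 0 <= h * j%:R / (2 ^ n)%:R <= h.
Proof.
move=> jn h0; apply/andP; split; first by rewrite divr_ge0// mulr_ge0// ltW.
by rewrite ler_pdivrMr// ler_pM2l// ler_nat.
Qed.

Lemma ou_sum_noise_cvg s h w : 0 <= s -> 0 < h ->
  ou_sum theta sigma s h (B^~ w) @ \oo --> xi s h w.
Proof. by move=> s0 h0; have H := (@ou_sum_cvg R (Y^~ w) (B^~ w) theta sigma mu x s h th0 (@cY w) (@sdeY w) s0 h0); exact: H. Qed.

(** The noise is a pathwise limit of sums of increments over [s, s + h]; this is what makes it
    independent of the past. *)
Lemma ou_noise_meas s h : 0 <= s -> 0 < h -> meas_wrt (future_gen B s h) (xi s h).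
Proof.
move=> s0 h0.
apply: (@measurable_fun_cvg _ (g_sigma_algebraType (future_gen B s h)) _ setT
   (fun n w => ou_sum theta sigma s h (B^~ w) n)); last first.
  by move=> w _; exact: ou_sum_noise_cvg.
move=> n; apply: measurable_sum => j.
apply: measurable_funM; first exact: measurable_cst.
set b := s + _; set a := s + _.
have -> : (fun w : g_sigma_algebraType (future_gen B s h) => B b w - B a w) =
   (fun w => (B b w - B s w) - (B a w - B s w)) by apply/funext => w; ring.
have H i : (i <= 2 ^ n)%N -> meas_wrt (future_gen B s h)
    (fun w => B (s + h * i%:R / (2 ^ n)%:R) w - B s w).
  move=> i_n; apply: (@gen_by_meas _ _ _ _ _ (fun r w => B r w - B s w)) => /=.
  by rewrite lerDl lerD2l; exact: ug.
by apply: measurable_funB; apply: H => //; exact: ltnW.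
Qed.

Lemma Y0E w : Y 0 w = x.
Proof.
case: hB => B0 _ _ _ _.
by rewrite sdeY// set_itv1 Rintegral_set1 addr0 B0 mulr0 addr0.
Qed.

(** Started at time 0, the state is a constant plus the noise of [0, t], whose increments are values
    of B because B 0 = 0. *)
Lemma ou_adapted t : 0 <= t -> meas_wrt (past_gen P B t) (Y t).
Proof.
move=> t0; have [->|tn0] := eqVneq t 0.
  by have -> : Y 0 = cst x by [apply/funext => w; exact: Y0E]; exact: measurable_cst.
have tp : 0 < t by rewrite lt_neqAle eq_sym tn0.
have -> : Y t = (fun w => mu + (x - mu) * expR (- (theta * t)) + xi 0 t w).
  by apply/funext => w; rewrite /xi /ou_noise add0r Y0E; ring.
apply: measurable_funD; first exact: measurable_cst.
have := ou_noise_meas (lexx 0) tp; apply: meas_wrt_sub.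
case: hB => B0 _ _ _ _.
move=> _ [r [A [/= /andP[r0 rt] mA ->]]]; apply: sub_sigma_algebra; left.
exists r, A; split => //; first by rewrite add0r in rt.
by have -> : (fun w => B r w - B 0 w) = B r by apply/funext => w; rewrite B0 subr0.
Qed.

Lemma ou_freeze s h d1 (T1 : measurableType d1) (Z : T -> T1) (f : T1 * R -> \bar R) :
  0 <= s -> 0 < h -> meas_wrt (past_gen P B s) Z ->
  measurable_fun setT f -> (forall z, 0 <= f z)%E ->
  (\int[P]_w f (Z w, xi s h w) = \int[P]_w \int[P]_v f (Z w, xi s h v))%E.
Proof.
move=> s0 h0 mZ mf f0; apply: (@indep_sys_fubini _ _ _ P (past_gen P B s) (future_gen B s h)) => //.
- exact: past_gen_measurable.
- exact: future_gen_measurable hB _ _ s0.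
- exact: BM_indep.
- exact: ou_noise_meas.
Qed.

Lemma BM_incr_mgf s h c : 0 <= s -> 0 < h ->
  (\int[P]_w (expR (c * (B (s + h) w - B s w)))%:E = (expR (c ^+ 2 * h / 2))%:E)%E.
Proof.
move=> s0 h0; have sh : s < s + h by rewrite ltrDl.
have [_ _ _ _ /(_ s _ s0 sh) law] := hB.
have mD : measurable_fun setT (fun w => B (s + h) w - B s w).
  by apply: measurable_funB; apply: mB => //; rewrite addr_ge0// ltW.
pose D := mfun_Sub (mem_set mD).
have mE : measurable_fun setT (fun z : R => (expR (c * z))%:E).
  by apply/measurable_EFinP; apply: measurableT_comp => //; apply: measurable_funM.
pose D' : T -> measurableTypeR R := fun w => B (s + h) w - B s w.
have mD' : measurable_fun setT D' by exact: mD.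
transitivity (\int[pushforward P D']_z (expR (c * z))%:E)%E.
  by rewrite ge0_integral_pushforward.
transitivity (\int[normal_prob 0 (Num.sqrt (s + h - s))]_z (expR (c * z))%:E)%E.
  by apply: eq_measure_integral => A mA _; exact: law.
rewrite normal_mgf; last by rewrite gt_eqF// sqrtr_gt0 addrAC subrr add0r.
rewrite mulr0 add0r sqr_sqrtr; last by rewrite addrAC subrr add0r ltW.
by rewrite addrAC subrr add0r.
Qed.

(** Induction on the number of cells: the last increment is independent of the partial sum before it
    and contributes its own gaussian factor. *)
Lemma ou_sum_mgf s h n c : 0 <= s -> 0 < h ->
  (\int[P]_w (expR (c * ou_sum theta sigma s h (B^~ w) n))%:E =
   (expR (c ^+ 2 * sigma ^+ 2 / 2 *
      \sum_(j < 2 ^ n) (expR (- (theta * (h - h * j%:R / (2 ^ n)%:R))) ^+ 2 * (h / (2 ^ n)%:R))))%:E)%E.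
Proof.
move=> s0 h0.
pose E (j : nat) := expR (- (theta * (h - h * j%:R / (2 ^ n)%:R))).
pose u (j : nat) := h * j%:R / (2 ^ n)%:R.
pose S J w := \sum_(0 <= j < J) (sigma * E j * (B (s + u j.+1) w - B (s + u j) w)).
have uS j : u j.+1 = u j + h / (2 ^ n)%:R by rewrite /u -natr1 mulrDr mulr1 mulrDl.
have u0 j : 0 <= u j by rewrite divr_ge0// mulr_ge0// ltW.
have Bmeas r t : 0 <= r -> r <= t -> meas_wrt (past_gen P B t) (B r).
  by move=> r0 rt; apply/meas_wrtE => A mA; apply: sub_sigma_algebra; left; exists r, A.
have mS J t : s + u J <= t -> meas_wrt (past_gen P B t) (S J).
  move=> Jt; rewrite /S; under eq_fun do rewrite big_nat.
  under eq_fun do rewrite -big_nat big_mkord.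
  apply: measurable_sum => j; apply: measurable_funM; first exact: measurable_cst.
  have H i : (i <= J)%N -> s + u i <= t.
    move=> iJ; apply: le_trans Jt; rewrite lerD2l ler_pM2r ?invr_gt0// ler_pM2l// ler_nat//.
  apply: measurable_funB; apply: Bmeas; rewrite ?addr_ge0//; apply: H => //; exact: ltnW.
have key J : (J <= 2 ^ n)%N -> (\int[P]_w (expR (c * S J w))%:E =
   (expR (c ^+ 2 * sigma ^+ 2 / 2 * \sum_(0 <= j < J) (E j ^+ 2 * (h / (2 ^ n)%:R))))%:E)%E.
  elim: J => [_|J IH Jn].
    rewrite /S; under eq_integral do rewrite big_geq// mulr0 expR0.
    rewrite [in RHS]big_geq// mulr0 expR0 integral_cst// mul1e.
    exact: probability_setT.
  pose t := s + u J; have t0 : 0 <= t by rewrite addr_ge0.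
  pose dt := h / (2 ^ n)%:R; have dt0 : 0 < dt by rewrite divr_gt0.
  have tS : s + u J.+1 = t + dt by rewrite uS addrA.
  pose f (z : R * R) := (expR (c * z.1) * expR (c * (sigma * E J) * z.2))%:E : \bar R.
  have mf : measurable_fun setT f.
    apply/measurable_EFinP; apply: measurable_funM; apply: measurableT_comp => //;
      apply: measurable_funM => //; exact: measurable_fst || exact: measurable_snd.
  have -> : (\int[P]_w (expR (c * S J.+1 w))%:E =
     \int[P]_w f (S J w, (B (t + dt) w - B t w)%R))%E.
    apply: eq_integral => w _; rewrite /f/= -expRD; congr (expR _)%:E.
    by rewrite /S big_nat_recr//= tS; ring.
  rewrite (@indep_sys_fubini _ _ _ P (past_gen P B t) (future_gen B t dt))//; last 6 first.
  - exact: past_gen_measurable.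
  - exact: future_gen_measurable hB _ _ t0.
  - exact: BM_indep.
  - exact: mS.
  - apply: (@gen_by_meas _ _ _ _ _ (fun r w => B r w - B t w)) => /=.
    by rewrite lexx lerDl ltW.
  - by move=> z; rewrite lee_fin mulr_ge0// expR_ge0.
  rewrite /f/=.
  transitivity (\int[P]_w ((expR (c * S J w))%:E * (expR ((c * (sigma * E J)) ^+ 2 * dt / 2))%:E))%E.
    apply: eq_integral => w _; rewrite -(BM_incr_mgf _ t0 dt0) -ge0_integralZl//.
    - apply/measurable_EFinP; apply: measurableT_comp => //; apply: measurable_funM => //.
      by apply: measurable_funB; apply: mB => //; rewrite addr_ge0// ltW.
  rewrite ge0_integralZr//; last first.
  - apply/measurable_EFinP; apply: measurableT_comp => //; apply: measurable_funM => //.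
    apply: (meas_wrt_measurable (past_gen_measurable cP hB (s:=t))); exact: mS.
  rewrite IH ?(ltnW Jn)// -EFinM -expRD; congr (expR _)%:E.
  by rewrite (big_nat_recr J)//= -/dt; set sm := \sum_(0 <= j < J) _; field.
have := key _ (leqnn (2 ^ n)); rewrite /S big_mkord => <-.
by apply: eq_integral => w _; rewrite /ou_sum big_mkord.
Qed.

Definition ou_var h := sigma ^+ 2 * (1 - expR (- (theta * h)) ^+ 2) / (2 * theta).

(** The exponential moments of the Riemann sums converge with their variances; pathwise convergence
    and a second-moment bound transfer the value to the noise. *)
Lemma ou_noise_mgf s h c : 0 <= s -> 0 < h ->
  (\int[P]_w (expR (c * xi s h w))%:E = (expR (c ^+ 2 * ou_var h / 2))%:E)%E.
Proof.
move=> s0 h0.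
pose V n := \sum_(j < 2 ^ n) (expR (- (theta * (h - h * j%:R / (2 ^ n)%:R))) ^+ 2 * (h / (2 ^ n)%:R)).
have cV : V @ \oo --> (1 - expR (- (theta * h)) ^+ 2) / (2 * theta).
  have th2 : 0 < 2 * theta by rewrite mulr_gt0.
  (* The variance sum is itself an [ou_sum]: the constant path 1 solves the equation with rate 2
     theta, mean 0 and driver 2 theta t, so the deterministic limit needs no separate
     integration. *)
  have := @ou_sum_cvg R (cst 1) id (2 * theta) (2 * theta) 0 1 s h th2.
  have c1 : {within `[0, +oo[, continuous (cst 1 : R -> R)} by move=> r; exact: cvg_cst.
  move=> /(_ c1) H.
  have {}H := H _ s0 h0.
  have {H} : ou_sum (2 * theta) (2 * theta) s h id @ \oo --> 1 - expR (- (2 * theta * h)).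
    rewrite [X in _ --> X](_ : _ = 1 - (0 + (1 - 0) * expR (- (2 * theta * h)))); last by ring.
    apply: H => t t0 /=.
    rewrite (@Rintegral_cst _ _ _ lebesgue_measure)//.
    have -> : fine (lebesgue_measure (`[0, t]%classic : set R)) = t.
      rewrite lebesgue_measure_itv/= lte_fin; case: ltP => //=; first by rewrite subr0.
      by move=> t0'; apply/eqP; rewrite eq_le t0 t0'.
    by ring.
  move=> H.
  have -> : V = (fun n => ou_sum (2 * theta) (2 * theta) s h id n / (2 * theta)).
    apply/funext => n; rewrite /V /ou_sum mulr_suml; apply: eq_bigr => j _.
    rewrite -expRM_natl/= -natr1; set e1 := expR _; set e2 := expR _.
    have -> : e1 = e2 by rewrite /e1 /e2; congr expR; ring.
    field.
    by rewrite !gt_eqF.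
  rewrite -expRM_natl; apply: cvgM; last exact: cvg_cst.
  by have -> : 2%:R * - (theta * h) = - (2 * theta * h) by ring.
(* This bounds the exponential moment at 2 c, which is the second moment of the variable at c. *)
have Vb n : V n <= h.
  apply: (@le_trans _ _ (\sum_(j < 2 ^ n) (h / (2 ^ n)%:R))).
    apply: ler_sum => j _; rewrite ler_piMl ?divr_ge0 ?(ltW h0)//.
    rewrite exprn_ile1 ?expR_ge0// -[leRHS]expR0 ler_expR oppr_le0 mulr_ge0 ?(ltW th0)//.
    by rewrite subr_ge0; have /andP[] := ug (ltnW (ltn_ord j)) h0.
  by rewrite sumr_const card_ord -[leLHS]mulr_natr mulfVK// gt_eqF.
apply: (@expectation_cvg_bounded_L2 _ _ _ P (fun n w => expR (c * ou_sum theta sigma s h (B^~ w) n)) _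
  (fun n => expR (c ^+ 2 * sigma ^+ 2 / 2 * V n)) _ (expR ((2 * c) ^+ 2 * sigma ^+ 2 / 2 * h))).
- move=> n; apply: measurableT_comp => //; apply: measurable_funM => //.
  apply: measurable_sum => j; apply: measurable_funM => //.
  have [/andP[u0 _] [/andP[u1 _]]] := (ug (ltnW (ltn_ord j)) h0, ug (ltn_ord j) h0).
  by apply: measurable_funB; apply: mB; rewrite addr_ge0.
- by move=> n w; exact: expR_ge0.
- move=> w; apply: expR_cvg.
  by apply: cvgM; [exact: cvg_cst|exact: ou_sum_noise_cvg].
- by move=> n; exact: ou_sum_mgf.
- move=> n; under eq_integral do rewrite -expRM_natl mulrA.
  rewrite ou_sum_mgf// lee_fin ler_expR ler_wpM2l// ?Vb//.
  by rewrite divr_ge0// mulr_ge0// sqr_ge0.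
- apply: expR_cvg.
  rewrite (_ : c ^+ 2 * ou_var h / 2 = c ^+ 2 * sigma ^+ 2 / 2 * ((1 - expR (- (theta * h)) ^+ 2) / (2 * theta))).
    by apply: cvgM; [exact: cvg_cst|exact: cV].
  by rewrite /ou_var; field; rewrite gt_eqF.
Qed.
End ou_noise.

(** The bracket is (u - 1/u)^2 with u = exp(z / 2), and u - 1/u >= z / 2 for z >= 0. It turns the
    exponential moments at 1 and -1 into a second-moment bound. *)
Lemma expR_cosh_ge {R : realType} (z : R) : z ^+ 2 <= 4 * (expR z + expR (- z) - 2).
Proof.
wlog z0 : z / 0 <= z.
  move=> H; have [/H//|/ltW z0] := leP 0 z.
  by have := H (- z); rewrite sqrrN opprK oppr_ge0 [_ + expR z]addrC; exact.
have h1 := expR_ge1Dx (z / 2).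
have h2 : expR (- (z / 2)) <= 1.
  by rewrite -[leRHS]expR0 ler_expR oppr_le0 divr_ge0.
have e1 : expR z = expR (z / 2) ^+ 2 by rewrite expr2 -expRD -splitr.
have e2 : expR (- z) = expR (- (z / 2)) ^+ 2 by rewrite expr2 -expRD -opprD -splitr.
have e3 : expR (z / 2) * expR (- (z / 2)) = 1 by rewrite -expRD subrr expR0.
rewrite e1 e2.
have -> : expR (z / 2) ^+ 2 + expR (- (z / 2)) ^+ 2 - 2 = (expR (z / 2) - expR (- (z / 2))) ^+ 2.
  rewrite sqrrB e3; ring.
have h3 : z / 2 <= expR (z / 2) - expR (- (z / 2)) by lra.
have h4 : 0 <= z / 2 by rewrite divr_ge0.
have : (z / 2) ^+ 2 <= (expR (z / 2) - expR (- (z / 2))) ^+ 2.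
  by rewrite lerXn2r// nnegrE// (le_trans h4).
by rewrite expr_div_n; lra.
Qed.

Lemma expRB1_le {R : realType} (z : R) : expR z - 1 <= z * expR z.
Proof.
have h := expR_ge1Dx (- z); have e0 := expR_gt0 z.
have e3 : expR z * expR (- z) = 1 by rewrite -expRD subrr expR0.
have : expR z * (1 - z) <= expR z * expR (- z) by rewrite ler_pM2l.
rewrite e3; lra.
Qed.

(** * Markov step and moments of the noise *)

Section ou_moments.
Context {R : realType} {d : measure_display} {T : measurableType d}.
Variables (P : probability T R) (B : R -> T -> R).
Hypothesis cP : measure_is_complete P.
Hypothesis hB : standard_BM P B.
Variables (theta sigma mu x : R) (Y : R -> T -> R).
Hypothesis th0 : 0 < theta.
Hypothesis cY : forall w, {within `[0, +oo[, continuous (fun t => Y t w)}.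
Hypothesis sdeY : forall w t, 0 <= t ->
  Y t w = x + Rintegral lebesgue_measure `[0, t] (fun s => theta * (mu - Y s w)) + sigma * B t w.

Let xi := ou_noise theta mu Y.
Let v := ou_var theta sigma.
Definition ou_mean h y := mu + (y - mu) * expR (- (theta * h)).
Let m := ou_mean.

Lemma Y_meas t : 0 <= t -> measurable_fun setT (Y t).
Proof.
move=> t0; apply: (meas_wrt_measurable (past_gen_measurable cP hB (s:=t))).
exact: (ou_adapted hB th0 cY sdeY t0).
Qed.

Lemma xi_mfun s h : 0 <= s -> 0 < h -> measurable_fun setT (xi s h).
Proof.
move=> s0 h0; have H := ou_noise_meas th0 cY sdeY s0 h0.
exact: (meas_wrt_measurable (@future_gen_measurable _ _ _ P B hB s h s0) H).
Qed.

Lemma Y_step s h w : Y (s + h) w = m h (Y s w) + xi s h w.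
Proof. by rewrite /m /ou_mean /xi /ou_noise; ring. Qed.

(** Markov property in integral form. The companion Z is any past-measurable variable, so that a
    control level or the indicator of an event can travel with the state. *)
Lemma ou_step s h d1 (T1 : measurableType d1) (Z : T -> T1) (F : T1 * R -> \bar R) :
  0 <= s -> 0 < h -> meas_wrt (past_gen P B s) Z ->
  measurable_fun setT F -> (forall z, 0 <= F z)%E ->
  (\int[P]_w F (Z w, Y (s + h) w) = \int[P]_w \int[P]_u F (Z w, m h (Y s w) + xi s h u)%R)%E.
Proof.
move=> s0 h0 mZ mF F0.
pose Z' w := (Z w, Y s w).
have mZ' : meas_wrt (past_gen P B s) Z'.
  by apply: measurable_fun_pair => //; exact: (ou_adapted hB th0 cY sdeY s0).
pose f (z : (T1 * R) * R) := F (z.1.1, m h z.1.2 + z.2).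
have mf : measurable_fun setT f.
  apply: (measurableT_comp mF); apply: measurable_fun_pair.
    by apply: measurableT_comp => //; exact: measurable_fst.
  apply: measurable_funD; last exact: measurable_snd.
  apply: measurable_funD => //; apply: measurable_funM => //; apply: measurable_funB => //.
  exact: (measurableT_comp measurable_snd measurable_fst).
have := @ou_freeze _ _ _ P B cP hB theta sigma mu x Y th0 cY sdeY s h _ _ Z' f s0 h0 mZ' mf (fun z => F0 _).
by rewrite /f/= => <-; apply: eq_integral => w _; rewrite Y_step.
Qed.

Lemma ou_step_le s h d1 (T1 : measurableType d1) (Z : T -> T1) (F : T1 * R -> \bar R)
    (F' : T -> \bar R) :
  0 <= s -> 0 < h -> meas_wrt (past_gen P B s) Z ->
  measurable_fun setT F -> (forall z, 0 <= F z)%E -> measurable_fun setT F' ->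
  (forall w, \int[P]_u F (Z w, m h (Y s w) + xi s h u)%R <= F' w)%E ->
  (\int[P]_w F (Z w, Y (s + h) w) <= \int[P]_w F' w)%E.
Proof.
move=> s0 h0 mZ mF F0 mF' FF'; rewrite (ou_step s0 h0 mZ mF F0).
apply: ge0_le_integral => //; first by move=> w _; apply: integral_ge0.
apply: (@measurable_fun_fubini_tonelli_F _ _ T T R P
  (fun z => F (Z z.1, m h (Y s z.1) + xi s h z.2))) => //.
apply: (measurableT_comp mF); apply: measurable_fun_pair.
  apply: measurableT_comp; last exact: measurable_fst.
  exact: (meas_wrt_measurable (@past_gen_measurable _ _ _ P B cP hB s) mZ).
apply: measurable_funD.
  apply: measurable_funD => //; apply: measurable_funM => //; apply: measurable_funB => //.
  by apply: (measurableT_comp (Y_meas s0)); exact: measurable_fst.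
by apply: (measurableT_comp (xi_mfun s0 h0)); exact: measurable_snd.
Qed.

Lemma ou_var_ge0 h : 0 <= h -> 0 <= v h.
Proof.
move=> h0; apply: divr_ge0; last by rewrite mulr_ge0// ltW.
apply: mulr_ge0; first exact: sqr_ge0.
rewrite subr_ge0; apply: exprn_ile1; first exact: expR_ge0.
rewrite -[leRHS]expR0 ler_expR oppr_le0.
by rewrite mulr_ge0// ltW.
Qed.

Lemma ou_var_le h : 0 <= h -> v h <= sigma ^+ 2 * h.
Proof.
move=> h0; rewrite /v /ou_var ler_pdivrMr ?mulr_gt0//.
rewrite -[leRHS]mulrA ler_wpM2l ?sqr_ge0// lerBlDl.
have -> : expR (- (theta * h)) ^+ 2 = expR (- (2 * theta * h)).
  by rewrite expr2 -expRD; congr expR; ring.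
by have := expR_ge1Dx (- (2 * theta * h)); lra.
Qed.

Lemma ou_var_ub h : 0 <= h -> v h <= sigma ^+ 2 / (2 * theta).
Proof.
move=> h0; rewrite /v /ou_var ler_pM2r ?invr_gt0 ?mulr_gt0//.
by rewrite ler_piMr ?sqr_ge0// lerBlDr lerDl sqr_ge0.
Qed.

(** From E xi^2 <= 8 (exp(v / 2) - 1) <= 4 v exp(v / 2); the exponential is bounded uniformly in the
    step because v <= sigma^2 / (2 theta). *)
Definition noise_const := 4 * expR (sigma ^+ 2 / (2 * theta)).

Lemma ou_noise_sq s h : 0 <= s -> 0 < h ->
  (\int[P]_w (xi s h w ^+ 2)%:E <= (noise_const * (sigma ^+ 2 * h))%:E)%E.
Proof.
move=> s0 h0.
have mx := xi_mfun s0 h0.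
have mexp c : measurable_fun setT (fun w => (expR (c * xi s h w))%:E).
  by apply/measurable_EFinP; apply: measurableT_comp => //; apply: measurable_funM.
have H c := @ou_noise_mgf _ _ _ P B cP hB theta sigma mu x Y th0 cY sdeY s h c s0 h0.
rewrite -/xi -/v in H.
have : (\int[P]_w ((xi s h w ^+ 2)%:E + 8%:E) <= \int[P]_w (4%:E * (expR (1 * xi s h w))%:E + 4%:E * (expR (- 1 * xi s h w))%:E))%E.
  apply: ge0_le_integral => //.
  - by move=> w _; rewrite -EFinD lee_fin addr_ge0// sqr_ge0.
  - by apply: emeasurable_funD => //; apply/measurable_EFinP; exact: measurable_funX.
  - by apply: emeasurable_funD; apply: emeasurable_funM.
  - move=> w _; rewrite -!EFinM -!EFinD lee_fin mul1r mulN1r.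
    by have := expR_cosh_ge (xi s h w); lra.
rewrite ge0_integralD//; last 2 first.
  - by move=> w _; rewrite lee_fin sqr_ge0.
  - by apply/measurable_EFinP; exact: measurable_funX.
rewrite ge0_integralD//; last 2 first.
  - by apply: emeasurable_funM.
  - by apply: emeasurable_funM.
rewrite !ge0_integralZl// !H integral_cst// sqrrN expr1n !mul1r.
have PT : P setT = 1%E by exact: probability_setT.
rewrite [X in (_ + _ * X)%E]PT mule1 -leeBrDr//.
move=> /le_trans; apply.
apply: (@le_trans _ _ ((4 * expR (v h / 2) + 4 * expR (v h / 2) - 8)%:E)); first by [].
rewrite lee_fin.
have v0 := ou_var_ge0 (ltW h0); have v1 := ou_var_le (ltW h0); have v2 := ou_var_ub (ltW h0).
have := expRB1_le (v h / 2); rewrite /noise_const.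
have e1 : expR (v h / 2) <= expR (sigma ^+ 2 / (2 * theta)) by rewrite ler_expR; lra.
have e0 := expR_gt0 (v h / 2).
move=> h1; apply: (@le_trans _ _ (8 * (v h / 2 * expR (v h / 2)))); first lra.
rewrite -mulrA.
have : v h * expR (v h / 2) <= (sigma ^+ 2 * h) * expR (sigma ^+ 2 / (2 * theta)).
  by apply: ler_pM => //; exact: ltW.
lra.
Qed.

Lemma ou_noise_integrable s h : 0 <= s -> 0 < h -> P.-integrable setT (EFin \o xi s h).
Proof.
move=> s0 h0; have mx := xi_mfun s0 h0.
apply/integrableP; split; first exact/measurable_EFinP.
apply: (@le_lt_trans _ _ (\int[P]_w (1%:E + (xi s h w ^+ 2)%:E))%E).
  apply: ge0_le_integral => //.
  - by apply: measurableT_comp => //; exact/measurable_EFinP.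
  - by apply: emeasurable_funD => //; apply/measurable_EFinP; exact: measurable_funX.
  - move=> w _; rewrite /= -EFinD lee_fin.
    set z := xi s h w; have [z1|z1] := leP 0 z; [rewrite ger0_norm//|rewrite ltr0_norm//]; nra.
rewrite ge0_integralD//; last 2 first.
  - by move=> w _; rewrite lee_fin sqr_ge0.
  - by apply/measurable_EFinP; exact: measurable_funX.
rewrite integral_cst// mul1e.
apply: lte_add_pinfty; first exact: le_lt_trans (probability_le1 P measurableT) (ltry 1).
exact: le_lt_trans (ou_noise_sq s0 h0) (ltry _).
Qed.

(** By 1 + z <= exp z, c E[xi] is at most the exponential moment at c minus 1, which is O(c^2);
    dividing by c of either sign and letting c tend to 0 kills the mean. *)
Lemma ou_noise_mean s h : 0 <= s -> 0 < h -> (\int[P]_w (xi s h w)%:E = 0)%E.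
Proof.
move=> s0 h0; have mx := xi_mfun s0 h0; have ix := ou_noise_integrable s0 h0.
have fin : (\int[P]_w (xi s h w)%:E)%E \is a fin_num by exact: integrable_fin_num.
rewrite -(fineK fin); set e := fine _.
have H c : c * e <= c ^+ 2 * v h / 2 * expR (c ^+ 2 * v h / 2).
  have : (\int[P]_w (1%:E + c%:E * (xi s h w)%:E) <= \int[P]_w (expR (c * xi s h w))%:E)%E.
    apply: le_integral => //.
    - apply: integrableD => //; first exact: (finite_measure_integrable_cst P 1 measurableT).
      exact: integrableZl.
    - apply/integrableP; split.
        by apply/measurable_EFinP; apply: measurableT_comp => //; apply: measurable_funM.
      under eq_integral do rewrite gee0_abs ?lee_fin ?expR_ge0//.
      by rewrite (ou_noise_mgf cP hB th0 cY sdeY c s0 h0) ltry.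
    - by move=> w _; rewrite -EFinM -EFinD lee_fin expR_ge1Dx.
  rewrite (ou_noise_mgf cP hB th0 cY sdeY c s0 h0) -/v.
  rewrite integralD//; last 2 first.
    - exact: (finite_measure_integrable_cst P 1 measurableT).
    - exact: integrableZl.
  have PT : P setT = 1%E by exact: probability_setT.
  rewrite integral_cst// [X in (_ * X)%E]PT mule1 integralZl// -(fineK fin) -/e -EFinM -EFinD lee_fin.
  by have := expRB1_le (c ^+ 2 * v h / 2); lra.
have v0 := ou_var_ge0 (ltW h0).
pose K := v h / 2 * expR (v h / 2).
have K0 : 0 <= K by rewrite mulr_ge0 ?expR_ge0// divr_ge0.
have H2 c : 0 <= c -> c <= 1 -> c ^+ 2 * v h / 2 * expR (c ^+ 2 * v h / 2) <= c ^+ 2 * K.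
  move=> c0 c1; have -> : c ^+ 2 * K = c ^+ 2 * v h / 2 * expR (v h / 2) by rewrite /K; ring.
  apply: ler_wpM2l; first by rewrite divr_ge0// mulr_ge0// sqr_ge0.
  rewrite ler_expR.
  by rewrite ler_pM2r ?invr_gt0// ler_piMl// exprn_ile1.
have e0 : `|e| <= 0.
  apply/ler_addgt0Pr => ep ep0.
  pose c := Num.min 1 (ep / (K + 1)).
  have K1 : 0 < K + 1 by rewrite ltr_wpDl.
  have c0 : 0 < c by rewrite lt_min ltr01 divr_gt0.
  have c1 : c <= 1 by rewrite ge_min lexx.
  have cK : c * K <= ep.
    have : c <= ep / (K + 1) by rewrite ge_min lexx orbT.
    rewrite ler_pdivlMr//; nra.
  rewrite add0r ler_norml; apply/andP; split.
    rewrite lerNl; have := H (- c); rewrite sqrrN => /le_trans/(_ (H2 _ (ltW c0) c1)).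
    rewrite mulNr -mulrN expr2 -mulrA ler_pM2l// => /le_trans; exact.
  have := H c => /le_trans/(_ (H2 _ (ltW c0) c1)).
  by rewrite expr2 -mulrA ler_pM2l// => /le_trans; exact.
by move: e0; rewrite normr_le0 => /eqP ->.
Qed.
End ou_moments.

(** * Maximal inequality *)

Section ou_maximal.
Context {R : realType} {d : measure_display} {T : measurableType d}.
Variables (P : probability T R) (B : R -> T -> R).
Hypothesis cP : measure_is_complete P.
Hypothesis hB : standard_BM P B.
Variables (theta sigma mu x : R) (Y : R -> T -> R).
Hypothesis th0 : 0 < theta.
Hypothesis cY : forall w, {within `[0, +oo[, continuous (fun t => Y t w)}.
Hypothesis sdeY : forall w t, 0 <= t ->
  Y t w = x + Rintegral lebesgue_measure `[0, t] (fun s => theta * (mu - Y s w)) + sigma * B t w.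
Variable lam : R.
Hypothesis lam0 : 0 < lam.

Let xi := ou_noise theta mu Y.
Let m := ou_mean theta mu.
Let K := theta * mu ^+ 2 + noise_const theta sigma * sigma ^+ 2.

(** The mean map is a convex combination of y and mu with weight 1 - exp(-theta h) <= theta h on mu;
    convexity of the square and the linear noise bound produce the two summands of K. *)
Lemma ou_kernel_sq s h y : 0 <= s -> 0 < h ->
  (\int[P]_u ((m h y + xi s h u) ^+ 2)%:E <= (y ^+ 2 + h * K)%:E)%E.
Proof.
move=> s0 h0.
have ix := ou_noise_integrable cP hB th0 cY sdeY s0 h0; rewrite -/xi in ix.
have mx := xi_mfun hB th0 cY sdeY s0 h0; rewrite -/xi in mx.
have sqle := ou_noise_sq cP hB th0 cY sdeY s0 h0; rewrite -/xi in sqle.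
have isq : P.-integrable setT (fun w => (xi s h w ^+ 2)%:E).
  apply/integrableP; split; first by apply/measurable_EFinP; exact: measurable_funX.
  under eq_integral do rewrite gee0_abs ?lee_fin ?sqr_ge0//.
  exact: le_lt_trans sqle (ltry _).
have icst (c : R) : P.-integrable setT (fun w => c%:E).
  exact: (finite_measure_integrable_cst P c measurableT).
have ilin : P.-integrable setT (fun w => ((2 * m h y)%:E * (xi s h w)%:E)%E).
  exact: integrableZl.
rewrite (eq_integral (fun u => (m h y ^+ 2)%:E + ((2 * m h y)%:E * (xi s h u)%:E + (xi s h u ^+ 2)%:E))%E); last first.
  by move=> u _; rewrite -EFinM -!EFinD; congr EFin; ring.
rewrite integralD//; last exact: integrableD.
rewrite integralD//.
have PT : P setT = 1%E by exact: probability_setT.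
rewrite integral_cst// [X in (_ * X)%E]PT mule1 integralZl//.
have -> : (\int[P]_w (xi s h w)%:E = 0)%E by exact: (ou_noise_mean cP hB th0 cY sdeY s0 h0).
rewrite mule0 add0e.
apply: (@le_trans _ _ ((m h y ^+ 2)%:E + (noise_const theta sigma * (sigma ^+ 2 * h))%:E)%E).
  by rewrite leeD2l.
rewrite -EFinD lee_fin.
have : m h y ^+ 2 <= y ^+ 2 + h * theta * mu ^+ 2; last by rewrite /K; lra.
rewrite /m /ou_mean; set r := expR _.
have r0 : 0 <= r by exact: expR_ge0.
have r1 : r <= 1 by rewrite -[leRHS]expR0 ler_expR oppr_le0 mulr_ge0// ltW.
have r2 : 1 - r <= h * theta by have := expR_ge1Dx (- (theta * h)); rewrite -/r; lra.
have : (mu + (y - mu) * r) ^+ 2 <= (1 - r) * mu ^+ 2 + r * y ^+ 2.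
  rewrite -subr_ge0.
  have -> : (1 - r) * mu ^+ 2 + r * y ^+ 2 - (mu + (y - mu) * r) ^+ 2 = r * (1 - r) * (y - mu) ^+ 2 by ring.
  by rewrite mulr_ge0 ?sqr_ge0// mulr_ge0// subr_ge0.
move=> /le_trans; apply; rewrite addrC; apply: lerD.
  by rewrite ler_piMl ?sqr_ge0.
by rewrite ler_wpM2r ?sqr_ge0.
Qed.

(* [lyap] is a Lyapunov function: [e^{-lam t} lyap(Y_t)] is a supermartingale. *)
Definition lyap y := K / lam + y ^+ 2.
Let V := lyap.

Lemma lyap_ge0 y : 0 <= V y.
Proof.
rewrite /V /lyap addr_ge0 ?sqr_ge0// divr_ge0 ?(ltW lam0)// /K.
apply: addr_ge0; apply: mulr_ge0; rewrite ?sqr_ge0// ?(ltW th0)//.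
by rewrite mulr_ge0// expR_ge0.
Qed.

Lemma lyap_meas : measurable_fun setT V.
Proof. by apply: measurable_funD => //; apply: measurable_funX. Qed.

(** Multiplying K / lam by lam h gives back the growth h K of the second moment, and 1 + lam h <=
    exp(lam h). *)
Lemma lyap_kernel s h y : 0 <= s -> 0 < h ->
  (\int[P]_u (V (m h y + xi s h u))%:E <= (expR (lam * h) * V y)%:E)%E.
Proof.
move=> s0 h0.
have mx := xi_mfun hB th0 cY sdeY s0 h0; rewrite -/xi in mx.
have K0 : 0 <= K / lam by have := lyap_ge0 0; rewrite /V /lyap expr0n addr0.
rewrite (eq_integral (fun u => (K / lam)%:E + ((m h y + xi s h u) ^+ 2)%:E)%E)//.
rewrite ge0_integralD//; last 2 first.
- by move=> u _; rewrite lee_fin sqr_ge0.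
- by apply/measurable_EFinP; apply: measurable_funX; apply: measurable_funD.
have PT : P setT = 1%E by exact: probability_setT.
rewrite integral_cst// [X in (_ * X)%E]PT mule1.
apply: (le_trans (leeD2l _ (ou_kernel_sq y s0 h0))).
rewrite -EFinD lee_fin /V /lyap.
apply: (@le_trans _ _ ((1 + lam * h) * (K / lam + y ^+ 2))).
  have -> : (1 + lam * h) * (K / lam + y ^+ 2) = K / lam + (y ^+ 2 + h * K) + lam * h * y ^+ 2.
    by field; rewrite gt_eqF.
  by rewrite lerDl mulr_ge0 ?sqr_ge0// mulr_ge0// ltW.
by rewrite ler_wpM2r ?lyap_ge0// expR_ge1Dx.
Qed.

Let lvl (t : R) w := expR (- (lam * t)) * V (Y t w).

Let lvl_past s t : 0 <= s -> s <= t -> meas_wrt (past_gen P B t) (lvl s).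
Proof.
move=> s0 st; apply: measurable_funM; first exact: measurable_cst.
apply: (measurableT_comp lyap_meas).
have := ou_adapted hB th0 cY sdeY s0; apply: meas_wrt_sub => E.
move=> [[r [A [r0 rs mA ->]]]|nE]; apply: sub_sigma_algebra; [left|by right].
by exists r, A; split => //; exact: le_trans st.
Qed.

Let ok (h a : R) (k : nat) w := [forall j : 'I_k.+1, lvl (j%:R * h) w <= a].

Let okS h a k w : ok h a k.+1 w = ok h a k w && (lvl (k.+1%:R * h) w <= a).
Proof.
apply/forallP/andP => [H|[/forallP H1 H2] j].
  split; last exact: (H ord_max).
  by apply/forallP => j; exact: (H (widen_ord (leqnSn _) j)).
have [jk|kj] := ltnP j k.+1; first exact: (H1 (Ordinal jk)).
have -> : (j : nat) = k.+1 by apply/eqP; rewrite eqn_leq kj -ltnS ltn_ord.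
exact: H2.
Qed.

Let Z h a k w : R := (ok h a k w)%:R.

Let Z_past h a k : 0 < h -> meas_wrt (past_gen P B (k%:R * h)) (Z h a k).
Proof.
move=> h0.
have ble k' (j : 'I_k'.+1) : (j%:R * h <= k'%:R * h :> R) by rewrite ler_pM2r// ler_nat -ltnS.
have : @measurable_fun _ _ (g_sigma_algebraType (past_gen P B (k%:R * h))) bool setT (ok h a k).
  have H j : (j <= k)%N -> @measurable_fun _ _ (g_sigma_algebraType (past_gen P B (k%:R * h))) bool setT (fun w => lvl (j%:R * h) w <= a).
    move=> jk; apply: measurable_fun_ler; last exact: measurable_cst.
    by apply: lvl_past; rewrite ?mulr_ge0 ?(ltW h0)// ler_pM2r// ler_nat.
  have : forall j, (j <= k)%N -> @measurable_fun _ _ (g_sigma_algebraType (past_gen P B (k%:R * h))) bool setT (ok h a j).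
    elim=> [_|j IH jk].
      have -> : ok h a 0 = (fun w => lvl (0%:R * h) w <= a).
        apply/funext => w; apply/forallP/idP => [H0|H0 i]; first exact: (H0 ord0).
        by rewrite ord1.
      exact: H.
    have -> : ok h a j.+1 = (fun w => ok h a j w && (lvl (j.+1%:R * h) w <= a)).
      by apply/funext => w; exact: okS.
    apply: measurable_and; last exact: H.
    by apply: IH; exact: ltnW.
  by apply.
move=> mok; have -> : Z h a k = (fun w => if ok h a k w then 1 else 0).
  by apply/funext => w; rewrite /Z; case: ok.
by apply: measurable_fun_ifT => //; exact: measurable_cst.
Qed.

(** Doob's maximal inequality by hand: W follows the discounted Lyapunov level and is frozen at a
    once the level has exceeded it. Its expectation never rises above V x, and it equals a on the
    bad event. *)
Lemma ou_maximal_grid h a N : 0 < h -> 0 < a ->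
  (P [set w | ~~ ok h a N w] <= (V x / a)%:E)%E.
Proof.
move=> h0 a0.
pose W k w := if ok h a k w then lvl (k%:R * h) w else a.
have kh0 k : 0 <= k%:R * h by rewrite mulr_ge0// ltW.
have lvl0 t w : 0 <= lvl t w by rewrite mulr_ge0 ?expR_ge0 ?lyap_ge0.
have mok k : measurable_fun setT (Z h a k).
  have H := @Z_past h a k h0; apply: (@meas_wrt_measurable _ _ _ _ _ _ _ H); exact: past_gen_measurable.
have mlvl t : 0 <= t -> measurable_fun setT (lvl t).
  by move=> t0; exact: (meas_wrt_measurable (past_gen_measurable cP hB (s:=t)) (lvl_past t0 (lexx t))).
have WE k : W k = (fun w => Z h a k w * lvl (k%:R * h) w + (1 - Z h a k w) * a).
  by apply/funext => w; rewrite /W /Z; case: ok => /=; ring.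
have mW k : measurable_fun setT (W k).
  rewrite WE; apply: measurable_funD; apply: measurable_funM => //; first exact: mlvl.
  by apply: measurable_funB.
have W0 k w : 0 <= W k w by rewrite /W; case: ok => //; exact: ltW.
have IW k : (\int[P]_w (W k w)%:E <= (V x)%:E)%E.
  elim: k => [|k IH].
    apply: (@le_trans _ _ (\int[P]_w (V x)%:E)%E).
      apply: ge0_le_integral => //.
      - by move=> w _; rewrite lee_fin.
      - exact/measurable_EFinP.
      - move=> w _; rewrite lee_fin /W.
        have l0 : lvl (0%:R * h) w = V x by rewrite /lvl mul0r mulr0 oppr0 expR0 mul1r (Y0E hB sdeY).
        have [_|/forallPn[j]] := boolP (ok h a 0 w); first by rewrite l0.
        by rewrite ord1 /= l0 -ltNge => /ltW.
    have PT : P setT = 1%E by exact: probability_setT.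
    by rewrite integral_cst// [X in (_ * X)%E]PT mule1.
  apply: le_trans IH.
  (* The absolute values only serve to make F nonnegative on all of R x R, as [ou_step_le] demands;
     on indicator values they change nothing. *)
  pose F (z : R * R) := (`|z.1| * (expR (- (lam * (k.+1%:R * h))) * V z.2) + `|1 - z.1| * a)%:E : \bar R.
  have mF : measurable_fun setT F.
    apply/measurable_EFinP; apply: measurable_funD; apply: measurable_funM => //.
    - by apply: measurableT_comp => //; exact: measurable_fst.
    - by apply: measurable_funM => //; apply: (measurableT_comp lyap_meas); exact: measurable_snd.
    - by apply: measurableT_comp => //; apply: measurable_funB => //; exact: measurable_fst.
  have F0 z : (0 <= F z)%E.
    by rewrite lee_fin addr_ge0 ?mulr_ge0 ?expR_ge0 ?lyap_ge0 ?(ltW a0).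
  apply: (@le_trans _ _ (\int[P]_w F (Z h a k w, Y (k%:R * h + h)%R w))%E).
    apply: ge0_le_integral => //.
    - by move=> w _; rewrite lee_fin.
    - exact/measurable_EFinP.
    - apply: (measurableT_comp mF); apply: measurable_fun_pair => //.
      by apply: (Y_meas cP hB th0 cY sdeY); rewrite addr_ge0// ltW.
    - move=> w _; rewrite lee_fin /F /= /W okS /Z.
      have -> : k%:R * h + h = k.+1%:R * h by rewrite -natr1 mulrDl mul1r.
      case: (ok h a k w) => /=; last by rewrite normr0 mul0r add0r subr0 normr1 mul1r.
      rewrite normr1 mul1r subrr normr0 mul0r addr0 -/(lvl (k.+1%:R * h) w).
      by case: ifPn => //; rewrite -ltNge => /ltW.
  have zp := @Z_past h a k h0.
  apply: (@ou_step_le _ _ _ P B cP hB theta sigma mu x Y th0 cY sdeY _ h _ _ (Z h a k) F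
    (fun w => (W k w)%:E) (kh0 k) h0 zp mF F0).
    exact/measurable_EFinP.
  move=> w; rewrite /F /= /W /Z; case: (ok h a k w) => /=.
    rewrite normr1 subrr normr0 mul0r.
    under eq_integral do rewrite mul1r addr0 EFinM.
    rewrite ge0_integralZl//; last 2 first.
    + apply/measurable_EFinP; apply: (measurableT_comp lyap_meas); apply: measurable_funD => //.
      exact: (xi_mfun hB th0 cY sdeY).
    + by move=> u _; rewrite lee_fin lyap_ge0.
    apply: (@le_trans _ _ ((expR (- (lam * (k.+1%:R * h))))%:E * (expR (lam * h) * V (Y (k%:R * h) w))%:E)%E).
      by apply: lee_wpmul2l; [rewrite lee_fin expR_ge0|exact: lyap_kernel].
    rewrite -EFinM lee_fin mulrA -expRD /lvl.
    by have -> : - (lam * (k.+1%:R * h)) + lam * h = - (lam * (k%:R * h)) by rewrite -natr1; ring.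
  rewrite normr0 subr0 normr1.
  under eq_integral do rewrite mul0r add0r mul1r.
  have PT : P setT = 1%E by exact: probability_setT.
  by rewrite integral_cst// [X in (_ * X)%E]PT mule1.
have mA : measurable [set w | ~~ ok h a N w].
  rewrite (_ : [set w | ~~ ok h a N w] = Z h a N @^-1` [set 0]).
    by rewrite -[X in measurable X]setTI; apply: mok => //.
  apply/seteqP; split => w; rewrite /Z /=; case: ok => //= /eqP.
  by rewrite oner_eq0.
have Pfin : P [set w | ~~ ok h a N w] \is a fin_num by exact: fin_num_measure.
have : (a%:E * P [set w | ~~ ok h a N w] <= (V x)%:E)%E.
  apply: le_trans (IW N).
  rewrite -[X in P X]setIT -integral_indic// -ge0_integralZl//; last 2 first.
    by apply/measurable_EFinP; exact: measurable_indic.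
    by rewrite lee_fin ltW.
  apply: ge0_le_integral => //.
  - by move=> w _; rewrite -EFinM lee_fin mulr_ge0 ?(ltW a0).
  - by apply: emeasurable_funM => //; apply/measurable_EFinP; exact: measurable_indic.
  - exact/measurable_EFinP.
  - move=> w _; rewrite -EFinM lee_fin indicE /W.
    have [okw|okw] := boolP (ok h a N w).
      by rewrite memNset ?mulr0 ?lvl0//= okw.
    by rewrite mem_set ?mulr1.
by rewrite -(fineK Pfin) -EFinM !lee_fin ler_pdivlMr// mulrC.
Qed.

Let pw n : (2 ^ n)%:R != 0 :> R. Proof. by rewrite pnatr_eq0 expn_eq0. Qed.
Let pw0 n : 0 < (2 ^ n)%:R :> R. Proof. by rewrite ltr0n expn_gt0. Qed.

Let badn a n := [set w | ~~ ok (2 ^ n)%:R^-1 a (4 ^ n) w].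

(** With mesh 2^-n and 4^n steps the grid reaches time 2^n: refinement and horizon grow together, so
    the events increase and every dyadic time is eventually seen. *)
Definition ou_bad a := \bigcup_n badn a n.

Let hn n : 0 < (2 ^ n)%:R^-1 :> R.
Proof. by rewrite invr_gt0. Qed.

Let badn_measurable a n : measurable (badn a n).
Proof.
rewrite (_ : badn a n = Z (2 ^ n)%:R^-1 a (4 ^ n) @^-1` [set 0]).
  rewrite -[X in measurable X]setTI; have H := @Z_past _ a (4 ^ n) (hn n).
  by apply: (@meas_wrt_measurable _ _ _ _ _ _ _ H) => //; exact: past_gen_measurable.
apply/seteqP; split => w; rewrite /badn /Z /=; case: ok => //= /eqP.
by rewrite oner_eq0.
Qed.

Lemma ou_bad_measurable a : measurable (ou_bad a).
Proof. exact: bigcupT_measurable. Qed.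

Lemma ou_bad_prob a : 0 < a -> (P (ou_bad a) <= (V x / a)%:E)%E.
Proof.
move=> a0.
have nd : nondecreasing_seq (badn a).
  apply/nondecreasing_seqP => n; apply/subsetPset => w /= /forallPn[j Hj].
  apply/forallPn.
  have j2 : (2 * j < (4 ^ n.+1).+1)%N.
    rewrite ltnS expnS (@leq_trans (2 * 4 ^ n))%N ?leq_mul2r ?orbT//.
    by rewrite leq_mul2l -ltnS ltn_ord orbT.
  exists (Ordinal j2) => /=; apply: contra Hj.
  by rewrite natrM expnS natrM invfM mulrACA divff ?mul1r// pnatr_eq0.
have := @nondecreasing_cvg_mu _ _ _ P _ (badn_measurable a) (ou_bad_measurable a) nd.
move=> /lee_cvg_to/(_ (cvg_cst (V x / a)%:E)); apply.
by apply: nearW => n; exact: ou_maximal_grid.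
Qed.

Lemma ou_not_bad a w : ~ ou_bad a w -> forall t, 0 <= t -> lvl t w <= a.
Proof.
move=> nb t t0.
have H (i n k : nat) : (k <= 2 ^ n)%N -> lvl ((2 ^ i)%:R * k%:R / (2 ^ n)%:R) w <= a.
  move=> kn; rewrite leNgt; apply/negP => Hlt; apply: nb.
  exists (n + i)%N => //=; apply/forallPn.
  have j2 : (k * 2 ^ i * 2 ^ i < (4 ^ (n + i)).+1)%N.
    rewrite ltnS -[4%N]/(2 * 2)%N expnMn expnD -!mulnA leq_mul//.
    by rewrite leq_mul2l leq_pmull ?orbT// expn_gt0.
  exists (Ordinal j2) => /=; rewrite -ltNge.
  have -> : (k * 2 ^ i * 2 ^ i)%:R * (2 ^ (n + i))%:R^-1 = (2 ^ i)%:R * k%:R / (2 ^ n)%:R :> R.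
    by rewrite expnD !natrM; field; rewrite !pw.
  exact: Hlt.
have [i ti] : exists i, t <= (2 ^ i)%:R.
  exists (Num.truncn t).+1; have /andP[_ /ltW/le_trans] := truncn_itv t0; apply.
  by rewrite ler_nat; apply: ltnW; exact: ltn_expl.
have [k [kn kt]] := dyadic_grid_cvg t0 ti.
have cl : {within `[0, +oo[, continuous (fun t => lvl t w)}.
  move=> r; apply: cvgM.
    have : {within `[0, +oo[, continuous (fun t : R => expR (- (lam * t)))}.
      apply: continuous_subspaceT => z; apply: expR_cvg.
      by apply: cvgN; apply: cvgM; [exact: cvg_cst|exact: cvg_id].
    exact.
  apply: cvgD; first exact: cvg_cst.
  by rewrite /= expr2; apply: cvgM; exact: cY.
have := within_itvcy_cvg_seq cl _ kt.
move=> /(_ _)/ler_cvg_to/(_ (cvg_cst a)); apply.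
  by move=> n; rewrite divr_ge0// mulr_ge0.
by apply: nearW => n; exact: H.
Qed.

(** A measurable dyadic majorant of sup_t e^{-lam t / 2} |Y_t|. A value in (2^j, 2^(j+1)] has square
    above 4^j, so the j-th bad event occurs and its term alone dominates. The terms have expectation
    at most 2 V(x) / 2^j, summing to at most 4 V(x). *)
Definition ou_sup w : \bar R :=
  (1%:E + \sum_(0 <= j <oo) ((2 ^ j.+1)%:R%:E * (\1_(ou_bad (4 ^ j)%:R) w)%:E))%E.

Let term0 j w : (0 <= (2 ^ j.+1)%:R%:E * (\1_(ou_bad (4 ^ j)%:R) w)%:E :> \bar R)%E.
Proof. by rewrite -EFinM lee_fin mulr_ge0. Qed.

Let mterm j : measurable_fun setT (fun w => (2 ^ j.+1)%:R%:E * (\1_(ou_bad (4 ^ j)%:R) w)%:E : \bar R)%E.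
Proof.
apply: emeasurable_funM => //; apply/measurable_EFinP.
by apply: measurable_indic; exact: ou_bad_measurable.
Qed.

Lemma ou_sup_measurable : measurable_fun setT ou_sup.
Proof. by apply: emeasurable_funD => //; apply: ge0_emeasurable_sum. Qed.

Lemma ou_sup_ge1 w : (1%:E <= ou_sup w)%E.
Proof. by rewrite leeDl// nneseries_ge0. Qed.

Lemma ou_sup_ub w t : 0 <= t -> ((expR (- (lam * t / 2)) * `|Y t w|)%:E <= ou_sup w)%E.
Proof.
move=> t0; set q := _ * `|_|.
have q0 : 0 <= q by rewrite mulr_ge0 ?expR_ge0.
have q2 : q ^+ 2 <= lvl t w.
  rewrite /q exprMn /lvl real_normK ?num_real// ler_pM ?sqr_ge0//.
    by rewrite expr2 -expRD -opprD -splitr.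
  have := lyap_ge0 0; rewrite /V /lyap expr0n addr0 => h; by rewrite lerDr.
have [q1|q1] := leP q 1; first by rewrite (le_trans _ (ou_sup_ge1 w))// lee_fin.
have ex : exists n, q <= (2 ^ n)%:R.
  exists (Num.truncn q).+1; have /andP[_ /ltW/le_trans] := truncn_itv q0; apply.
  by rewrite ler_nat; apply: ltnW; exact: ltn_expl.
have := ex_minnP ex; case: ex_minnP => n qn min_n [[|j] qj minj].
  by move: q1; rewrite ltNge (le_trans qj)// expn0.
have jq : (2 ^ j)%:R < q by rewrite ltNge; apply/negP => /minj; rewrite ltnn.
have bw : ou_bad (4 ^ j)%:R w.
  apply: contrapT => /ou_not_bad/(_ t t0); rewrite leNgt => /negP; apply.
  apply: lt_le_trans q2; rewrite -[4%N]/(2 * 2)%N expnMn natrM -expr2 ltrXn2r// nnegrE.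
apply: (@le_trans _ _ ((2 ^ j.+1)%:R%:E * (\1_(ou_bad (4 ^ j)%:R) w)%:E)%E).
  by rewrite indicE mem_set// mule1 lee_fin.
apply: (@le_trans _ _ (\sum_(0 <= i < j.+1) ((2 ^ i.+1)%:R%:E * (\1_(ou_bad (4 ^ i)%:R) w)%:E))%E).
  by rewrite big_nat_recr//= leeDr// sume_ge0.
apply: (@le_trans _ _ (\sum_(0 <= i <oo) ((2 ^ i.+1)%:R%:E * (\1_(ou_bad (4 ^ i)%:R) w)%:E))%E).
  exact: nneseries_lim_ge.
by rewrite leeDr.
Qed.

Lemma ou_sup_integrable : P.-integrable setT ou_sup.
Proof.
have V0 := lyap_ge0 x.
apply/integrableP; split; first exact: ou_sup_measurable.
under eq_integral => w _ do rewrite gee0_abs ?(le_trans _ (ou_sup_ge1 w))//.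
rewrite ge0_integralD//; last 2 first.
- by move=> w _; exact: nneseries_ge0.
- by apply: ge0_emeasurable_sum.
have PT : P setT = 1%E by exact: probability_setT.
rewrite integral_cst// [X in (_ * X)%E]PT mule1 lte_add_pinfty ?ltry//.
rewrite integral_nneseries//.
apply: (@le_lt_trans _ _ (4 * V x)%:E); last exact: ltry.
apply: lime_le; first by apply: is_cvg_nneseries => n _ _; apply: integral_ge0.
apply: nearW => n.
apply: (@le_trans _ _ (\sum_(0 <= j < n) (2 * V x / (2 ^ j)%:R)%:E)%E).
  apply: lee_sum => j _; rewrite ge0_integralZl//; last first.
    by apply/measurable_EFinP; apply: measurable_indic; exact: ou_bad_measurable.
  rewrite integral_indic ?setIT//; last exact: ou_bad_measurable.
  apply: (@le_trans _ _ ((2 ^ j.+1)%:R%:E * (V x / (4 ^ j)%:R)%:E)%E).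
    by apply: lee_wpmul2l; [rewrite lee_fin|apply: ou_bad_prob; rewrite ltr0n expn_gt0].
  rewrite -EFinM lee_fin -[4%N]/(2 * 2)%N expnMn expnS !natrM le_eqVlt; apply/orP; left; apply/eqP.
  by field; rewrite pw.
rewrite sumEFin lee_fin.
have -> : \sum_(0 <= j < n) 2 * V x / (2 ^ j)%:R = 4 * V x - 4 * V x / (2 ^ n)%:R.
  elim: n => [|n IH]; first by rewrite big_geq// expn0 divr1 subrr.
  by rewrite big_nat_recr//= IH expnS natrM; field; rewrite pw.
by rewrite gerBl divr_ge0// mulr_ge0.
Qed.
End ou_maximal.

(** * Parabolic cylinder functions *)

Section scaling.
Context {R : realType}.
Notation leb := (@lebesgue_measure R).
Local Open Scope ereal_scope.

(** Lebesgue measure equals r times its image under x -> r x, by uniqueness on half-open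
    intervals. *)
Lemma lebesgue_scale (r : R) (f : R -> \bar R) : (0 < r)%R ->
  measurable_fun setT f -> (forall x, 0 <= f x) ->
  \int[leb]_(x in `]0%R, +oo[) f (r * x)%R = (r^-1)%:E * \int[leb]_(x in `]0%R, +oo[) f x.
Proof.
move=> r0 mf f0.
have mr : measurable_fun setT (( *%R r) : measurableTypeR R -> measurableTypeR R).
  by apply: measurable_funM.
pose pf := pushforward leb (( *%R r) : measurableTypeR R -> measurableTypeR R).
have ri : (0 <= r)%R by exact: ltW.
have H A : measurable A -> leb A = mscale (NngNum ri) pf A.
  apply: lebesgue_measure_unique => //= _ [[a b] _ <-].
  rewrite /mscale/= /pf /pushforward.
  have -> : ( *%R r) @^-1` `]a, b] = `](a / r)%R, (b / r)%R]%classic.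
    apply/seteqP; split => x /=; rewrite !in_itv/= ltr_pdivrMr// ler_pdivlMr//.
      by rewrite [(r * _)%R]mulrC.
    by rewrite [(r * _)%R]mulrC.
  rewrite !lebesgue_measure_itv/= !lte_fin ltr_pM2r ?invr_gt0//.
  case: ifPn => _; last by rewrite mule0.
  by rewrite -!EFinB -EFinM; congr EFin; field; rewrite gt_eqF.
have -> : `]0%R, +oo[%classic = ( *%R r) @^-1` `]0%R, +oo[.
  by apply/seteqP; split => x /=; rewrite !in_itv/= !andbT pmulr_rgt0.
have mD : measurable (`]0%R, +oo[%classic : set (measurableTypeR R)) by [].
have E := @ge0_integral_pushforward _ _ (measurableTypeR R) (measurableTypeR R) R _ mr leb _ f mD (measurable_funTS mf) (fun y _ => f0 y).
rewrite -[LHS]E.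
have -> : ( *%R r) @^-1` `]0%R, +oo[ = `]0%R, +oo[%classic.
  by apply/seteqP; split => x /=; rewrite !in_itv/= !andbT pmulr_rgt0.
have -> : \int[leb]_(x in `]0%R, +oo[) f x = \int[mscale (NngNum ri) pf]_(x in `]0%R, +oo[) f x.
  by move=> m; apply: eq_measure_integral => A mA _; exact: H.
rewrite ge0_integral_mscale//=; last exact: measurable_funTS.
by rewrite muleA -EFinM mulVf ?mul1e// gt_eqF.
Qed.
End scaling.

Section gamma_integral.
Context {R : realType}.
Notation leb := (@lebesgue_measure R).
Variable a : R.
Hypothesis a0 : 0 < a.

(** For a < 1 the integrand is unbounded at 0, so the interval is exhausted by [2^-(n+1), 1], where
    the fundamental theorem of calculus applies. *)
Lemma powR_integral01 : (\int[leb]_(u in `]0%R, 1%R]) (powR u (a - 1))%:E <= (a^-1)%:E)%E.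
Proof.
pose F n := `[(2^-1) ^+ n.+1, 1]%classic : set R.
have p0 n : 0 < (2^-1) ^+ n :> R by rewrite exprn_gt0// invr_gt0.
have p1 n : (2^-1) ^+ n.+1 < 1 :> R by rewrite exprn_ilt1// ?invr_ge0// invf_lt1// ltr1n.
have FU : `]0%R, 1%R]%classic = \bigcup_n F n.
  apply/seteqP; split => u /=; last first.
    by move=> [n _]; rewrite /F /= !in_itv/= => /andP[nu ->]; rewrite (lt_le_trans (p0 _) nu).
  rewrite in_itv/= => /andP[u0 u1].
  have : (fun n => (2^-1) ^+ n : R) @ \oo --> 0.
    by apply: cvg_expr; rewrite ger0_norm ?invr_ge0// invf_lt1// ltr1n.
  move=> /cvgrPdist_lt/(_ u u0)[n _ Hn]; exists n => //.
  rewrite /F /= in_itv/= u1 andbT.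
  by have := Hn n.+1 (leqnSn n); rewrite sub0r normrN ger0_norm ?(ltW (p0 _))// => /ltW.
rewrite FU.
have mp : measurable_fun setT (fun u : R => (powR u (a - 1))%:E).
  by apply/measurable_EFinP; exact: measurable_powR.
have /lee_cvg_to : (\int[leb]_(x in F i) (powR x (a - 1))%:E @[i --> \oo] --> \int[leb]_(x in \bigcup_i F i) (powR x (a - 1))%:E)%E.
  apply: ge0_nondecreasing_set_cvg_integral => //.
  - apply/nondecreasing_seqP => n; apply/subsetPset => u /=.
    rewrite /F /= !in_itv/= => /andP[h ->]; rewrite andbT (le_trans _ h)// exprS.
    by rewrite ler_piMl ?(ltW (p0 _))// invf_le1// ler1n.
  - by move=> i; rewrite /F.
  - by move=> i; exact: measurable_funTS.
  - by move=> i u _; rewrite lee_fin powR_ge0.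
move=> /(_ _ _ (cvg_cst (a^-1)%:E)); apply.
apply: nearW => n; rewrite /F.
rewrite (@continuous_FTC2 _ _ (fun u => powR u a / a))//.
- rewrite -EFinB lee_fin powR1 mul1r gerBl; apply: divr_ge0; [exact: powR_ge0|exact: ltW].
- apply: derivable_within_continuous => u /=; rewrite in_itv/= => /andP[u0 _].
  by apply: derivable_powR; rewrite in_itv/= andbT (lt_le_trans _ u0)// p0.
- have dF u : 0 < u -> derivable (fun u => powR u a / a) u 1.
    by move=> u0; apply: derivableM => //; apply: derivable_powR; rewrite in_itv/= andbT.
  have cF u : 0 < u -> {for u, continuous (fun u => powR u a / a)}.
    by move=> u0; apply: differentiable_continuous; apply/derivable1_diffP; exact: dF.
  split.
  + by move=> u; rewrite in_itv/= => /andP[u0 _]; apply: dF; rewrite (lt_trans _ u0).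
  + by apply: cvg_at_right_filter; apply: cF.
  + by apply: cvg_at_left_filter; apply: cF.
- move=> u; rewrite in_itv/= => /andP[u0 _].
  have up : 0 < u by rewrite (lt_trans _ u0).
  have Hd := @is_derive1_powR _ a _ up.
  rewrite derive1E deriveMr; last exact: ex_derive.
  by rewrite derive_val /GRing.scale/=; field; rewrite gt_eqF.
Qed.

Lemma gamma_integral_fin : (\int[leb]_(u in `]0%R, +oo[) (powR u (a - 1) * expR (- u))%:E < +oo)%E.
Proof.
have mp : measurable_fun setT (fun u : R => (powR u (a - 1))%:E).
  by apply/measurable_EFinP; exact: measurable_powR.
have mf : measurable_fun setT (fun u : R => (powR u (a - 1) * expR (- u))%:E).
  apply/measurable_EFinP; apply: measurable_funM; first exact: measurable_powR.
  by apply: measurableT_comp => //; exact: measurable_funN.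
have f0 u : (0 <= (powR u (a - 1) * expR (- u))%:E)%E by rewrite lee_fin mulr_ge0 ?powR_ge0 ?expR_ge0.
have -> : `]0%R, +oo[%classic = `]0%R, 1%R] `|` `]1%R, +oo[ :> set R.
  apply/seteqP; split => u /=; rewrite !in_itv/= !andbT.
    by case: (leP u 1) => u1 u0; [left; rewrite u0|right].
  by move=> [/andP[]//|]; exact: lt_trans.
rewrite ge0_integral_setU//=; last 2 first.
- exact: measurable_funTS.
- by apply/disj_setPS => u []/=; rewrite !in_itv/= andbT => /andP[_ u1]; rewrite ltNge u1.
apply: lte_add_pinfty.
  apply: le_lt_trans (ltry (a^-1)); apply: le_trans powR_integral01.
  apply: ge0_le_integral => //; try exact: measurable_funTS.
  move=> u /=; rewrite in_itv/= => /andP[u0 u1]; rewrite lee_fin ler_piMr ?powR_ge0//.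
  by rewrite -[leRHS]expR0 ler_expR oppr_le0 ltW.
(* On u > 1, u^(a-1) <= u^(n+1) <= C exp(u / 2) by one term of the exponential series; the tail is
   then dominated by 2 C times the exponential density of rate 1/2. *)
pose n := (Num.truncn a).+1.
pose C := 2 ^+ n.+1 * (n.+1)`!%:R : R.
apply: le_lt_trans (ltry (2 * C)).
apply: (@le_trans _ _ (\int[leb]_u ((2 * C)%:E * (exponential_pdf (2^-1) u)%:E))%E).
  apply: (@le_trans _ _ (\int[leb]_(u in `]1%R, +oo[) ((2 * C)%:E * (exponential_pdf (2^-1) u)%:E))%E).
    apply: ge0_le_integral => //.
    - exact: measurable_funTS.
    - apply: emeasurable_funM => //; apply/measurable_EFinP; apply: measurable_funTS.
      exact: measurable_exponential_pdf.
    - move=> u /=; rewrite in_itv/= andbT => u1.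
      have u0 : 0 < u by rewrite (lt_trans _ u1).
      rewrite exponential_pdfE ?(ltW u0)// -EFinM lee_fin.
      have h1 : powR u (a - 1) <= u ^+ n.+1.
        rewrite -powR_mulrn ?(ltW u0)// ler_powR ?(ltW u1)//.
        have /andP[_ h] := truncn_itv (ltW a0).
        by rewrite -natr1 lerBlDr -addrA ler_wpDr// ltW.
      have h2 : u ^+ n.+1 <= C * expR (u / 2).
        have := @expR_ge1Dxn _ (u / 2) n; rewrite divr_ge0 ?(ltW u0)// => /(_ isT) h.
        have h' : (u / 2) ^+ n.+1 / (n.+1)`!%:R <= expR (u / 2) by rewrite (le_trans _ h)// ler_wpDl.
        move: h'; rewrite ler_pdivrMr ?ltr0n ?fact_gt0// expr_div_n ler_pdivrMr ?exprn_gt0//.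
        by move/le_trans; apply; rewrite /C le_eqVlt; apply/orP; left; apply/eqP; ring.
      have -> : 2 * C * (2^-1 * expR (- 2^-1 * u)) = (C * expR (u / 2)) * expR (- u).
        have -> : expR (- 2^-1 * u) = expR (u / 2) * expR (- u).
          by rewrite -expRD; congr expR; field.
        by field.
      by rewrite ler_wpM2r ?expR_ge0// (le_trans h1).
  apply: ge0_subset_integral => //.
  - by apply: emeasurable_funM => //; apply/measurable_EFinP; exact: measurable_exponential_pdf.
  - by move=> u _; rewrite mule_ge0// lee_fin; [rewrite mulr_ge0// mulr_ge0// exprn_ge0|apply: exponential_pdf_ge0; rewrite invr_ge0].
rewrite ge0_integralZl//; last 3 first.
- by apply/measurable_EFinP; exact: measurable_exponential_pdf.
- by move=> u _; rewrite lee_fin; apply: exponential_pdf_ge0; rewrite invr_ge0.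
- by rewrite lee_fin mulr_ge0// mulr_ge0// exprn_ge0.
by rewrite integral_exponential_pdf ?invr_gt0// mule1.
Qed.
End gamma_integral.

Section parabolic.
Context {R : realType}.
Notation leb := (@lebesgue_measure R).
Notation D := (`]0%R, +oo[%classic : set R).
Variable a : R.
Hypothesis a0 : 0 < a.

(** Integrand of the k-th z-derivative of the parabolic cylinder integral, stripped of its gaussian
    prefactor and of 1 / Gamma a. *)
Definition pc_wt (k : nat) (z u : R) : R :=
  u ^+ k * (powR u (a - 1) * expR (- (u ^+ 2 / 2) + u * z)).

Definition pc_int (k : nat) (z : R) : R := Rintegral leb D (pc_wt k z).

Lemma pc_wt_meas k z : measurable_fun setT (pc_wt k z).
Proof.
apply: measurable_funM; first exact: measurable_funX.
apply: measurable_funM; first exact: measurable_powR.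
apply: measurableT_comp => //; apply: measurable_funD.
  apply: measurable_funN; apply: measurable_funM => //; exact: measurable_funX.
exact: measurable_funM.
Qed.

Lemma pc_wt_ge0 k z u : 0 < u -> 0 <= pc_wt k z u.
Proof.
by move=> u0; rewrite /pc_wt mulr_ge0 ?exprn_ge0 ?(ltW u0)// mulr_ge0 ?powR_ge0 ?expR_ge0.
Qed.

Lemma pc_wt_gt0 k z u : 0 < u -> 0 < pc_wt k z u.
Proof.
by move=> u0; rewrite /pc_wt mulr_gt0 ?exprn_gt0// mulr_gt0 ?powR_gt0 ?expR_gt0.
Qed.

Lemma fact_expR k (u : R) : 0 <= u -> u ^+ k <= k`!%:R * expR u.
Proof.
case: k => [|k] u0; first by rewrite expr0 fact0 mul1r -[leLHS]expR0 ler_expR.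
have := expR_ge1Dxn k u0 => h.
have h' : u ^+ k.+1 / (k.+1)`!%:R <= expR u by rewrite (le_trans _ h)// ler_wpDl.
by move: h'; rewrite ler_pdivrMr ?ltr0n ?fact_gt0// mulrC.
Qed.

Lemma gamma_integrable : leb.-integrable D (EFin \o (fun u => powR u (a - 1) * expR (- u))).
Proof.
apply/integrableP; split.
  apply/measurable_EFinP; apply: measurable_funTS.
  by apply: measurable_funM; [exact: measurable_powR|apply: measurableT_comp => //; exact: measurable_funN].
have := gamma_integral_fin a0; apply: le_lt_trans.
apply: ge0_le_integral => //.
- apply: measurableT_comp => //; apply/measurable_EFinP; apply: measurable_funTS.
  by apply: measurable_funM; [exact: measurable_powR|apply: measurableT_comp => //; exact: measurable_funN].
- apply/measurable_EFinP; apply: measurable_funTS.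
  by apply: measurable_funM; [exact: measurable_powR|apply: measurableT_comp => //; exact: measurable_funN].
- by move=> u _ /=; rewrite lee_fin ger0_norm// mulr_ge0 ?powR_ge0 ?expR_ge0.
Qed.

Lemma Rintegral_gt0 (f : R -> R) : measurable_fun D f -> leb.-integrable D (EFin \o f) ->
  (forall u, 0 < u -> 0 < f u) -> 0 < Rintegral leb D f.
Proof.
move=> mf fi f0.
have ge : 0 <= Rintegral leb D f.
  by apply: Rintegral_ge0 => u /=; rewrite in_itv/= andbT => /f0/ltW.
rewrite lt_neqAle ge andbT; apply/negP => /eqP e0.
have E : (\int[leb]_(u in D) `|(f u)%:E| = 0)%E.
  have -> : (\int[leb]_(u in D) `|(f u)%:E| = \int[leb]_(u in D) (f u)%:E)%E.
    apply: eq_integral => u; rewrite inE/= in_itv/= andbT => u0.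
    by rewrite gtr0_norm// f0.
  have fin : (\int[leb]_(u in D) (f u)%:E)%E \is a fin_num by exact: (integrable_fin_num _ fi).
  by rewrite -(fineK fin); move: e0; rewrite /Rintegral => <-.
have mD : measurable (D : set (measurableTypeR R)) by [].
have mEf : measurable_fun D (EFin \o f) by exact/measurable_EFinP.
have := iffLR (@ae_eq_integral_abs _ _ _ leb D mD (EFin \o f) mEf) E.
move=> [N [mN N0 sub]].
have : (leb D <= leb N)%E.
  apply: le_measure; rewrite ?inE// => u /=.
  rewrite in_itv/= andbT => u0; apply: sub => /= /(_ _).
  rewrite in_itv/= andbT u0 => /(_ isT) [] h.
  by have := f0 _ u0; rewrite h ltxx.
by rewrite N0 lebesgue_measure_itv/= ltry.
Qed.

Lemma pc_integrable k z : leb.-integrable D (EFin \o pc_wt k z).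
Proof.
have mD0 : measurable (D : set (measurableTypeR R)) by [].
have h := integrableZl mD0 (k`!%:R * expR ((z + 2) ^+ 2 / 2)) gamma_integrable.
apply: le_integrable h => //.
  by apply/measurable_EFinP; apply: measurable_funTS; exact: pc_wt_meas.
move=> u /=; rewrite in_itv/= andbT => u0.
rewrite lee_fin !ger0_norm; last 2 first.
- by rewrite mulr_ge0 ?mulr_ge0 ?powR_ge0 ?expR_ge0.
- exact: pc_wt_ge0.
rewrite /pc_wt.
(* Expanding (u - (z + 2))^2 >= 0 leaves two factors exp(-u): one pays for u^k, the other completes
   the Gamma integrand. *)
have e : expR (- (u ^+ 2 / 2) + u * z) <= expR ((z + 2) ^+ 2 / 2) * expR (- u) * expR (- u).
  by rewrite -!expRD ler_expR; have := sqr_ge0 (u - (z + 2)); lra.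
have hk := @fact_expR k u (ltW u0).
apply: le_trans (ler_wpM2l _ (ler_wpM2l _ e)) _; rewrite ?exprn_ge0 ?(ltW u0) ?powR_ge0//.
apply: le_trans (ler_wpM2r _ hk) _.
  by rewrite !mulr_ge0 ?powR_ge0 ?expR_ge0.
have E : expR u * expR (- u) = 1 by rewrite -expRD subrr expR0.
rewrite le_eqVlt; apply/orP; left; apply/eqP.
transitivity (k`!%:R * powR u (a - 1) * expR ((z + 2) ^+ 2 / 2) * expR (- u) * (expR u * expR (-u))).
  by ring.
by rewrite E; ring.
Qed.

Lemma pc_int_gt0 k z : 0 < pc_int k z.
Proof.
apply: Rintegral_gt0; [|exact: pc_integrable|exact: pc_wt_gt0].
by apply: measurable_funTS; exact: pc_wt_meas.
Qed.

Lemma GammaE : 0 < Gamma a.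
Proof.
apply: Rintegral_gt0; [|exact: gamma_integrable|].
  apply: measurable_funTS.
  by apply: measurable_funM; [exact: measurable_powR|apply: measurableT_comp => //; exact: measurable_funN].
by move=> u u0; rewrite mulr_gt0 ?powR_gt0 ?expR_gt0.
Qed.

Lemma pc_wtD k z e u : pc_wt k (z + e) u = pc_wt k z u * expR (u * e).
Proof. by rewrite /pc_wt mulrDr addrA [expR (_ + u * e)]expRD; ring. Qed.

Lemma pc_wtS k z u : pc_wt k.+1 z u = u * pc_wt k z u.
Proof. by rewrite /pc_wt exprS; ring. Qed.

(** Integrates 1 + u e <= exp(u e) against the weight; this is the source of the convexity of
    psi. *)
Lemma pc_int_tangent z e : pc_int 0 z + e * pc_int 1 z <= pc_int 0 (z + e).
Proof.
have I k z := pc_integrable k z; have mD : measurable (D : set (measurableTypeR R)) by [].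
rewrite /pc_int -(RintegralZl e mD (I 1%N z)) -RintegralD//; last exact: (integrableZl mD e (I 1%N z)).
apply: le_Rintegral => //.
- exact: (integrableD mD (I 0%N z) (integrableZl mD e (I 1%N z))).
- exact: (I 0%N (z + e)).
move=> u /=; rewrite in_itv/= andbT => u0.
change (pc_wt 0 z u + e * pc_wt 1 z u <= pc_wt 0 (z + e) u); rewrite pc_wtD pc_wtS.
have := expR_ge1Dx (u * e) => /(ler_wpM2l (pc_wt_ge0 0 z u0)).
  by apply: le_trans; rewrite le_eqVlt; apply/orP; left; apply/eqP; ring.
exact: (I 0%N z).
Qed.

Lemma expR_taylor2_abs (z : R) : `|expR z - 1 - z| <= z ^+ 2 * expR `|z|.
Proof.
have h1 := expR_ge1Dx z.
rewrite ger0_norm; last by lra.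
have h2 := expR_ge1Dx (- z).
have e1 : expR z * expR (- z) = 1 by rewrite -expRD subrr expR0.
have := expR_gt0 z => p; have pn := expR_gt0 (- z).
have [z0|z0] := leP 0 z.
- rewrite ger0_norm//.
  have h3 : expR z - 1 <= z * expR z.
    have := ler_wpM2l (ltW p) h2; rewrite e1; lra.
  have h4 : z * (expR z - 1) <= z * (z * expR z) by exact: ler_wpM2l.
  have h5 : z * expR z <= z + z * (z * expR z) by lra.
  rewrite expr2; lra.
- rewrite ltr0_norm//.
  have h3 : expR z * (1 - z) <= 1 by rewrite -[leRHS]e1 ler_pM2l.
  have h4 : expR z - 1 <= z * expR z by lra.
  have h5 : z * (expR z - 1) <= z * z.
    rewrite ler_nM2l//; lra.
  have h6 : z ^+ 2 * 1 <= z ^+ 2 * expR (- z) by rewrite ler_wpM2l ?sqr_ge0// -expR0 ler_expR; lra.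
  rewrite expr2 in h6 *; lra.
Qed.

(** A pointwise quadratic Taylor remainder, integrated; the derivative under the integral sign
    follows from it directly. The shift z + 1 absorbs exp(u |e|) for |e| <= 1. *)
Lemma pc_int_diff z e : `|e| <= 1 ->
  `|pc_int 0 (z + e) - pc_int 0 z - e * pc_int 1 z| <= e ^+ 2 * pc_int 2 (z + 1).
Proof.
move=> e1; have I k z := pc_integrable k z; have mD : measurable (D : set (measurableTypeR R)) by [].
have Ie := integrableZl mD e (I 1%N z).
have IB := integrableB mD (I 0%N (z + e)) (I 0%N z).
have IB2 := integrableB mD IB Ie.
rewrite /pc_int -(RintegralZl e mD (I 1%N z)) -(RintegralB mD (I _ _) (I _ _)).
rewrite -(RintegralB mD IB Ie).
apply: le_trans (le_normr_Rintegral mD IB2) _.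
rewrite -(RintegralZl _ mD (I 2%N (z + 1))).
apply: le_Rintegral => //.
- exact: (integrable_norm IB2).
- exact: (integrableZl mD _ (I _ _)).
move=> u /=; rewrite in_itv/= andbT => u0.
have w0 := pc_wt_ge0 0 z u0.
rewrite !pc_wtD !pc_wtS.
have -> : pc_wt 0 z u * expR (u * e) - pc_wt 0 z u - e * (u * pc_wt 0 z u) =
  pc_wt 0 z u * (expR (u * e) - 1 - u * e) by ring.
rewrite normrM ger0_norm//.
have -> : e ^+ 2 * (u * (u * pc_wt 0 z u) * expR (u * 1)) = pc_wt 0 z u * ((u * e) ^+ 2 * expR (u * 1)).
  by ring.
rewrite ler_wpM2l// (le_trans (expR_taylor2_abs _))// ler_wpM2l ?sqr_ge0// ler_expR normrM gtr0_norm//.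
by rewrite ler_wpM2l// ltW.
Qed.

Lemma pc_int_is_derive (z : R) : is_derive z 1 (pc_int 0) (pc_int 1 z).
Proof.
have C0 := pc_int_gt0 2 (z + 1).
suff H : (fun h : R => h^-1 *: (pc_int 0 (h *: 1 + z) - pc_int 0 z)) @ 0^' --> pc_int 1 z.
  by apply: DeriveDef; [apply/cvg_ex; exists (pc_int 1 z)|apply: cvg_lim].
apply/cvgrPdist_le => /= e e0.
have dd : 0 < Num.min 1 (e / pc_int 2 (z + 1)) by rewrite lt_min ltr01/= divr_gt0.
apply: filterS2 (dnbhs0_lt dd) (nbhs_dnbhs_neq 0) => h.
rewrite lt_min => /andP[h1 h2] hn0.
rewrite /GRing.scale/= mulr1 [h + z]addrC.
have H := @pc_int_diff z h (ltW h1).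
have -> (x y w : R) : x - h^-1 * (y - w) = - h^-1 * (y - w - h * x) by field.
rewrite normrM normrN normfV ler_pdivrMl ?normr_gt0//.
apply: le_trans H _; rewrite -real_normK ?num_real// expr2 -mulrA ler_wpM2l//.
by move: h2; rewrite ltr_pdivlMr// => /ltW.
Qed.

(** Quadratic growth, from x^2 / 2 <= exp x, is what makes (x - K) / psi small far out and so forces
    an interior maximum. *)
Lemma pc_int_growth z : 0 <= z -> z ^+ 2 / 2 * pc_int 2 0 <= pc_int 0 z.
Proof.
move=> z0; have I k z := pc_integrable k z; have mD : measurable (D : set (measurableTypeR R)) by [].
rewrite /pc_int -(RintegralZl _ mD (I _ _)); apply: le_Rintegral => //.
- exact: (integrableZl mD _ (I 2%N 0)).
- exact: (I 0%N z).
move=> u /=; rewrite in_itv/= andbT => u0.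
have w0 := pc_wt_ge0 0 0 u0.
change (z ^+ 2 / 2 * pc_wt 2 0 u <= pc_wt 0 z u).
rewrite -[z in leRHS]add0r pc_wtD !pc_wtS.
have -> : z ^+ 2 / 2 * (u * (u * pc_wt 0 0 u)) = pc_wt 0 0 u * ((u * z) ^+ 2 / 2) by field.
rewrite ler_wpM2l//.
have := @fact_expR 2 (u * z); rewrite mulr_ge0 ?(ltW u0)// => /(_ isT).
by move=> hh; rewrite ler_pdivrMr// [_ * 2]mulrC.
Qed.

Lemma pc_scale (r z : R) : 0 < r ->
  (\int[leb]_(u in D) (powR u (a - 1) * expR (- (r ^+ 2 / 2 * u ^+ 2) + u * (r * z)))%:E =
   (powR r (- a) * pc_int 0 z)%:E)%E.
Proof.
move=> r0.
pose f u : \bar R := (\1_D u * pc_wt 0 z u)%:E.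
have mf : measurable_fun setT f.
  by apply/measurable_EFinP; apply: measurable_funM; [exact: measurable_indic|exact: pc_wt_meas].
have f0 u : (0 <= f u)%E.
  rewrite lee_fin indicE; case: (boolP (u \in D)) => /=; last by rewrite mul0r.
  by rewrite inE/= in_itv/= andbT mul1r => u0; exact: pc_wt_ge0.
have H := lebesgue_scale r0 mf f0.
have E1 : (\int[leb]_(x in D) f x = (pc_int 0 z)%:E)%E.
  rewrite /pc_int /Rintegral fineK; last exact: (integrable_fin_num _ (pc_integrable 0 z)).
  by apply: eq_integral => u uD; rewrite /f indicE uD mul1r.
rewrite E1 in H.
have -> : (powR r (- a) * pc_int 0 z)%:E = ((powR r (1 - a))%:E * (r^-1%:E * (pc_int 0 z)%:E))%E.
  rewrite -!EFinM mulrA; congr (EFin (_ * _)).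
  have -> : r^-1 = powR r (-1) by rewrite powR_inv1// ltW.
  by rewrite -powRD; [congr powR; ring|apply/implyP => _; rewrite gt_eqF].
rewrite -H -ge0_integralZl//; last 2 first.
- have mr : measurable_fun setT (fun x : R => r * x) by exact: measurable_funM.
  by apply: measurable_funTS; exact: (measurableT_comp mf mr).
- by rewrite lee_fin powR_ge0.
apply: eq_integral => u uD; move: (uD); rewrite inE/= in_itv/= andbT => u0.
have ruD : r * u \in D by rewrite inE/= in_itv/= andbT mulr_gt0.
rewrite /f indicE ruD mul1r /pc_wt expr0 mul1r -EFinM; congr EFin.
rewrite powRM ?(ltW r0) ?(ltW u0)//.
have -> : powR r (1 - a) * (powR r (a - 1) * powR u (a - 1) * expR (- ((r * u) ^+ 2 / 2) + r * u * z)) =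
  (powR r (1 - a) * powR r (a - 1)) * (powR u (a - 1) * expR (- ((r * u) ^+ 2 / 2) + r * u * z)) by ring.
have -> : powR r (1 - a) * powR r (a - 1) = 1.
  by rewrite -powRD; [rewrite -(powRr0 r); congr powR; ring|apply/implyP => _; rewrite gt_eqF].
rewrite mul1r.
by congr (_ * expR _); field.
Qed.

Section tonelli.
Context d (T : measurableType d) (P : probability T R).

Lemma pc_tonelli (chi al be : T -> R) : measurable_fun setT chi -> (forall w, 0 <= chi w) ->
  measurable_fun setT al -> measurable_fun setT be ->
  (\int[P]_w (\int[leb]_(u in D) (chi w * (powR u (a - 1) * expR (- (be w * u ^+ 2) + u * al w)))%:E) =
   \int[leb]_(u in D) \int[P]_w (chi w * (powR u (a - 1) * expR (- (be w * u ^+ 2) + u * al w)))%:E)%E.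
Proof.
move=> mchi chi0 mal mbe.
pose f (z : T * measurableTypeR R) : \bar R :=
  (\1_D z.2 * (chi z.1 * (powR z.2 (a - 1) * expR (- (be z.1 * z.2 ^+ 2) + z.2 * al z.1))))%:E.
have m1 (g : T -> R) : measurable_fun setT g -> measurable_fun setT (fun z : T * measurableTypeR R => g z.1).
  by move=> mg; exact: (measurableT_comp mg measurable_fst).
have m2 (g : measurableTypeR R -> R) : measurable_fun setT g -> measurable_fun setT (fun z : T * measurableTypeR R => g z.2).
  by move=> mg; exact: (measurableT_comp mg measurable_snd).
have mf : measurable_fun setT f.
  apply/measurable_EFinP; apply: measurable_funM; first by apply: (m2 (\1_D)); exact: measurable_indic.
  apply: measurable_funM; first exact: m1.
  apply: measurable_funM; first by apply: (m2 (fun u => powR u (a - 1))); exact: measurable_powR.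
  apply: measurableT_comp => //; apply: measurable_funD.
    apply: measurable_funN; apply: measurable_funM; first exact: m1.
    by apply: (m2 (fun u => u ^+ 2)); exact: measurable_funX.
  by apply: measurable_funM; [exact: (m2 id)|exact: m1].
have f0 z : (0 <= f z)%E.
  by rewrite lee_fin !mulr_ge0 ?powR_ge0 ?expR_ge0// indicE.
have := @fubini_tonelli _ _ T (measurableTypeR R) R P leb f mf f0.
have <- : (\int[P]_w \int[leb]_u f (w, u) = \int[P]_w (\int[leb]_(u in D) (chi w * (powR u (a - 1) * expR (- (be w * u ^+ 2) + u * al w)))%:E))%E.
  apply: eq_integral => w _; rewrite [RHS]integral_mkcond; apply: eq_integral => u _.
  by rewrite /f /= patchE indicE; case: ifP => _; rewrite ?mul1r ?mul0r.
move=> ->; rewrite [RHS]integral_mkcond; apply: eq_integral => u _.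
rewrite patchE; case: ifP => uD.
  by apply: eq_integral => w _; rewrite /f /= indicE uD mul1r.
by rewrite integral0_eq// => w _; rewrite /f /= indicE uD mul0r.
Qed.

End tonelli.

End parabolic.

(** The ratio (x - K) / p vanishes at K, and at M it is below its value at N, so its maximum on
    [K, M] is interior; the vanishing derivative there is the stated equation. *)
Lemma ratio_critical {R : realType} (p p' : R -> R) (K N M : R) :
  (forall x, 0 < p x) -> (forall x : R, is_derive x 1 p (p' x)) ->
  K < N -> N < M -> (M - K) / p M < (N - K) / p N ->
  exists c, K < c /\ p c = (c - K) * p' c.
Proof.
move=> p0 dp KN NM fM.
pose f x := (x - K) / p x.
have df (x : R) : is_derive x 1 f ((p x - (x - K) * p' x) / p x ^+ 2).
  have h1 := dp x.
  have pn : p x != 0 by rewrite gt_eqF.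
  have h2 : is_derive x 1 (fun x => (p x)^-1) (- (p x) ^- 2 *: p' x) by exact: is_deriveV.
  rewrite /f; apply: is_derive_eq; rewrite /GRing.scale/=; field; exact: pn.
have f1 : 0 < f N by rewrite divr_gt0// subr_gt0.
have KM : K < M by exact: lt_trans NM.
have cf : {within `[K, M], continuous f}.
  apply: continuous_subspaceT => x.
  by apply: differentiable_continuous; apply/derivable1_diffP; have := df x => -[].
have [c cKM hc] := EVT_max (ltW KM) cf.
have fK : f K = 0 by rewrite /f subrr mul0r.
have hN : f N <= f c by apply: hc; rewrite in_itv/= !ltW.
have cI : c \in `]K, M[.
  move: cKM; rewrite !in_itv/= => /andP[k1 k2]; apply/andP; split.
    rewrite lt_neqAle k1 andbT; apply/eqP => e.
    by have := lt_le_trans f1 hN; rewrite -e fK ltxx.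
  rewrite lt_neqAle k2 andbT; apply/eqP => e.
  by have := lt_le_trans fM hN; rewrite e ltxx.
have D0 : is_derive c 1 f 0.
  apply: (derive1_at_max (ltW KM)) cI _.
    by move=> t _; have := df t => -[].
  by move=> t; rewrite in_itv/= => /andP[t1 t2]; apply: hc; rewrite in_itv/= !ltW.
have Z : (p c - (c - K) * p' c) / p c ^+ 2 = 0.
  by have [_ <-] := df c; have [_ ->] := D0.
exists c; split; first by move: cI; rewrite in_itv/= => /andP[].
move/eqP: Z; rewrite mulf_eq0 invr_eq0 expf_eq0/= [p c == 0]gt_eqF// orbF subr_eq0.
by move/eqP.
Qed.

(** * The function psi and the threshold equation *)

Section psi.
Context {R : realType}.
Variables (theta sigma mu lam : R).
Hypotheses (th0 : 0 < theta) (sg0 : 0 < sigma) (lam0 : 0 < lam).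
Let a := lam / theta.
Let a0 : 0 < a. Proof. exact: divr_gt0. Qed.
Definition psi_kap := Num.sqrt (2 * theta) / sigma.
Let psi := psi_lam theta sigma mu lam.

Lemma psi_kap_gt0 : 0 < psi_kap.
Proof. by rewrite divr_gt0// sqrtr_gt0 mulr_gt0. Qed.

(** The exponential in front of D is the exact inverse of the factor exp(-z^2 / 4) inside it,
    leaving a Laplace-type integral with no gaussian prefactor. *)
Lemma psi_lamE x : psi x = (Gamma a)^-1 * pc_int a 0 (psi_kap * (x - mu)).
Proof.
rewrite /psi /psi_lam /Dpc opprK -/a [LHS]mulrA [X in X * _]mulrA -expRD.
have -> : theta * (x - mu) ^+ 2 / (2 * sigma ^+ 2) + - ((- ((x - mu) * Num.sqrt (2 * theta) / sigma)) ^+ 2 / 4) = 0.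
  have s2 : Num.sqrt (2 * theta) ^+ 2 = 2 * theta by rewrite sqr_sqrtr// mulr_ge0// ltW.
  rewrite sqrrN !exprMn s2; field; rewrite ?gt_eqF//.
rewrite expR0 mul1r; congr (_ * _); rewrite /pc_int; apply: eq_Rintegral => u _.
by rewrite /pc_wt expr0 mul1r /psi_kap; congr (_ * expR (_ + _)); ring.
Qed.

Lemma psi_gt0 x : 0 < psi x.
Proof. by rewrite psi_lamE mulr_gt0 ?invr_gt0 ?GammaE ?pc_int_gt0. Qed.

Definition psi' x := (Gamma a)^-1 * (psi_kap * pc_int a 1 (psi_kap * (x - mu))).

Lemma psi'_gt0 x : 0 < psi' x.
Proof. by rewrite /psi' mulr_gt0 ?invr_gt0 ?GammaE// mulr_gt0 ?pc_int_gt0 ?psi_kap_gt0. Qed.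

Lemma psi_is_derive (x : R) : is_derive x 1 psi (psi' x).
Proof.
have -> : psi = (Gamma a)^-1 \*: (pc_int a 0 \o (fun x => psi_kap * (x - mu))).
  by apply/funext => y; rewrite psi_lamE.
have H : is_derive x 1 (fun x : R => psi_kap * (x - mu)) psi_kap.
  apply: is_derive_eq; rewrite /GRing.scale/=; ring.
have := @is_derive1_comp _ (pc_int a 0) _ x _ _ (pc_int_is_derive a0 (psi_kap * (x - mu))) H => H2.
by apply: is_derive_eq; rewrite /psi' /GRing.scale/=; ring.
Qed.

Lemma psi_tangent x y : psi x + psi' x * (y - x) <= psi y.
Proof.
rewrite !psi_lamE /psi'.
have := @pc_int_tangent _ a a0 (psi_kap * (x - mu)) (psi_kap * (y - x)).
have -> : psi_kap * (x - mu) + psi_kap * (y - x) = psi_kap * (y - mu) by ring.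
have G0 : 0 <= (Gamma a)^-1 by rewrite invr_ge0 ltW// GammaE.
move=> /(ler_wpM2l G0); apply: le_trans; rewrite le_eqVlt; apply/orP; left; apply/eqP; ring.
Qed.

Lemma psi_le x y : x <= y -> psi x <= psi y.
Proof.
move=> xy; apply: le_trans (psi_tangent x y).
by rewrite lerDl mulr_ge0 ?subr_ge0// ltW ?psi'_gt0.
Qed.

Lemma psi_growth : exists2 C, 0 < C & forall x, mu <= x -> C * (x - mu) ^+ 2 <= psi x.
Proof.
exists ((Gamma a)^-1 * (psi_kap ^+ 2 / 2 * pc_int a 2 0)).
  by rewrite mulr_gt0 ?invr_gt0 ?GammaE// mulr_gt0 ?pc_int_gt0// divr_gt0// exprn_gt0// psi_kap_gt0.
move=> x xm; have := @pc_int_growth _ a a0 (psi_kap * (x - mu)).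
rewrite mulr_ge0 ?subr_ge0 ?(ltW psi_kap_gt0)// => /(_ isT) => h.
have G0 : 0 <= (Gamma a)^-1 by rewrite invr_ge0 ltW// GammaE.
rewrite psi_lamE; apply: le_trans (ler_wpM2l G0 h).
by have -> (u v k y : R) : u * (k ^+ 2 / 2 * v) * y ^+ 2 = u * ((k * y) ^+ 2 / 2 * v) by field.
Qed.

Lemma gam_exists K : exists x, K < x /\ psi x / derive1 psi x = x - K.
Proof.
have dpsi x : derive1 psi x = psi' x by have := psi_is_derive x => h; rewrite derive1E derive_val.
have [C C0 hC] := psi_growth.
pose f1 := (K + 1 - K) / psi (K + 1).
have f10 : 0 < f1 by rewrite divr_gt0 ?psi_gt0// addrAC subrr add0r.
have Cf : 0 < C * f1 by rewrite mulr_gt0.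
(* With s = M - mu > q one has M - K <= s (1 + |mu - K|) < C f1 s^2 <= f1 psi M, which puts the
   ratio at M below its value f1 at K + 1. *)
pose q := (1 + `|mu - K|) / (C * f1).
pose M := Num.max (K + 1) mu + 1 + q.
have q0 : 0 < q by rewrite divr_gt0// ltr_wpDr.
have MK : K + 1 < M.
  have h : K + 1 <= Num.max (K + 1) mu by rewrite le_max lexx.
  by rewrite /M -addrA; apply: le_lt_trans h _; rewrite ltrDl addr_gt0.
have Mmu : 1 + q <= M - mu by rewrite lerBrDr /M -[leRHS]addrA [leRHS]addrC lerD2l le_max lexx orbT.
have fM : (M - K) / psi M < f1.
  rewrite ltr_pdivrMr ?psi_gt0//.
  set s := M - mu in Mmu *.
  have s1 : 1 <= s by apply: le_trans Mmu; rewrite lerDl ltW.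
  have s0 : 0 < s by exact: lt_le_trans s1.
  have hs : M - K <= s * (1 + `|mu - K|).
    have -> : M - K = s + (mu - K) by rewrite /s addrA subrK.
    by rewrite mulrDr mulr1 lerD2l (le_trans (ler_norm _))// ler_peMl.
  apply: le_lt_trans hs _.
  have h : C * s ^+ 2 <= psi M by apply: hC; rewrite -subr_ge0 ltW.
  apply: lt_le_trans (ler_wpM2l (ltW f10) h).
  have -> (x y z : R) : x * (y * z ^+ 2) = z * (z * (y * x)) by ring.
  rewrite ltr_pM2l// -ltr_pdivrMr// (lt_le_trans _ Mmu)// -[ltLHS]add0r ltrD2r//.
have [c [Kc E]] := ratio_critical psi_gt0 psi_is_derive (ltr_pwDr ltr01 (lexx K)) MK fM.
exists c; split => //; rewrite dpsi E mulfK// gt_eqF// psi'_gt0//.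
Qed.

Lemma gam_spec Phi c : let g := gam theta sigma mu lam Phi c in
  xbar0 theta mu lam Phi c < g /\ psi g = psi' g * (g - xbar0 theta mu lam Phi c).
Proof.
move=> g; have := xgetPex 0 (gam_exists (xbar0 theta mu lam Phi c)).
rewrite -/(gam theta sigma mu lam Phi c) -/g => -[h1 h2]; split=> //.
rewrite -h2 derive1E; have h := psi_is_derive g; rewrite derive_val mulrC divfK//.
by rewrite gt_eqF// psi'_gt0.
Qed.

End psi.

(** * Joint measurability from monotonicity and continuity *)

Section joint_measurability.
Context {R : realType}.

Lemma floor_grid_cvg (y : R) :
  (fun n => (Num.floor (y * (2 ^ n)%:R))%:~R / (2 ^ n)%:R) @ \oo --> y.
Proof.
have p n : 0 < (2 ^ n)%:R :> R by rewrite ltr0n expn_gt0.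
apply: (@squeeze_cvgr _ _ _ _ (fun n => y - 1 / (2 ^ n)%:R) (fun=> y)).
- apply: nearW => n; have /andP[h1 h2] := floor_itv (y * (2 ^ n)%:R).
  rewrite ler_pdivrMr// h1 andbT ler_pdivlMr// mulrBl divfK ?gt_eqF//.
  by rewrite lerBlDr ltW// -intrD1.
- rewrite -[X in _ --> X]subr0; apply: cvgB; first exact: cvg_cst.
  have -> : (fun n => 1 / (2 ^ n)%:R : R) = (fun n => (2^-1) ^+ n).
    by apply/funext => n; rewrite div1r exprVn natrX.
  by apply: cvg_expr; rewrite ger0_norm ?invr_ge0// invf_lt1// ltr1n.
- exact: cvg_cst.
Qed.

(** The second variable is rounded to a dyadic grid, where countably many sections, measurable by
    monotonicity in q, are glued. Monotonicity replaces regularity of q -> [gam q], which is defined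
    by choice. *)
Lemma measurable_monotone_continuous (F : R -> R -> R) :
  (forall y q q', q <= q' -> F q' y <= F q y) ->
  (forall q, continuous (F q)) ->
  measurable_fun setT (fun z : R * R => F z.1 z.2).
Proof.
move=> Fm Fc.
pose G n (z : R * R) := F z.1 ((Num.floor (z.2 * (2 ^ n)%:R))%:~R / (2 ^ n)%:R).
apply: (@measurable_fun_cvg _ _ _ setT G); last first.
  by move=> z _; apply: continuous_cvg; [exact: Fc|exact: floor_grid_cvg].
move=> n _ A mA; rewrite setTI.
have -> : G n @^-1` A = \bigcup_(i : int)
    ((fun q => F q (i%:~R / (2 ^ n)%:R)) @^-1` A `*` [set y | Num.floor (y * (2 ^ n)%:R) = i]).
  apply/seteqP; split => [[q y] /= Hz|[q y] /= [i _ [/= h e]]]; last by rewrite /preimage/= /G/= e.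
  by exists (Num.floor (y * (2 ^ n)%:R)).
apply: countable_bigcupT_measurable => // i; apply: measurableX.
  rewrite -[X in measurable X]setTI.
  by apply: (@nonincreasing_measurable _ setT) => // q q' *; exact: Fm.
rewrite -[X in measurable X]setTI.
have -> : [set: R] `&` [set y : R | Num.floor (y * (2 ^ n)%:R) = i] =
    `[i%:~R / (2 ^ n)%:R, (i%:~R + 1) / (2 ^ n)%:R[%classic.
  have p : 0 < (2 ^ n)%:R :> R by rewrite ltr0n expn_gt0.
  apply/seteqP; split => y /=; rewrite in_itv/= ler_pdivrMr// ltr_pdivlMr// -intrD1.
    by move=> [_ <-]; exact: floor_itv.
  by move=> h; split => //; exact: floor_def.
exact: measurable_itv.
Qed.
End joint_measurability.

(** * Stopping values and the verification inequalities *)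

Section stopping_value.
Context {R : realType}.
Variables (p p' : R -> R).
Hypotheses (p0 : forall y, 0 < p y) (p'0 : forall y, 0 < p' y).
Hypothesis tang : forall x y, p x + p' x * (y - x) <= p y.

Lemma convex_slope_le x y : x <= y -> p' x <= p' y.
Proof.
rewrite le_eqVlt => /predU1P[->//|xy].
have := tang x y; have := tang y x => h1 h2.
have d0 : 0 < y - x by rewrite subr_gt0.
rewrite -(ler_pM2r d0); nra.
Qed.

Lemma convex_le x y : x <= y -> p x <= p y.
Proof.
move=> xy; apply: le_trans (tang x y).
by rewrite lerDl mulr_ge0 ?subr_ge0// ltW.
Qed.

(** Candidate value for stopping the reward y - K at threshold g. Below g it is the multiple of p
    meeting the reward at g; when p g = p' g (g - K) the contact is tangential, which is smooth
    fit. *)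
Definition stop_val (g K y : R) := if y < g then (g - K) / p g * p y else y - K.

Section one.
Variables (g K : R).
Hypotheses (Kg : K < g) (gE : p g = p' g * (g - K)).
Let al := (g - K) / p g.
Let S := stop_val g K.
Let al0 : 0 < al. Proof. by rewrite divr_gt0// subr_gt0. Qed.
Let alE : al * p' g = 1.
Proof. by rewrite /al gE; field; apply/andP; split; rewrite gt_eqF ?subr_gt0. Qed.
Let alg : al * p g = g - K. Proof. by rewrite /al divfK// gt_eqF. Qed.

(** The line y - K is the tangent at g of the convex function al p, because al p'(g) = 1 and al p(g)
    = g - K. *)
Lemma stop_val_tangent y : y - K <= al * p y.
Proof.
have := ler_wpM2l (ltW al0) (tang g y); rewrite mulrDr mulrA alE alg; lra.
Qed.

Lemma stop_val_le y : S y <= al * p y.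
Proof. by rewrite /S /stop_val; case: ifP => // _; exact: stop_val_tangent. Qed.

Lemma stop_val_ge y : y - K <= S y.
Proof. by rewrite /S /stop_val; case: ifP => // _; exact: stop_val_tangent. Qed.

Lemma stop_val_ge0 y : 0 <= S y.
Proof.
rewrite /S /stop_val; case: ltP => [_|gy]; first by rewrite mulr_ge0 ?ltW.
by rewrite subr_ge0 (le_trans (ltW Kg)).
Qed.

(** Below g the slope al p' is at most its value 1 at g; above g it equals 1. *)
Lemma stop_val_exc y z : y <= z -> S z - z <= S y - y.
Proof.
move=> yz; have [zg|gz] := ltP z g; last first.
  have := stop_val_ge y; rewrite {2}/S /stop_val ltNge gz/=; lra.
have yg : y < g by exact: le_lt_trans zg.
rewrite /S /stop_val zg yg -/al.
have h1 := ler_wpM2l (ltW al0) (tang z y).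
have h2 := ler_wpM2l (ltW al0) (convex_slope_le (ltW zg)); rewrite alE in h2.
have h3 : al * p' z * (z - y) <= 1 * (z - y) by apply: ler_wpM2r; rewrite ?subr_ge0.
by move: h1; rewrite mulrDr mulrA => h1; nra.
Qed.

Lemma stop_val_mono y z : y <= z -> S y <= S z.
Proof.
move=> yz; rewrite /S /stop_val -/al; case: ltP => yg; case: ltP => zg.
- by rewrite ler_wpM2l ?(ltW al0)// convex_le.
- apply: le_trans (ler_wpM2l (ltW al0) (convex_le (ltW yg))) _.
  by rewrite alg lerD2r.
- by move: (le_lt_trans yz zg); rewrite ltNge yg.
- by rewrite lerD2r.
Qed.

Lemma stop_val_lip y z : `|S y - S z| <= `|y - z|.
Proof.
wlog yz : y z / y <= z.
  move=> H; case: (leP y z) => [/H//|/ltW/H].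
  by rewrite distrC [X in _ <= X]distrC.
have h1 := stop_val_exc yz; have h2 := stop_val_mono yz.
rewrite distrC ger0_norm ?subr_ge0// distrC ger0_norm ?subr_ge0//; lra.
Qed.

(** Beyond g waiting does not pay: the tangent at y evaluated at g, with p g = p' g (g - K) <= p' y
    (g - K), yields p y <= p' y (y - K), so (y - K) / p y does not increase. *)
Lemma stop_val_ratio y z : g <= y -> y <= z -> (z - K) * p y <= (y - K) * p z.
Proof.
move=> gy yz.
have h1 : p y <= p' y * (y - K).
  have := tang y g; rewrite gE => h.
  have := ler_wpM2r (ltW _ : 0 <= g - K) (convex_slope_le gy); rewrite subr_gt0 => /(_ Kg); lra.
have yK : 0 <= y - K by rewrite subr_ge0 (le_trans (ltW Kg)).
have h2 := ler_wpM2l yK (tang y z).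
apply: le_trans h2.
have h3 : p y * (z - y) <= (p' y * (y - K)) * (z - y) by rewrite ler_wpM2r ?subr_ge0.
lra.
Qed.

End one.

(** Using the threshold g1 in the problem with cost K2 is suboptimal. That strategy loses (K2 - K1)
    p y / p g1 relative to cost K1, and the discount p y / p g1 is at most 1. *)
Lemma stop_val_mono_cost g1 K1 g2 K2 y :
  K1 < g1 -> p g1 = p' g1 * (g1 - K1) -> K2 < g2 -> p g2 = p' g2 * (g2 - K2) ->
  K1 <= K2 -> stop_val g1 K1 y + K1 <= stop_val g2 K2 y + K2.
Proof.
move=> Kg1 gE1 Kg2 gE2 K12.
have [yg1|g1y] := ltP y g1; last first.
  have := stop_val_ge Kg2 gE2 y; rewrite {2}/stop_val ltNge g1y/=; lra.
rewrite {1}/stop_val yg1.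
have r1 : p y / p g1 <= 1 by rewrite ler_pdivrMr// mul1r convex_le// ltW.
have r0 : 0 < p y / p g1 by rewrite divr_gt0.
(* [H] is that suboptimality: for y < g2 it is the tangent bound at g1, and for y >= g2 it says that
   moving on from y to g1 is worse than stopping. *)
suff H : (g1 - K2) * (p y / p g1) <= stop_val g2 K2 y.
  have E : (g1 - K1) / p g1 * p y = (g1 - K2) * (p y / p g1) + (K2 - K1) * (p y / p g1).
    by rewrite -mulrDl -mulrA [_^-1 * _]mulrC; congr (_ * _); ring.
  have : (K2 - K1) * (p y / p g1) <= (K2 - K1) * 1 by rewrite ler_wpM2l// subr_ge0.
  by rewrite E; lra.
have [yg2|g2y] := ltP y g2.
  rewrite /stop_val yg2.
  have := stop_val_tangent Kg2 gE2 g1 => h.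
  apply: le_trans (ler_wpM2r (ltW r0) h) _.
  by rewrite le_eqVlt; apply/orP; left; apply/eqP; field; apply/andP; split; rewrite gt_eqF.
rewrite /stop_val ltNge g2y/= mulrA ler_pdivrMr//.
exact: stop_val_ratio Kg2 gE2 _ _ g2y (ltW yg1).
Qed.

(* The excess [S y - y] is nonincreasing, so beyond the threshold the kernel is compared with its value there. *)
Lemma stop_val_kernel d (T : measurableType d) (P : probability T R) (xi : T -> R) (m : R -> R)
    (g K E y : R) :
  K < g -> p g = p' g * (g - K) -> measurable_fun setT xi -> measurable_fun setT p ->
  (forall z, \int[P]_w (p (m z + xi w))%:E = (E * p z)%:E)%E -> 1 <= E ->
  (forall z, g <= z -> 0 <= m z - m g <= z - g) ->
  (\int[P]_w (stop_val g K (m y + xi w))%:E <= (E * stop_val g K y)%:E)%E.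
Proof.
move=> Kg gE mxi mp ker E1 hm.
have al0 : 0 <= (g - K) / p g by rewrite divr_ge0 ?subr_ge0 ?ltW.
have mpx z : measurable_fun setT (fun w => (p (m z + xi w))%:E).
  have mz : measurable_fun setT (fun w => m z + xi w) by exact: measurable_funD.
  by apply/measurable_EFinP; exact: (measurableT_comp mp mz).
have mS : measurable_fun setT (stop_val g K).
  apply: measurable_fun_ifT => //; [exact: measurable_fun_ltr|by apply: measurable_funM|exact: measurable_funB].
have mSx : measurable_fun setT (fun w => (stop_val g K (m y + xi w))%:E).
  have mz : measurable_fun setT (fun w => m y + xi w) by exact: measurable_funD.
  by apply/measurable_EFinP; exact: (measurableT_comp mS mz).
have [yg|gy] := ltP y g.
  apply: (@le_trans _ _ (\int[P]_w (((g - K) / p g)%:E * (p (m y + xi w))%:E))%E).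
    apply: ge0_le_integral => //.
    - by move=> w _; rewrite lee_fin stop_val_ge0.
    - by apply: emeasurable_funM.
    - by move=> w _; rewrite -EFinM lee_fin stop_val_le.
  rewrite ge0_integralZl//; last by move=> w _; rewrite lee_fin ltW.
  by rewrite ker -EFinM lee_fin /stop_val yg mulrCA.
have /andP[d0 d1] := hm _ gy.
apply: (@le_trans _ _ (\int[P]_w ((m y - m g)%:E + ((g - K) / p g)%:E * (p (m g + xi w))%:E))%E).
  apply: ge0_le_integral => //.
  - by move=> w _; rewrite lee_fin stop_val_ge0.
  - by apply: emeasurable_funD => //; apply: emeasurable_funM.
  - move=> w _; rewrite -EFinM -EFinD lee_fin.
    have h1 := stop_val_le Kg gE (m g + xi w).
    have h2 : m g + xi w <= m y + xi w by rewrite lerD2r -subr_ge0.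
    have := stop_val_exc Kg gE h2; lra.
rewrite ge0_integralD//; last 2 first.
- by move=> w _; rewrite -EFinM lee_fin mulr_ge0// ltW.
- by apply: emeasurable_funM.
rewrite ge0_integralZl//; last by move=> w _; rewrite lee_fin ltW.
rewrite ker integral_cst//= probability_setT mule1 -EFinM -EFinD lee_fin.
rewrite /stop_val ltNge gy/=.
have -> : (g - K) / p g * (E * p g) = E * (g - K) by field; rewrite gt_eqF.
have : 1 * (y - g) <= E * (y - g) by rewrite ler_wpM2r// subr_ge0.
lra.
Qed.

Lemma stop_val_continuous g K : K < g -> p g = p' g * (g - K) -> continuous (stop_val g K).
Proof.
move=> Kg gE y; apply/cvgrPdist_lt => e e0; exists e => //= z yz.
by apply: le_lt_trans yz; exact: stop_val_lip.
Qed.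
End stopping_value.

(** * Action of the gaussian step on psi *)

Section tilt.
Context {R : realType}.
Variables (theta sigma mu lam : R).
Hypotheses (th0 : 0 < theta) (sg0 : 0 < sigma) (lam0 : 0 < lam).
Let a := lam / theta.
Let a0 : 0 < a. Proof. exact: divr_gt0. Qed.
Let psi := psi_lam theta sigma mu lam.
Let kap := psi_kap theta sigma.
Notation D := (`]0%R, +oo[%classic : set R).

(* Integrating out the gaussian step turns the weight [exp(-u^2/2)] of the parabolic cylinder integral into
   [exp(-(ru)^2/2)], which a rescaling of [u] undoes; the exponential tilt merely moves the starting point. *)
Lemma psi_tilt d (T : measurableType d) (P : probability T R) (xi : T -> R) h b y :
  measurable_fun setT xi ->
  (forall b, \int[P]_w (expR (b * xi w))%:E = (expR (b ^+ 2 * ou_var theta sigma h / 2))%:E)%E ->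
  (\int[P]_w (expR (b * xi w) * psi (ou_mean theta mu h y + xi w))%:E =
   (expR (b ^+ 2 * ou_var theta sigma h / 2) *
    (expR (lam * h) * psi (y + b * ou_var theta sigma h / expR (- (theta * h)))))%:E)%E.
Proof.
move=> mxi mgf; set v := ou_var theta sigma h in mgf *; set r := expR (- (theta * h)).
have r0 : 0 < r by exact: expR_gt0.
have kv : kap ^+ 2 * v = 1 - r ^+ 2.
  have s2 : Num.sqrt (2 * theta) ^+ 2 = 2 * theta by rewrite sqr_sqrtr// mulr_ge0// ltW.
  by rewrite /kap /psi_kap /v /ou_var -/r !exprMn s2; field; rewrite !gt_eqF.
pose al w := kap * (ou_mean theta mu h y - mu) + kap * xi w.
have mal : measurable_fun setT al by apply: measurable_funD => //; exact: measurable_funM.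
have mch : measurable_fun setT (fun w => (Gamma a)^-1 * expR (b * xi w)).
  by apply: measurable_funM => //; apply: measurableT_comp => //; exact: measurable_funM.
have ch0 w : 0 <= (Gamma a)^-1 * expR (b * xi w) by rewrite mulr_ge0 ?expR_ge0// invr_ge0 ltW// GammaE.
transitivity (\int[P]_w (\int[lebesgue_measure]_(u in D) ((Gamma a)^-1 * expR (b * xi w) *
    (powR u (a - 1) * expR (- (2^-1 * u ^+ 2) + u * al w)))%:E))%E.
  apply: eq_integral => w _; under [RHS]eq_integral => u _ do rewrite EFinM.
  have Ew : kap * (ou_mean theta mu h y + xi w - mu) = al w by rewrite /al; ring.
  rewrite ge0_integralZl//; last 3 first.
  - apply/measurable_EFinP; apply: measurable_funTS; apply: measurable_funM; first exact: measurable_powR.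
    apply: measurableT_comp => //; apply: measurable_funD; last exact: measurable_funM.
    by apply: measurable_funN; apply: measurable_funM => //; exact: measurable_funX.
  - by move=> u _; rewrite lee_fin mulr_ge0 ?powR_ge0 ?expR_ge0.
  - by rewrite lee_fin ch0.
  have -> : psi (ou_mean theta mu h y + xi w) = (Gamma a)^-1 * pc_int a 0 (al w) by rewrite -Ew; exact: psi_lamE.
  rewrite mulrA [expR _ * _]mulrC EFinM; congr (_ * _)%E.
  rewrite /pc_int /Rintegral fineK; last exact: (integrable_fin_num _ (pc_integrable a0 _ _)).
  by apply: eq_integral => u _; rewrite /pc_wt expr0 !mul1r [_ / 2]mulrC.
rewrite (pc_tonelli a P mch ch0 mal (measurable_cst (2^-1 : R))).
have -> : expR (b ^+ 2 * v / 2) * (expR (lam * h) * psi (y + b * v / r)) =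
   ((Gamma a)^-1 * expR (b ^+ 2 * v / 2)) * (powR r (- a) * pc_int a 0 (kap * (y + b * v / r - mu))).
  have -> : powR r (- a) = expR (lam * h).
    by rewrite /r -expRM; congr expR; rewrite /a; field; rewrite gt_eqF.
  have -> : psi (y + b * v / r) = (Gamma a)^-1 * pc_int a 0 (kap * (y + b * v / r - mu)) by exact: psi_lamE.
  ring.
rewrite EFinM -(pc_scale a0 _ r0) -ge0_integralZl//; last 3 first.
- apply/measurable_EFinP; apply: measurable_funTS; apply: measurable_funM; first exact: measurable_powR.
  apply: measurableT_comp => //; apply: measurable_funD; last exact: measurable_funM.
  by apply: measurable_funN; apply: measurable_funM => //; exact: measurable_funX.
- by move=> u _; rewrite lee_fin mulr_ge0 ?powR_ge0 ?expR_ge0.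
- by rewrite lee_fin mulr_ge0 ?expR_ge0// invr_ge0 ltW// GammaE.
apply: eq_integral => u _.
transitivity (\int[P]_w (((Gamma a)^-1 * (powR u (a - 1) * expR (- (2^-1 * u ^+ 2) + u * (kap * (ou_mean theta mu h y - mu)))))%:E
   * (expR ((b + u * kap) * xi w))%:E))%E.
  apply: eq_integral => w _; rewrite -EFinM; congr EFin.
  have -> (A B C E : R) : A * B * (C * E) = A * (C * (B * E)) by ring.
  have -> (A C E F : R) : A * (C * E) * F = A * (C * (E * F)) by ring.
  by rewrite -!expRD; congr (_ * (_ * expR _)); rewrite /al /cst; ring.
rewrite ge0_integralZl//; last 2 first.
- by apply/measurable_EFinP; apply: measurableT_comp => //; exact: measurable_funM.
- by rewrite lee_fin !mulr_ge0 ?powR_ge0 ?expR_ge0// invr_ge0 ltW// GammaE.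
rewrite mgf -!EFinM; congr EFin.
set e1 := expR _; set e2 := expR _; set e3 := expR _; set e4 := expR _.
suff E : e1 * e2 = e3 * e4.
  have -> (A C : R) : A * (C * e1) * e2 = A * C * (e1 * e2) by ring.
  by rewrite E; ring.
rewrite /e1 /e2 /e3 /e4 -!expRD; congr expR.
have -> : ou_mean theta mu h y - mu = (y - mu) * r by rewrite /ou_mean -/r; ring.
have -> : - (r ^+ 2 / 2 * u ^+ 2) = - (u ^+ 2 / 2) + u ^+ 2 * (1 - r ^+ 2) / 2 by field.
by rewrite -kv; field; rewrite gt_eqF.
Qed.

Lemma psi_kernel d (T : measurableType d) (P : probability T R) (xi : T -> R) h y :
  measurable_fun setT xi ->
  (forall b, \int[P]_w (expR (b * xi w))%:E = (expR (b ^+ 2 * ou_var theta sigma h / 2))%:E)%E ->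
  (\int[P]_w (psi (ou_mean theta mu h y + xi w))%:E = (expR (lam * h) * psi y)%:E)%E.
Proof.
move=> mxi mgf; have := psi_tilt 0 y mxi mgf.
under eq_integral => w _ do rewrite mul0r expR0 mul1r.
by rewrite expr0n/= !mul0r expR0 mul1r addr0.
Qed.

End tilt.

(** * Gain, saving and their monotonicity in the level *)

Section verification.
Context {R : realType}.
Variables (theta sigma mu lam : R) (Phi : R -> R).
Hypotheses (th0 : 0 < theta) (sg0 : 0 < sigma) (mu0 : 0 < mu) (lam0 : 0 < lam).
Hypothesis dPhi : forall y : R, derivable Phi y 1.
Hypothesis Phi_ni : forall y z, y <= z -> Phi z <= Phi y.
Hypothesis Phi_cvx : forall y z s, y != z -> 0 < s -> s < 1 ->
  Phi (s * y + (1 - s) * z) < s * Phi y + (1 - s) * Phi z.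
Hypothesis Phi1 : Phi 1 = 0.
Hypothesis k_lt0 : forall c, 0 <= c -> c <= 1 -> kfun theta lam Phi c < 0.

Let zt := zeta theta lam Phi.
Let K := xbar0 theta mu lam Phi.
Let gm := gam theta sigma mu lam Phi.
Let p := psi_lam theta sigma mu lam.
Let pp := psi' theta sigma mu lam.
Let tang := psi_tangent mu th0 sg0 lam0.
Let p0 := psi_gt0 mu th0 sg0 lam0.
Let pp0 := psi'_gt0 mu th0 sg0 lam0.
Let lt0 : 0 < lam + theta. Proof. exact: addr_gt0. Qed.

Definition ou_resolvent (y : R) := (y - mu) / (lam + theta) + mu / lam.
Let A := ou_resolvent.
Definition gain (q y : R) := y * (1 - q) - lam * Phi q * A y.
(** The factor is minus the slope of [gain q]. The level 1 is set apart because zeta vanishes there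
    and [xbar0] divides by it. *)
Definition saving (q y : R) :=
  if q == 1 then 0 else - zt q / (lam + theta) * stop_val p (gm q) (K q) y.

Lemma zeta1 : zt 1 = 0.
Proof. by rewrite /zt /zeta subrr mulr0 Phi1 mulr0 subrr. Qed.

(** The derivative of zeta is -k; this is where the sign of k enters. *)
Lemma zeta_lt q q' : 0 <= q -> q < q' -> q' <= 1 -> zt q < zt q'.
Proof.
move=> q0 qq q1.
have dz (y : R) : is_derive y 1 zt (- kfun theta lam Phi y).
  have h : is_derive y 1 Phi (derive1 Phi y).
    by rewrite derive1E; apply/derivableP; exact: dPhi.
  by rewrite /zt /zeta /kfun; apply: is_derive_eq; rewrite /GRing.scale/=; ring.
apply: (@gtr0_derive1_incr _ zt 0 1) => //.
- move=> y; rewrite in_itv/= => /andP[/ltW y0 /ltW y1].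
  by rewrite derive1E; have h := dz y; rewrite derive_val oppr_gt0 k_lt0.
- apply: continuous_subspaceT => y.
  by apply: differentiable_continuous; apply/derivable1_diffP; have := dz y => -[].
Qed.

Lemma zeta_lt0 q : 0 <= q -> q < 1 -> zt q < 0.
Proof. by move=> q0 q1; rewrite -zeta1; exact: zeta_lt. Qed.

Lemma Phi_ge0 q : q <= 1 -> 0 <= Phi q.
Proof. by move=> q1; rewrite -Phi1; exact: Phi_ni. Qed.

Lemma Phi_chord q q' : q <= q' -> q' < 1 -> Phi q' * (1 - q) <= Phi q * (1 - q').
Proof.
rewrite le_eqVlt => /predU1P[->//|qq q1].
have q1' : q < 1 by exact: lt_trans q1.
have d0 : 0 < 1 - q by rewrite subr_gt0.
pose s := (1 - q') / (1 - q).
have s0 : 0 < s by rewrite divr_gt0// subr_gt0.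
have s1 : s < 1 by rewrite ltr_pdivrMr// mul1r ltrD2l ltrN2.
have := @Phi_cvx q 1 s; rewrite lt_eqF// => /(_ isT s0 s1).
have -> : s * q + (1 - s) * 1 = q' by rewrite /s; field; rewrite gt_eqF.
rewrite Phi1 mulr0 addr0 => /ltW h.
apply: le_trans (ler_wpM2r (ltW d0) h) _.
by rewrite /s le_eqVlt; apply/orP; left; apply/eqP; field; rewrite gt_eqF.
Qed.

(** Divided through by 1 - q, [xbar0] is an increasing function of Phi q / (1 - q) while zeta is
    negative, and by [Phi_chord] this ratio does not increase with q. *)
Lemma xbar0_ni q q' : 0 <= q -> q <= q' -> q' < 1 -> K q' <= K q.
Proof.
move=> q0 qq q1; have z0 := zeta_lt0 q0 (le_lt_trans qq q1).
have z1 := zeta_lt0 (le_trans q0 qq) q1.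
rewrite /K /xbar0 ler_ndivrMr// mulrAC ler_ndivrMr//.
rewrite -!mulrA !ler_pM2l//; have := ler_wpM2l (ltW lt0) (Phi_chord qq q1).
by rewrite /zt /zeta; lra.
Qed.

Lemma gain1 y : gain 1 y = 0.
Proof. by rewrite /gain subrr Phi1 !(mulr0, mul0r) subrr. Qed.

(** Identifies [xbar0 q] as the state at which spending all the fuel and never spending any cost the
    same; - [gain q] is thus a positive multiple of the reward of [stop_val]. *)
Lemma gainE q y : 0 <= q -> q < 1 -> gain q y = zt q / (lam + theta) * (y - K q).
Proof.
move=> q0 q1; have zn : zt q != 0 by rewrite lt_eqF// zeta_lt0.
have E : zt q / (lam + theta) * (y - K q) = (zt q * y - theta * mu * Phi q) / (lam + theta).
  rewrite /K /xbar0 -/zt; field; rewrite ?zn ?gt_eqF//.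
by rewrite E /gain /A /ou_resolvent /zt /zeta; field; rewrite ?gt_eqF.
Qed.

Lemma gm_spec q : K q < gm q /\ p (gm q) = pp (gm q) * (gm q - K q).
Proof. exact: (gam_spec mu th0 sg0 lam0 Phi q). Qed.

Lemma saving_ge0 q y : 0 <= q -> q <= 1 -> 0 <= saving q y.
Proof.
move=> q0; rewrite le_eqVlt /saving => /predU1P[->|q1]; first by rewrite eqxx.
rewrite lt_eqF//; have [h1 h2] := gm_spec q.
rewrite mulr_ge0 ?(stop_val_ge0 p0 h1)// divr_ge0 ?(ltW lt0)//.
by rewrite oppr_ge0 ltW// zeta_lt0.
Qed.

Lemma stop_sumE q y : 0 <= q -> q < 1 ->
  gain q y + saving q y = - zt q / (lam + theta) * (stop_val p (gm q) (K q) y - (y - K q)).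
Proof. by move=> q0 q1; rewrite gainE// /saving lt_eqF//; ring. Qed.

Lemma gain_saving_ge0 q y : 0 <= q -> q <= 1 -> 0 <= gain q y + saving q y.
Proof.
move=> q0; rewrite le_eqVlt => /predU1P[->|q1]; first by rewrite gain1 /saving eqxx addr0.
rewrite stop_sumE//; have [h1 h2] := gm_spec q.
rewrite mulr_ge0 ?divr_ge0 ?(ltW lt0) ?oppr_ge0 ?(ltW (zeta_lt0 q0 q1))//.
by rewrite subr_ge0 (stop_val_ge p0 pp0 tang h1 h2).
Qed.

(** A product of two nonnegative factors that do not increase in q: - zeta q, and the excess of the
    stopping value over y - K, by [stop_val_mono_cost] and [xbar0_ni]. *)
Lemma gain_saving_ni q q' y : 0 <= q -> q <= q' -> q' <= 1 ->
  gain q' y + saving q' y <= gain q y + saving q y.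
Proof.
move=> q0 qq; rewrite le_eqVlt => /predU1P[q1|q1].
  by rewrite [leLHS](_ : _ = 0) ?gain_saving_ge0// -?q1// q1 gain1 /saving eqxx addr0.
have q'0 := le_trans q0 qq; have q1' := le_lt_trans qq q1.
have [h1 h2] := gm_spec q; have [h1' h2'] := gm_spec q'.
rewrite !stop_sumE// -!mulrA.
have zz : - zt q' <= - zt q.
  rewrite lerN2; move: qq; rewrite le_eqVlt => /predU1P[->//|qq].
  by rewrite ltW// zeta_lt// ltW.
apply: ler_pM => //.
- by rewrite oppr_ge0 ltW// zeta_lt0.
- by rewrite mulr_ge0 ?invr_ge0 ?(ltW lt0)// subr_ge0 (stop_val_ge p0 pp0 tang h1' h2').
rewrite ler_wpM2l ?invr_ge0 ?(ltW lt0)//.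
have := stop_val_mono_cost p0 pp0 tang y h1' h2' h1 h2 (xbar0_ni q0 qq q1).
by rewrite !opprB !addrA lerD2r.
Qed.

(** The bracket of W at the threshold is [gain] evaluated at gamma, and [gainE] turns it into minus
    the stopping reward times the slope factor. *)
Lemma WfunE x c : 0 <= c -> c <= 1 ->
  Wfun theta sigma mu lam Phi x c = lam * Phi c * A x - saving c x.
Proof.
move=> c0; rewrite le_eqVlt /Wfun /saving => /predU1P[->|c1].
  by rewrite eqxx Phi1 !(mulr0, mul0r) subr0.
rewrite lt_eqF// /stop_val -/(gm c) -/p; have [h1 h2] := gm_spec c.
case: ifP => _.
  have := gainE (gm c) c0 c1; rewrite /gain => ->.
  by rewrite /A /ou_resolvent; field; rewrite !gt_eqF.
have := gainE x c0 c1; rewrite /gain -/(A x); move: (zt c / _ * _) => u h.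
have -> : - zt c / (lam + theta) * (x - K c) = - (zt c / (lam + theta) * (x - K c)) by ring.
by rewrite -(gainE x c0 c1) /gain; ring.
Qed.

Lemma gain_lip q y z : 0 <= q -> q <= 1 ->
  `|gain q y - gain q z| <= (1 + lam * Phi 0 / (lam + theta)) * `|y - z|.
Proof.
move=> q0 q1.
have -> : gain q y - gain q z = ((1 - q) - lam * Phi q / (lam + theta)) * (y - z).
  by rewrite /gain /A /ou_resolvent; field; rewrite !gt_eqF.
rewrite normrM ler_wpM2r// (le_trans (ler_normB _ _))// lerD//.
  by rewrite ger0_norm ?subr_ge0// lerBlDr lerDl.
rewrite ger0_norm; last by rewrite divr_ge0 ?mulr_ge0 ?Phi_ge0// ltW.
by rewrite ler_pM2r ?invr_gt0// ler_pM2l// Phi_ni.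
Qed.

Lemma saving_lip q y z : 0 <= q -> q <= 1 ->
  `|saving q y - saving q z| <= - zt 0 / (lam + theta) * `|y - z|.
Proof.
move=> q0 q1; have z0 := zeta_lt0 (lexx 0) ltr01.
have c0 : 0 <= - zt 0 / (lam + theta) by rewrite divr_ge0 ?(ltW lt0)// oppr_ge0 ltW.
rewrite /saving; case: (eqVneq q 1) => [_|qn]; first by rewrite subrr normr0 mulr_ge0.
have {}q1 : q < 1 by rewrite lt_neqAle qn.
have [h1 h2] := gm_spec q.
rewrite -mulrBr normrM; apply: ler_pM => //; last exact: (stop_val_lip p0 pp0 tang h1 h2).
rewrite ger0_norm; last by rewrite divr_ge0 ?(ltW lt0)// oppr_ge0 ltW// zeta_lt0.
rewrite ler_pM2r ?invr_gt0// lerN2.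
by move: q0; rewrite le_eqVlt => /predU1P[<-//|q0]; rewrite ltW// zeta_lt// ltW.
Qed.

(** Uniformity in q comes from comparison with level 0: saving q <= gain 0 + saving 0 - gain q,
    where [gain] grows linearly with constants independent of q. *)
Lemma saving_growth : exists2 C, 0 <= C & forall q y, 0 <= q -> q <= 1 -> saving q y <= C * (1 + `|y|).
Proof.
have z0 := zeta_lt0 (lexx 0) ltr01.
pose L1 := 1 + lam * Phi 0 / (lam + theta).
pose L2 := - zt 0 / (lam + theta).
have L10 : 0 <= L1 by rewrite addr_ge0// divr_ge0 ?(ltW lt0)// mulr_ge0 ?Phi_ge0// ltW.
have L20 : 0 <= L2 by rewrite divr_ge0 ?(ltW lt0)// oppr_ge0 ltW.
pose G0 := lam * Phi 0 * `|A 0|.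
have G00 : 0 <= G0 by rewrite !mulr_ge0 ?Phi_ge0// ltW.
exists (L2 + `|saving 0 0| + L1 + L1 + G0 + G0) => [|q y q0 q1]; first by do !apply: addr_ge0 => //.
have g0 r : 0 <= r -> r <= 1 -> `|gain r y| <= G0 + L1 * `|y|.
  move=> r0 r1; have := gain_lip y 0 r0 r1; rewrite subr0 -/L1 => h.
  have -> : gain r y = gain r 0 + (gain r y - gain r 0) by rewrite addrC subrK.
  rewrite (le_trans (ler_normD _ _))// lerD//.
  rewrite /gain mul0r sub0r normrN normrM [`|lam * _|]ger0_norm ?mulr_ge0 ?Phi_ge0 ?(ltW lam0)//.
  by rewrite ler_wpM2r// ler_pM2l// Phi_ni.
have hm := gain_saving_ni y (lexx 0) q0 q1.
have h0 := saving_lip y 0 (lexx 0) ler01; rewrite subr0 -/L2 in h0.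
have a1 := ler_norm (saving 0 y - saving 0 0).
have a2 := ler_norm (saving 0 0).
have a3 := ler_norm (gain 0 y); have a4 := ler_norm (- gain q y); rewrite normrN in a4.
have b1 := g0 0 (lexx 0) ler01; have b2 := g0 q q0 q1.
have : saving q y <= L2 * `|y| + `|saving 0 0| + 2 * (G0 + L1 * `|y|) by lra.
move/le_trans; apply.
have y0 := normr_ge0 y; have s0 := normr_ge0 (saving 0 0).
have := mulr_ge0 s0 y0; have := mulr_ge0 G00 y0; nra.
Qed.

(** Clipping the level extends monotonicity in q to all real q, so that [saving] becomes a jointly
    measurable function on R x R. *)
Definition clip01 (q : R) := Num.max 0 (Num.min q 1).

Lemma clip01_itv q : 0 <= clip01 q <= 1.
Proof. by rewrite /clip01 le_max lexx/= ge_max ler01/= ge_min lexx orbT. Qed.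

Lemma clip01_id q : 0 <= q -> q <= 1 -> clip01 q = q.
Proof. by move=> q0 q1; rewrite /clip01 min_l// max_r. Qed.

Lemma clip01_le q q' : q <= q' -> clip01 q <= clip01 q'.
Proof.
move=> qq; have h : Num.min q 1 <= Num.min q' 1 by rewrite le_min !ge_min qq lexx orbT.
by rewrite /clip01 ge_max !le_max lexx h orbT.
Qed.

Lemma clip01_measurable : measurable_fun setT clip01.
Proof. by apply: measurable_maxr => //; apply: measurable_minr. Qed.

(** The sum gain + saving is monotone in q and Lipschitz in y, hence jointly measurable; [gain] is
    measurable by its formula and can be subtracted. *)
Lemma saving_measurable : measurable_fun setT (fun z : R * R => saving (clip01 z.1) z.2).
Proof.
have -> : (fun z : R * R => saving (clip01 z.1) z.2) = (fun z : R * R =>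
    (gain (clip01 z.1) z.2 + saving (clip01 z.1) z.2) - gain (clip01 z.1) z.2).
  by apply/funext => z; ring.
apply: measurable_funB.
  apply: (@measurable_monotone_continuous _ (fun q y => gain (clip01 q) y + saving (clip01 q) y)).
    move=> y q q' qq; have /andP[a1 a2] := clip01_itv q; have /andP[b1 b2] := clip01_itv q'.
    by apply: gain_saving_ni => //; exact: clip01_le.
  move=> q y; have /andP[a1 a2] := clip01_itv q.
  apply/cvgrPdist_lt => e e0.
  pose L := (1 + lam * Phi 0 / (lam + theta)) - zt 0 / (lam + theta).
  have z0 := zeta_lt0 (lexx 0) ltr01.
  have L0 : 0 < L.
    rewrite /L ltr_wpDr//; last first.
      by rewrite ltr_wpDr// divr_ge0 ?(ltW lt0)// mulr_ge0 ?Phi_ge0// ltW.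
    by rewrite -mulNr divr_ge0 ?(ltW lt0)// oppr_ge0 ltW.
  exists (e / L); first by rewrite /= divr_gt0.
  move=> z /= yz; rewrite opprD addrACA (le_lt_trans (ler_normD _ _))//.
  apply: le_lt_trans (lerD (gain_lip y z a1 a2) (saving_lip y z a1 a2)) _.
  by rewrite -mulrDl mulNr -/L mulrC -ltr_pdivlMr.
apply: measurable_funB; first apply: measurable_funM => //.
  apply: measurable_funB => //; exact: (measurableT_comp clip01_measurable).
apply: measurable_funM.
  apply: measurable_funM => //.
  have mP : measurable_fun setT Phi.
    by apply: nonincreasing_measurable => // y z _ _; exact: Phi_ni.
  exact: (measurableT_comp mP (measurableT_comp clip01_measurable (@measurable_fst _ _ R R))).
apply: measurable_funD => //; apply: measurable_funM => //; exact: measurable_funB.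
Qed.

Lemma psi_measurable : measurable_fun setT p.
Proof.
apply: continuous_measurable_fun => y.
by apply: differentiable_continuous; apply/derivable1_diffP; have := psi_is_derive mu th0 sg0 lam0 y => -[].
Qed.

(** The discounted saving at a fixed level is a supermartingale: [psi_kernel] supplies the
    eigenfunction identity, and the mean map contracts distances, which is the condition on m in
    [stop_val_kernel]. *)
Lemma saving_kernel d (T : measurableType d) (P : probability T R) (xi : T -> R) h q y :
  0 < h -> 0 <= q -> q <= 1 -> measurable_fun setT xi ->
  (forall b, \int[P]_w (expR (b * xi w))%:E = (expR (b ^+ 2 * ou_var theta sigma h / 2))%:E)%E ->
  (\int[P]_w (saving q (ou_mean theta mu h y + xi w))%:E <= (expR (lam * h) * saving q y)%:E)%E.
Proof.
move=> h0 q0 q1 mxi mgf.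
rewrite /saving; case: (eqVneq q 1) => [_|qn]; first by rewrite integral0 mulr0.
have {}q1 : q < 1 by rewrite lt_neqAle qn.
have [h1 h2] := gm_spec q.
have c0 : 0 <= - zt q / (lam + theta) by rewrite divr_ge0 ?(ltW lt0)// oppr_ge0 ltW// zeta_lt0.
under eq_integral => w _ do rewrite EFinM.
have mz : measurable_fun setT (fun w => ou_mean theta mu h y + xi w) by exact: measurable_funD.
have mS := continuous_measurable_fun (stop_val_continuous p0 pp0 tang h1 h2).
rewrite ge0_integralZl//; last 2 first.
- by apply/measurable_EFinP; exact: (measurableT_comp mS mz).
- by move=> w _; rewrite lee_fin (stop_val_ge0 p0 h1).
rewrite mulrCA [X in (_ <= X)%E]EFinM; apply: lee_wpmul2l => //.
apply: (@stop_val_kernel _ _ _ p0 pp0 tang _ _ P xi (ou_mean theta mu h) (gm q) (K q) (expR (lam * h)) y h1 h2 mxi psi_measurable).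
- by move=> z; exact: psi_kernel.
- by rewrite -[leLHS]expR0 ler_expR mulr_ge0// ltW.
move=> z gz; rewrite /ou_mean.
have -> : mu + (z - mu) * expR (- (theta * h)) - (mu + (gm q - mu) * expR (- (theta * h))) =
   (z - gm q) * expR (- (theta * h)) by ring.
rewrite mulr_ge0 ?subr_ge0 ?expR_ge0//= ler_piMr ?subr_ge0//.
by rewrite -[leRHS]expR0 ler_expR oppr_le0 mulr_ge0// ltW.
Qed.
End verification.

(** * Discretization of the cost *)

Section stieltjes.
Context {R : realType}.
Implicit Types (f v : R -> R) (g : nat -> R) (h : R).

Definition msh (j : nat) : R := (2 ^ j)%:R^-1.

Lemma msh_gt0 j : 0 < msh j.
Proof. by rewrite invr_gt0 ltr0n expn_gt0. Qed.

Lemma msh_le1 j : msh j <= 1.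
Proof. by rewrite invf_le1 ?ltr0n ?expn_gt0// ler1n expn_gt0. Qed.

Lemma msh_cvg : msh @ \oo --> 0.
Proof. by have := @cvg_pow2V R 1; under eq_fun do rewrite div1r. Qed.

Lemma cvg_le_cst (u : nat -> R) (l C : R) : u @ \oo --> l ->
  (\forall n \near \oo, u n <= C) -> l <= C.
Proof.
move=> ul uC; have <- : limn u = l by exact: cvg_lim.
by apply: limr_le => //; apply/cvg_ex; exists l.
Qed.

(** The integrand is a sequence rather than a function, so that left-point and right-point
    evaluations obey the same lemmas. *)
Definition grid_sum g v h (a b : nat) : R :=
  \sum_(a <= k < b) g k * (v (k.+1%:R * h) - v (k%:R * h)).

Lemma grid_sum_cat g v h a b c : (a <= b)%N -> (b <= c)%N ->
  grid_sum g v h a c = grid_sum g v h a b + grid_sum g v h b c.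
Proof. by move=> ab bc; rewrite /grid_sum (big_cat_nat _ bc). Qed.

Lemma grid_sum_bound g v h a b C : (a <= b)%N ->
  (forall k, (a <= k)%N -> v (k%:R * h) <= v (k.+1%:R * h)) ->
  (forall k, (a <= k < b)%N -> `|g k| <= C) ->
  `|grid_sum g v h a b| <= C * (v (b%:R * h) - v (a%:R * h)).
Proof.
move=> ab vm gC; rewrite /grid_sum.
apply: le_trans (ler_norm_sum _ _ _) _.
have -> : v (b%:R * h) - v (a%:R * h) = \sum_(a <= k < b) (v (k.+1%:R * h) - v (k%:R * h)).
  by rewrite (telescope_sumr (fun k => v (k%:R * h))).
rewrite mulr_sumr !big_nat; apply: ler_sum => k kab.
rewrite normrM ler_pM// ?gC// ger0_norm// subr_ge0 vm//.
by case/andP: kab.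
Qed.

(** Splitting each cell in r replaces the value at its left end by values within the cell, so the
    change is at most the oscillation e times the variation of v. *)
Lemma grid_sum_refine f v h N r e : 0 <= h -> (0 < r)%N ->
  (forall a b, 0 <= a -> a <= b -> v a <= v b) ->
  (forall a b, 0 <= a -> a <= b -> b <= N%:R * h -> b - a <= h -> `|f b - f a| <= e) ->
  `|grid_sum (fun k => f (k%:R * (h / r%:R))) v (h / r%:R) 0 (N * r)
     - grid_sum (fun k => f (k%:R * h)) v h 0 N| <= e * (v (N%:R * h) - v 0).
Proof.
move=> h0 r0 vm; elim: N => [|N IH] fe.
  by rewrite mul0n mul0r subrr mulr0 /grid_sum !big_geq// subrr normr0.
have rn : r%:R != 0 :> R by rewrite pnatr_eq0 -lt0n.
have hr0 : 0 <= h / r%:R by rewrite divr_ge0.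
have Er k : (k * r)%:R * (h / r%:R) = k%:R * h by rewrite natrM; field.
have {}IH := IH _.
rewrite (@grid_sum_cat _ _ _ 0 (N * r) (N.+1 * r))// ?leq_mul2r ?leqnSn ?orbT//.
rewrite (@grid_sum_cat _ _ _ 0 N N.+1)//.
set A := grid_sum _ _ _ 0 (N * r); set A' := grid_sum _ _ _ 0 N.
set D := grid_sum _ _ _ (N * r) _.
have -> : A + D - (A' + grid_sum (fun k => f (k%:R * h)) v h N N.+1) =
  (A - A') + (D - grid_sum (fun k => f (k%:R * h)) v h N N.+1) by ring.
have -> : e * (v (N.+1%:R * h) - v 0) = e * (v (N%:R * h) - v 0) + e * (v (N.+1%:R * h) - v (N%:R * h)) by ring.
apply: le_trans (ler_normD _ _) _; apply: lerD.
  apply: IH => a b a0 ab bN; apply: fe => //.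
  by rewrite (le_trans bN)// ler_wpM2r// ler_nat.
have -> : D - grid_sum (fun k => f (k%:R * h)) v h N N.+1 =
    grid_sum (fun k => f (k%:R * (h / r%:R)) - f (N%:R * h)) v (h / r%:R) (N * r) (N.+1 * r).
  rewrite /D /grid_sum big_nat1.
  have -> : v (N.+1%:R * h) - v (N%:R * h) =
      \sum_(N * r <= k < N.+1 * r) (v (k.+1%:R * (h / r%:R)) - v (k%:R * (h / r%:R))).
    rewrite (telescope_sumr (fun k => v (k%:R * (h / r%:R)))) ?Er//.
    by rewrite leq_mul2r leqnSn orbT.
  by rewrite mulr_sumr -sumrB; apply: eq_bigr => k _; rewrite mulrBl.
have := @grid_sum_bound (fun k => f (k%:R * (h / r%:R)) - f (N%:R * h)) v (h / r%:R) (N * r) (N.+1 * r) e.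
rewrite !Er; apply; first by rewrite leq_mul2r leqnSn orbT.
  by move=> k _; apply: vm; rewrite ?mulr_ge0// ler_wpM2r// ler_nat.
move=> k /andP[k1 k2]; have a1 : N%:R * h <= k%:R * (h / r%:R) by rewrite -Er ler_wpM2r// ler_nat.
have a2 : k%:R * (h / r%:R) <= N.+1%:R * h by rewrite -Er ler_wpM2r// ler_nat ltnW.
apply: fe => //; first by rewrite mulr_ge0.
by rewrite lerBlDr (le_trans a2)// -natr1 mulrDl mul1r addrC.
Qed.

Lemma RS_sumE f v m n : (0 < n)%N ->
  RS_sum f v m%:R n = grid_sum (fun k => f (k%:R * (m%:R / n%:R))) v (m%:R / n%:R) 0 n.
Proof.
by move=> n0; rewrite /RS_sum /grid_sum big_mkord; apply: eq_bigr => k _; rewrite !mulrA.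
Qed.

(** Cauchy criterion: the sums with n and N points are both compared with the common refinement
    having n N points. *)
Lemma RS_sum_cvg f v m : {within `[0, +oo[, continuous f} ->
  (forall a b, 0 <= a -> a <= b -> v a <= v b) -> cvgn (RS_sum f v m%:R).
Proof.
move=> cf vm; apply/cauchy_cvgP/cauchy_exP => e e0.
(* The added 1 keeps the divisor positive when v is constant. *)
pose V := v m%:R - v 0 + 1.
have V0 : 0 < V by rewrite ltr_wpDl// subr_ge0 vm.
have e1 : 0 < e / (2 * V) by rewrite divr_gt0// mulr_gt0.
have [dl dl0 H] := unif_cont_segment m%:R cf e1.
have osc n : (0 < n)%N -> m%:R / n%:R < dl ->
  forall a b, 0 <= a -> a <= b -> b <= n%:R * (m%:R / n%:R) -> b - a <= m%:R / n%:R -> `|f b - f a| <= e / (2 * V).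
  move=> n0 nd a b a0 ab bm ba; rewrite distrC; apply/ltW/H => //.
  - by apply: le_trans ab _; apply: le_trans bm _; rewrite mulrCA divff ?mulr1// pnatr_eq0 -lt0n.
  - exact: le_trans ab.
  - by rewrite distrC ger0_norm ?subr_ge0// (le_lt_trans ba).
have Em n : (0 < n)%N -> n%:R * (m%:R / n%:R) = m%:R :> R.
  by move=> n0; rewrite mulrCA divff ?mulr1// pnatr_eq0 -lt0n.
have key n r : (0 < n)%N -> (0 < r)%N -> m%:R / n%:R < dl ->
    `|RS_sum f v m%:R (n * r) - RS_sum f v m%:R n| <= e / (2 * V) * (v m%:R - v 0).
  move=> n0 r0 nd; rewrite !RS_sumE ?muln_gt0 ?n0//.
  have -> : m%:R / (n * r)%:R = m%:R / n%:R / r%:R :> R by rewrite natrM invfM mulrA.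
  have := @grid_sum_refine f v (m%:R / n%:R) n r (e / (2 * V)); rewrite Em//.
  by apply => //; have := osc n n0 nd; rewrite Em.
pose N := (Num.truncn (m%:R / dl)).+1.
have Nd n : (N <= n)%N -> (0 < n)%N /\ m%:R / n%:R < dl.
  move=> Nn; have n0 : (0 < n)%N by exact: leq_trans Nn.
  split => //; rewrite ltr_pdivrMr ?ltr0n// mulrC -ltr_pdivrMr//.
  have /andP[_ h] := truncn_itv (divr_ge0 (ler0n R m) (ltW dl0)).
  by rewrite (lt_le_trans h)// ler_nat.
exists (RS_sum f v m%:R N); exists N => //= n Nn.
rewrite /ball/=; have [N0 Nd0] := Nd _ (leqnn N); have [n0 nd0] := Nd _ Nn.
have h1 := key N n N0 n0 Nd0; have h2 := key n N n0 N0 nd0.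
rewrite mulnC in h2.
have -> : RS_sum f v m%:R N - RS_sum f v m%:R n =
  (RS_sum f v m%:R (N * n) - RS_sum f v m%:R n) - (RS_sum f v m%:R (N * n) - RS_sum f v m%:R N) by ring.
apply: le_lt_trans (ler_normB _ _) _.
apply: le_lt_trans (lerD h2 h1) _.
have -> : e / (2 * V) * (v m%:R - v 0) + e / (2 * V) * (v m%:R - v 0) = e * ((v m%:R - v 0) / V).
  by field; rewrite gt_eqF.
rewrite gtr_pMr// ltr_pdivrMr// mul1r /V ltrDl//.
Qed.

Lemma RS_sum_dyadic f v m j : (0 < m)%N ->
  RS_sum f v m%:R (m * 2 ^ j) = grid_sum (fun k => f (k%:R * msh j)) v (msh j) 0 (m * 2 ^ j).
Proof.
move=> m0; rewrite RS_sumE ?muln_gt0 ?m0 ?expn_gt0//.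
have -> // : m%:R / (m * 2 ^ j)%:R = msh j :> R.
by rewrite natrM invfM mulrA divff ?mul1r// pnatr_eq0 -lt0n.
Qed.

Lemma pow2_cvg_oo m : (0 < m)%N -> (fun j => m * 2 ^ j)%N @ \oo --> \oo.
Proof.
move=> m0 A [N _ AN]; exists N => // j /= Nj; apply: AN => /=.
apply: leq_trans Nj _; apply: leq_trans (ltnW (ltn_expl j (ltnSn 1))) _.
exact: leq_pmull.
Qed.

(** [stieltjes_int] is an iterated limit, mesh before horizon, while here both move together. The
    exponential decay of f and the variation bound 1 make the tail beyond m at most G exp(-b m) at
    every mesh; on [0, m], right and left evaluation differ by the modulus of continuity. *)
Lemma stieltjes_cvg f v (G b : R) : {within `[0, +oo[, continuous f} ->
  (forall x y, 0 <= x -> x <= y -> v x <= v y) -> 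
  (forall x y, 0 <= x -> 0 <= y -> v x - v y <= 1) ->
  0 < b -> (forall s, 0 <= s -> `|f s| <= G * expR (- (b * s))) ->
  (fun j => grid_sum (fun k => f (k.+1%:R * msh j)) v (msh j) 0 (j * 2 ^ j)) @ \oo -->
  stieltjes_int f v.
Proof.
move=> cf vm v1 b0 fG.
have G0 : 0 <= G by have := fG 0 (lexx 0); rewrite mulr0 oppr0 expR0 mulr1; apply: le_trans.
pose L m := limn (fun n => RS_sum f v m%:R n).
pose t m := G * expR (- (b * m%:R)).
have t_cvg : t @ \oo --> 0.
  rewrite -(mulr0 G); apply: cvgM; first exact: cvg_cst.
  have -> : (fun m => expR (- (b * m%:R)) : R) = (fun m => expR (- b) ^+ m).
    by apply/funext => m; rewrite -expRM_natl mulrN mulrC.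
  by apply: cvg_expr; rewrite ger0_norm ?expR_ge0// expR_lt1 oppr_lt0.
have LD m : (0 < m)%N ->
    (fun j => grid_sum (fun k => f (k%:R * msh j)) v (msh j) 0 (m * 2 ^ j)) @ \oo --> L m.
  move=> m0; under eq_fun do rewrite -RS_sum_dyadic//.
  exact: (cvg_comp _ (RS_sum f v m%:R) (pow2_cvg_oo m0) (@RS_sum_cvg f v m cf vm)).
have tail (g : nat -> R) j m n : (m <= n)%N ->
    (forall k, (m * 2 ^ j <= k)%N -> `|g k| <= G * expR (- (b * (k%:R * msh j)))) ->
    `|grid_sum g v (msh j) (m * 2 ^ j) (n * 2 ^ j)| <= t m.
  move=> mn gk.
  have H := @grid_sum_bound g v (msh j) (m * 2 ^ j) (n * 2 ^ j) (t m).
  apply: le_trans (H _ _ _) _.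
  - by rewrite leq_mul2r mn orbT.
  - by move=> k _; apply: vm; rewrite ?mulr_ge0 ?ler_wpM2r ?ler_nat// ltW ?msh_gt0.
  - move=> k /andP[k1 _]; apply: le_trans (gk k k1) _; rewrite ler_wpM2l// ler_expR lerN2 ler_pM2l//.
    by rewrite /msh ler_pdivlMr ?ltr0n ?expn_gt0// -natrM ler_nat.
  - rewrite ler_piMr ?mulr_ge0 ?expR_ge0// v1// mulr_ge0// ltW ?msh_gt0//.
have Ltail m n : (0 < m)%N -> (m <= n)%N -> `|L n - L m| <= t m.
  move=> m0 mn.
  have C : (fun j => `|grid_sum (fun k => f (k%:R * msh j)) v (msh j) 0 (n * 2 ^ j) -
      grid_sum (fun k => f (k%:R * msh j)) v (msh j) 0 (m * 2 ^ j)|) @ \oo --> `|L n - L m|.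
    by apply: cvg_norm; apply: cvgB; apply: LD => //; exact: leq_trans mn.
  apply: (cvg_le_cst C); apply: nearW => j.
  rewrite (@grid_sum_cat _ _ _ 0 (m * 2 ^ j) (n * 2 ^ j))// ?leq_mul2r ?mn ?orbT//.
  rewrite addrAC subrr add0r; apply: tail => // k _.
  by apply: fG; rewrite mulr_ge0// ltW ?msh_gt0.
have cL : cvgn L.
  apply/cauchy_cvgP/cauchy_exP => e e0.
  have /cvgrPdist_lt/(_ e e0)[m0 _ Hm] := t_cvg.
  exists (L m0.+1); exists m0.+1 => //= n mn; rewrite /ball/= distrC.
  apply: le_lt_trans (Ltail _ _ (ltn0Sn _) mn) _.
  have := Hm m0.+1 (leqnSn _); rewrite sub0r normrN; exact: le_lt_trans (ler_norm _).
have Llim m : (0 < m)%N -> `|stieltjes_int f v - L m| <= t m.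
  move=> m0.
  have C : (fun n => `|L n - L m|) @ \oo --> `|stieltjes_int f v - L m|.
    by apply: cvg_norm; apply: cvgB; [exact: cL|exact: cvg_cst].
  by apply: (cvg_le_cst C); exists m => // n /= mn; exact: Ltail.
apply/cvgrPdist_lt => e e0.
have e4 : 0 < e / 4 by rewrite divr_gt0.
have /cvgrPdist_lt/(_ _ e4)[m0 _ Hm] := t_cvg.
pose m := m0.+1.
have tm : t m < e / 4.
  have := Hm m (leqnSn _); rewrite sub0r normrN; exact: le_lt_trans (ler_norm _).
have [dl dl0 U] := unif_cont_segment m%:R cf e4.
have /cvgrPdist_lt/(_ _ e4)[j1 _ H1] := LD m (ltn0Sn _).
have /cvgrPdist_lt/(_ _ dl0)[j2 _ H2] := msh_cvg.
exists (maxn m (maxn j1 j2)) => // j /=; rewrite !geq_max => /andP[mj /andP[j1j j2j]].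
rewrite (@grid_sum_cat _ _ _ 0 (m * 2 ^ j) (j * 2 ^ j))// ?leq_mul2r ?mj ?orbT//.
set S1 := grid_sum _ _ _ 0 _; set S2 := grid_sum _ _ _ (m * 2 ^ j)%N _.
have hS2 : `|S2| <= t m.
  apply: tail => // k mk; apply: le_trans (fG _ _) _; first by rewrite mulr_ge0// ltW ?msh_gt0.
  by rewrite ler_wpM2l// ler_expR lerN2 ler_pM2l// ler_wpM2r ?ler_nat// ltW ?msh_gt0.
set S3 := grid_sum (fun k => f (k%:R * msh j)) v (msh j) 0 (m * 2 ^ j).
have h3 : `|L m - S3| < e / 4 by exact: H1.
have h13 : `|S1 - S3| <= e / 4.
  have -> : S1 - S3 = grid_sum (fun k => f (k.+1%:R * msh j) - f (k%:R * msh j)) v (msh j) 0 (m * 2 ^ j).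
    by rewrite /S1 /S3 /grid_sum -sumrB; apply: eq_bigr => k _; rewrite mulrBl.
  have H := @grid_sum_bound (fun k => f (k.+1%:R * msh j) - f (k%:R * msh j)) v (msh j) 0 (m * 2 ^ j) (e / 4).
  apply: le_trans (H _ _ _) _ => //.
  - by move=> k _; apply: vm; rewrite ?mulr_ge0 ?ler_wpM2r ?ler_nat// ltW ?msh_gt0.
  - move=> k /andP[_ km]; apply/ltW/U.
    + by rewrite mulr_ge0// ltW ?msh_gt0.
    + by rewrite /msh ler_pdivrMr ?ltr0n ?expn_gt0// -natrM ler_nat.
    + by rewrite mulr_ge0// ltW ?msh_gt0.
    + rewrite -mulrBl -natrB// subSnn mul1r ger0_norm ?(ltW (msh_gt0 j))//.
      by have := H2 j j2j; rewrite sub0r normrN; exact: le_lt_trans (ler_norm _).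
  - by rewrite ler_piMr ?(ltW e4)// v1// mulr_ge0// ltW ?msh_gt0.
have h4 := Llim m (ltn0Sn _).
(* Four errors of e / 4: horizon of the iterated limit, mesh on [0, m], right against left
   evaluation, and the tail. *)
have -> : stieltjes_int f v - (S1 + S2) = (stieltjes_int f v - L m) + (L m - S3) - (S1 - S3) - S2 by ring.
have a1 := ler_normB (stieltjes_int f v - L m + (L m - S3) - (S1 - S3)) S2.
have a2 := ler_normB (stieltjes_int f v - L m + (L m - S3)) (S1 - S3).
have a3 := ler_normD (stieltjes_int f v - L m) (L m - S3).
move: tm a1 a2 a3 h4 h3 h13 hS2; lra.
Qed.

End stieltjes.

(** * Riemann sums with cell-dependent integrands *)

Section step_integral.
Context {R : realType}.
Notation leb := (@lebesgue_measure R).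
Notation D := (`[0%R, +oo[%classic : set R).

Lemma expR_tail_integrable (b : R) : 0 < b ->
  leb.-integrable D (fun s => (expR (- (b * s)))%:E).
Proof.
move=> b0.
have m : measurable_fun D (fun s => (expR (- (b * s)))%:E).
  apply/measurable_EFinP; apply: measurableT_comp => //; apply: measurable_funN.
  exact: measurable_funM.
apply/integrableP; split => //.
apply: (@le_lt_trans _ _ ((b^-1)%:E * \int[leb]_s (exponential_pdf b s)%:E)%E); last first.
  by rewrite integral_exponential_pdf// mule1 ltry.
rewrite -ge0_integralZl//; last 3 first.
- by apply/measurable_EFinP; exact: measurable_exponential_pdf.
- by move=> s _; rewrite lee_fin; apply: exponential_pdf_ge0; exact: ltW.
- by rewrite lee_fin invr_ge0 ltW.
apply: (@le_trans _ _ (\int[leb]_(s in D) ((b^-1)%:E * (exponential_pdf b s)%:E))%E).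
  apply: ge0_le_integral => //.
  - exact: measurableT_comp.
  - apply: emeasurable_funM => //; apply/measurable_EFinP; apply: measurable_funTS.
    exact: measurable_exponential_pdf.
  - move=> s /=; rewrite in_itv/= andbT => s0.
    rewrite exponential_pdfE// lee_fin ger0_norm ?expR_ge0// mulrA mulVf ?gt_eqF// mul1r.
    by rewrite mulNr.
apply: ge0_subset_integral => //.
- by apply: emeasurable_funM => //; apply/measurable_EFinP; exact: measurable_exponential_pdf.
- move=> s _; rewrite mule_ge0// lee_fin ?invr_ge0 ?(ltW b0)//.
  by apply: exponential_pdf_ge0; exact: ltW.
Qed.

(** The sum is the integral of a step function whose value at s is the coefficient of the cell
    containing s; dominated convergence applies since this cell converges to s. *)
Lemma integral_grid_cvg (u : R -> R) (a : nat -> nat -> R) (C b : R) : 0 < b -> 0 <= C ->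
  (forall j k, `|a j k| <= C * expR (- (b * (k%:R * msh j)))) ->
  (forall s, 0 <= s -> (fun j => a j (Num.truncn (s / msh j))) @ \oo --> u s) ->
  (fun j => (\sum_(0 <= k < j * 2 ^ j) a j k * msh j)%:E) @ \oo -->
  (\int[leb]_(s in D) (u s)%:E)%E.
Proof.
move=> b0 C0 aC au.
pose I j k := `[k%:R * msh j, k.+1%:R * msh j[%classic : set R.
pose F j (s : R) : R := \sum_(0 <= k < j * 2 ^ j) a j k * \1_(I j k) s.
have inI j k s : I j k s <-> 0 <= s /\ k = Num.truncn (s / msh j :> R).
  rewrite /I /= in_itv/= -ler_pdivlMr ?msh_gt0// -ltr_pdivrMr ?msh_gt0//.
  split => [/andP[k1 k2]|[s0 ->]].
    have s0 : 0 <= s / msh j by exact: le_trans k1.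
    split; first by move: s0; rewrite pmulr_lge0// invr_gt0 msh_gt0.
    by apply/esym/truncn_def; rewrite k1 k2.
  by apply: truncn_itv; rewrite divr_ge0// ltW// msh_gt0.
have FE j s : 0 <= s -> F j s = if (Num.truncn (s / msh j) < j * 2 ^ j)%N then a j (Num.truncn (s / msh j)) else 0.
  move=> s0; set k0 := Num.truncn _.
  have one k : \1_(I j k) s = (k == k0)%:R :> R.
    rewrite indicE; suff -> : (s \in I j k) = (k == k0) by [].
    apply/idP/eqP; first by rewrite inE => /inI[].
    by move=> ->; rewrite inE; apply/inI.
  rewrite /F big_mkord; case: ltnP => hk.
    rewrite (bigD1 (Ordinal hk))//= one eqxx mulr1 big1 ?addr0// => i; rewrite one.
    by rewrite -val_eqE/= => /negbTE ->; rewrite mulr0.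
  rewrite big1// => i _; rewrite one; case: eqP => e; last by rewrite mulr0.
  by have := ltn_ord i; rewrite e ltnNge hk.
have mF j : measurable_fun setT (F j).
  apply: measurable_sum => k; apply: measurable_funM => //.
  by apply: measurable_indic; exact: measurable_itv.
have -> : (fun j => (\sum_(0 <= k < j * 2 ^ j) a j k * msh j)%:E) = (fun j => \int[leb]_(s in D) (F j s)%:E)%E.
  apply/funext => j; rewrite /F.
  have mI k : measurable (I j k : set (measurableTypeR R)) by exact: measurable_itv.
  have lI k : leb (I j k) = (msh j)%:E.
    rewrite lebesgue_measure_itv/= lte_fin ltr_pM2r ?msh_gt0// ltr_nat ltnSn.
    by rewrite -EFinB -mulrBl -natrB// subSnn mul1r.
  have II k : leb.-integrable D (EFin \o (fun s => a j k * \1_(I j k) s)).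
    apply: (@integrableS _ _ _ _ setT) => //.
    have -> : EFin \o (fun s => a j k * \1_(I j k) s) = (fun s => (a j k)%:E * (\1_(I j k) s)%:E)%E.
      by apply/funext => s.
    apply: integrableZl => //.
    apply/integrableP; split; first by apply/measurable_EFinP; exact: measurable_indic.
    under eq_integral do rewrite gee0_abs ?lee_fin//.
    by rewrite integral_indic// setIT; apply: le_lt_trans (ltry (msh j)); rewrite -(lI k).
  have -> : (fun s => (\sum_(0 <= k < j * 2 ^ j) a j k * \1_(I j k) s)%:E) =
     (fun s => \sum_(k <- index_iota 0 (j * 2 ^ j)) ((a j k * \1_(I j k) s)%:E : \bar R))%E.
    by apply/funext => s; rewrite sumEFin.
  rewrite (@integral_sum _ _ _ leb D _ nat (fun k s => (a j k * \1_(I j k) s)%:E))// -sumEFin.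
  apply: eq_bigr => k _.
  under eq_integral do rewrite EFinM.
  rewrite integralZl//; last first.
    apply: (@integrableS _ _ _ _ setT) => //.
    apply/integrableP; split; first by apply/measurable_EFinP; exact: measurable_indic.
    under eq_integral do rewrite gee0_abs ?lee_fin//.
    by rewrite integral_indic// setIT; apply: le_lt_trans (ltry (msh j)); rewrite -(lI k).
  rewrite integral_indic// EFinM; congr (_ * _)%E.
  rewrite (_ : I j k `&` _ = I j k); first exact/esym/lI.
  by apply/seteqP; split => s; [case|move=> Is; split=> //; have [s0 _] := (inI j k s).1 Is; rewrite /= in_itv/= s0].
have lim s : D s -> (fun j => (F j s)%:E) @ \oo --> (u s)%:E.
  rewrite /= in_itv/= andbT => s0; apply: EFin_cvg.
  apply: cvg_trans (au s s0); apply: near_eq_cvg.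
  exists (Num.truncn s).+1 => // j /= sj.
  rewrite FE// ifT//.
  have s1 : s < j%:R.
    have /andP[_ h] := truncn_itv s0; apply: lt_le_trans h _.
    by rewrite ler_nat.
  have d0 : 0 <= s / msh j by rewrite divr_ge0// ltW ?msh_gt0.
  have /andP[h _] := truncn_itv d0; rewrite -(ltr_nat R).
  apply: le_lt_trans h _; rewrite /msh invrK natrM ltr_pM2r// ltr0n expn_gt0//.
have mu_ : measurable_fun D (fun s => (u s)%:E).
  apply: (@emeasurable_fun_cvg _ _ _ D (fun j s => (F j s)%:E)) => // j.
  by apply/measurable_EFinP; apply: measurable_funTS; exact: mF.
apply: (@dominated_cvg _ _ _ leb D _ (fun j s => (F j s)%:E) _ (fun s => (C * expR b)%:E * (expR (- (b * s)))%:E)%E) => //.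
- by move=> j; apply/measurable_EFinP; apply: measurable_funTS; exact: mF.
- by apply: integrableZl => //; exact: expR_tail_integrable.
- move=> j s; rewrite /= in_itv/= andbT => s0; rewrite FE// -EFinM lee_fin.
  case: ifP => _; last by rewrite normr0 !mulr_ge0 ?expR_ge0.
  apply: le_trans (aC _ _) _; rewrite -mulrA -expRD ler_wpM2l// ler_expR.
  have d0 : 0 <= s / msh j by rewrite divr_ge0// ltW ?msh_gt0.
  have /andP[_ h] := truncn_itv d0.
  move: h; rewrite ltr_pdivrMr ?msh_gt0// -natr1 mulrDl mul1r => h.
  have h2 : s <= (Num.truncn (s / msh j))%:R * msh j + 1 by rewrite (le_trans (ltW h))// lerD2l msh_le1.
  by have := ler_wpM2l (ltW b0) h2; rewrite mulrDr mulr1; lra.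
Qed.
End step_integral.

(** * The discrete cost along one path *)

Section discrete_cost.
Context {R : realType}.
Variables (theta mu lam : R) (Phi : R -> R) (c : R).
Hypotheses (th0 : 0 < theta) (mu0 : 0 < mu) (lam0 : 0 < lam).
Hypothesis cPhi : continuous Phi.
Hypothesis Phi_ni : forall y z, y <= z -> Phi z <= Phi y.
Hypothesis Phi1 : Phi 1 = 0.
Hypothesis c0 : 0 <= c.

Let lt0 : 0 < lam + theta. Proof. exact: addr_gt0. Qed.

(** The integral over [0, h] of e^{-lam r} times the mean of the state at r started from y. Using it
    instead of the path within a cell makes the summation by parts exact. *)
Definition ou_weight (h y : R) :=
  (y - mu) * ((1 - expR (- ((lam + theta) * h))) / (lam + theta))
  + mu * ((1 - expR (- (lam * h))) / lam).

Definition disc (t : R) := expR (- (lam * t)).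

(** The running cost freezes the level at the left end, while fuel is priced at the right end: both
    levels then meet the same state, which gives a difference of [gain] at that state. *)
Definition dcost_term (y v : R -> R) (h : R) (k : nat) :=
  lam * Phi (c + v (k%:R * h)) * disc (k%:R * h) * ou_weight h (y (k%:R * h))
  + disc (k.+1%:R * h) * y (k.+1%:R * h) * (v (k.+1%:R * h) - v (k%:R * h)).

Definition dcost (y v : R -> R) (j : nat) :=
  \sum_(0 <= k < j * 2 ^ j) dcost_term y v (msh j) k.

Lemma expR_frac_itv (z h : R) : 0 < z -> 0 <= h ->
  0 <= (1 - expR (- (z * h))) / z <= h.
Proof.
move=> z0 h0; rewrite divr_ge0 ?(ltW z0)//=; last first.
  by rewrite subr_ge0 -[leRHS]expR0 ler_expR oppr_le0 mulr_ge0// ltW.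
rewrite ler_pdivrMr//; have := expR_ge1Dx (- (z * h)); lra.
Qed.

Lemma expR_frac_cvg (z : R) : 0 < z ->
  (fun j => (1 - expR (- (z * msh j))) / z / msh j) @ \oo --> (1 : R).
Proof.
move=> z0; apply/cvgrPdist_le => e e0.
have [_ /cvgrPdist_lt] := ((I, @msh_cvg R)).
have d0 : 0 < e / (z * expR z) by rewrite divr_gt0// mulr_gt0// expR_gt0.
move=> /(_ _ d0) [N _ HN]; exists N => // j Nj /=.
have m0 := @msh_gt0 R j; have m1 := @msh_le1 R j.
have := HN j Nj; rewrite sub0r normrN gtr0_norm// => hj.
have H := expR_taylor2_abs (- (z * msh j)).
have -> : 1 - (1 - expR (- (z * msh j))) / z / msh j =
    (expR (- (z * msh j)) - 1 - (- (z * msh j))) / (z * msh j).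
  by field; rewrite !gt_eqF.
have zm : 0 < z * msh j by rewrite mulr_gt0.
rewrite normrM normfV (gtr0_norm zm) ler_pdivrMr//.
apply: le_trans H _; rewrite normrN sqrrN (gtr0_norm zm).
have h1 : expR (z * msh j) <= expR z by rewrite ler_expR ler_piMr// ltW.
have h2 : msh j * (z * expR z) <= e by rewrite -ler_pdivlMr ?mulr_gt0 ?expR_gt0// ltW.
have -> (u w : R) : u ^+ 2 * w = (u * w) * u by ring.
rewrite ler_wpM2r ?(ltW zm)//; apply: le_trans h2.
have -> (u w r : R) : u * w * r = w * (u * r) by ring.
by rewrite ler_wpM2l ?(ltW m0)// ler_wpM2l// ltW.
Qed.

Lemma ou_weight_bound h y : 0 <= h -> `|ou_weight h y| <= h * (`|y| + 2 * mu).
Proof.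
move=> h0; have /andP[a1 a2] := expR_frac_itv lt0 h0; have /andP[b1 b2] := expR_frac_itv lam0 h0.
rewrite /ou_weight.
move: ((1 - expR (- ((lam + theta) * h))) / (lam + theta)) a1 a2 => u a1 a2.
move: ((1 - expR (- (lam * h))) / lam) b1 b2 => w b1 b2.
rewrite (le_trans (ler_normD _ _))// !normrM (ger0_norm a1) (ger0_norm b1) (gtr0_norm mu0).
have h1 : `|y - mu| <= `|y| + mu by rewrite (le_trans (ler_normB _ _))// [`|mu|]gtr0_norm.
have h2 := ler_pM (normr_ge0 _) a1 h1 a2.
have h3 := ler_wpM2l (ltW mu0) b2.
lra.
Qed.

Lemma grid_le (s : R) j : 0 <= s -> 0 <= s - (Num.truncn (s / msh j))%:R * msh j <= msh j.
Proof.
move=> s0; have m0 := @msh_gt0 R j.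
have d0 : 0 <= s / msh j by rewrite divr_ge0// ltW.
have /andP[] := truncn_itv d0; rewrite ler_pdivlMr// ltr_pdivrMr// -natr1 mulrDl mul1r.
by move=> h1 h2; rewrite subr_ge0 h1/= lerBlDl ltW.
Qed.

Lemma grid_near (s e : R) : 0 <= s -> 0 < e ->
  \forall j \near \oo, s - (Num.truncn (s / msh j))%:R * msh j < e.
Proof.
move=> s0 e0; have /cvgrPdist_lt/(_ e e0)[N _ HN] := @msh_cvg R.
exists N => // j Nj; have /andP[_ h] := grid_le j s0; apply: le_lt_trans h _.
by have := HN j Nj; rewrite sub0r normrN; exact: le_lt_trans (ler_norm _).
Qed.

Section path.
Variables (y v : R -> R) (G : R).
Hypothesis cy : {within `[0, +oo[, continuous y}.
Hypothesis yG : forall s, 0 <= s -> expR (- (lam * s / 2)) * `|y s| <= G.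
Hypothesis vm : forall s t, 0 <= s -> s <= t -> v s <= v t.
Hypothesis vl : forall t, 0 < t -> v @ t^'- --> v t.
Hypothesis v0 : v 0 = 0.
Hypothesis v1 : forall t, 0 <= t -> c + v t <= 1.

Let b := lam / 2.
Let b0 : 0 < b. Proof. exact: divr_gt0. Qed.
Let v_ge0 t : 0 <= t -> 0 <= v t. Proof. by move=> t0; rewrite -v0 vm. Qed.
Let q01 t : 0 <= t -> 0 <= c + v t <= 1.
Proof. by move=> t0; rewrite v1// andbT addr_ge0// v_ge0. Qed.
Let Phi01 t : 0 <= t -> 0 <= Phi (c + v t) <= Phi 0.
Proof.
by move=> t0; have /andP[h1 h2] := q01 t0; rewrite -{1}Phi1 !Phi_ni.
Qed.
Let G0 : 0 <= G.
Proof. by apply: le_trans (yG (lexx 0)); rewrite mulr_ge0 ?expR_ge0. Qed.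
Let Phi00 : 0 <= Phi 0. Proof. by rewrite -[leLHS]Phi1 Phi_ni. Qed.

Let kh0 j k : 0 <= k%:R * msh j :> R. Proof. by rewrite mulr_ge0// ltW ?msh_gt0. Qed.

Let fG (s : R) : 0 <= s -> `|disc s * y s| <= G * expR (- (b * s)).
Proof.
move=> s0; rewrite normrM ger0_norm ?expR_ge0//.
have -> : disc s = expR (- (b * s)) * expR (- (lam * s / 2)).
  by rewrite -expRD /disc /b; congr expR; field.
by rewrite -[leLHS]mulrA [leRHS]mulrC ler_wpM2l ?expR_ge0// yG.
Qed.

Let a j k := lam * Phi (c + v (k%:R * msh j)) * disc (k%:R * msh j) *
   (ou_weight (msh j) (y (k%:R * msh j)) / msh j).

Let aC j k : `|a j k| <= lam * Phi 0 * (G + 2 * mu) * expR (- (b * (k%:R * msh j))).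
Proof.
have m0 := @msh_gt0 R j; have /andP[p0 p1] := Phi01 (kh0 j k).
rewrite /a !normrM (gtr0_norm lam0) (ger0_norm p0) -[leLHS]mulrA -[leRHS]mulrA.
apply: ler_pM; [by rewrite mulr_ge0// ltW|by rewrite mulr_ge0|by rewrite ler_pM2l|].
rewrite -normrM.
have h1 : `|ou_weight (msh j) (y (k%:R * msh j)) / msh j| <= `|y (k%:R * msh j)| + 2 * mu.
  rewrite normrM normfV (gtr0_norm m0) ler_pdivrMr// [leRHS]mulrC; exact: ou_weight_bound (ltW m0).
apply: le_trans (ler_wpM2l (normr_ge0 _) h1) _.
rewrite mulrDr [leRHS]mulrDl; apply: lerD; first by rewrite -normrM fG.
rewrite ger0_norm ?expR_ge0// mulrC ler_wpM2l ?mulr_ge0 ?(ltW mu0)//.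
by rewrite /disc ler_expR lerN2 ler_wpM2r// /b ler_pdivrMr// ler_pMr// ler1n.
Qed.

Let a_cvg (s : R) : 0 <= s -> (fun j => a j (Num.truncn (s / msh j))) @ \oo -->
  expR (- (lam * s)) * lam * y s * Phi (c + v s).
Proof.
move=> s0; pose sj j : R := (Num.truncn (s / msh j))%:R * msh j.
have sj0 j : 0 <= sj j by exact: kh0.
have csj : sj @ \oo --> s.
  apply/cvgrPdist_lt => e e0; apply: filterS (grid_near s0 e0) => j h.
  by have /andP[h1 _] := grid_le j s0; rewrite ger0_norm.
have cys : y (sj j) @[j --> \oo] --> y s.
  apply/cvgrPdist_lt => e e0; have [dl dl0 H] := within_itvcyP_eps cy s0 e0.
  apply: filterS (grid_near s0 dl0) => j h; rewrite distrC; apply: H => //.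
  by have /andP[h1 _] := grid_le j s0; rewrite distrC ger0_norm.
(* Grid points approach s from below, so left-continuity of the control suffices; s = 0 and the case
   where s is a grid point are separate, as a left limit excludes its base point. *)
have cvs : v (sj j) @[j --> \oo] --> v s.
  apply/cvgrPdist_lt => e e0.
  have [se|sn0] := eqVneq s 0.
    apply: nearW => j; rewrite /sj se mul0r truncn0 mul0r subrr normr0//.
  have sp : 0 < s by rewrite lt_neqAle eq_sym sn0.
  have /cvgrPdist_lt/(_ e e0) := vl sp; rewrite /at_left /within/= => -[dl dl0 H].
  apply: filterS (grid_near s0 dl0) => j h.
  have /andP[h1 _] := grid_le j s0.
  have [->|ne] := eqVneq (sj j) s; first by rewrite subrr normr0.
  apply: H; first by rewrite /ball/= ger0_norm.
  by rewrite lt_neqAle ne -subr_ge0.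
have cPs : Phi (c + v (sj j)) @[j --> \oo] --> Phi (c + v s).
  by apply: continuous_cvg; [exact: cPhi|apply: cvgD => //; exact: cvg_cst].
have cds : disc (sj j) @[j --> \oo] --> expR (- (lam * s)).
  by apply: expR_cvg; apply: cvgN; apply: cvgM => //; exact: cvg_cst.
have cw : (fun j => ou_weight (msh j) (y (sj j)) / msh j) @ \oo --> y s.
  have -> : (fun j => ou_weight (msh j) (y (sj j)) / msh j) = (fun j =>
     (y (sj j) - mu) * ((1 - expR (- ((lam + theta) * msh j))) / (lam + theta) / msh j)
     + mu * ((1 - expR (- (lam * msh j))) / lam / msh j)).
    by apply/funext => j; rewrite /ou_weight mulrDl !mulrA.
  rewrite -[X in _ --> X](_ : (y s - mu) * 1 + mu * 1 = _); last by rewrite !mulr1 subrK.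
  apply: cvgD; apply: cvgM; [|exact: expR_frac_cvg|exact: cvg_cst|exact: expR_frac_cvg].
  by apply: cvgB => //; exact: cvg_cst.
rewrite (_ : _ * Phi _ = lam * Phi (c + v s) * expR (- (lam * s)) * y s); last by ring.
by apply: cvgM cw; apply: cvgM cds; apply: cvgM cPs; exact: cvg_cst.
Qed.

Let dcostE j : dcost y v j = \sum_(0 <= k < j * 2 ^ j) a j k * msh j +
  grid_sum (fun k => disc (k.+1%:R * msh j) * y (k.+1%:R * msh j)) v (msh j) 0 (j * 2 ^ j).
Proof.
rewrite /dcost /grid_sum -big_split/=; apply: eq_bigr => k _; rewrite /dcost_term /a.
by congr (_ + _); rewrite -[RHS]mulrA divfK// gt_eqF// msh_gt0.
Qed.

Lemma dcost_cvg : (fun j => (dcost y v j)%:E) @ \oo -->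
  (\int[lebesgue_measure]_(s in `[0%R, +oo[)
          (expR (- (lam * s)) * lam * y s * Phi (c + v s))%:E
   + (stieltjes_int (fun s => expR (- (lam * s)) * y s)%R v)%:E)%E.
Proof.
under eq_fun do rewrite dcostE EFinD.
apply: cvgeD => //; first exact: fin_num_adde_defl.
  have C0 : 0 <= lam * Phi 0 * (G + 2 * mu).
    by rewrite !mulr_ge0 ?(ltW lam0)// addr_ge0// mulr_ge0// ltW.
  exact: (integral_grid_cvg b0 C0 aC a_cvg).
apply: EFin_cvg; apply: (@stieltjes_cvg _ (fun s => disc s * y s) v G b) => //.
- move=> t; apply: continuousM; last exact: cy.
  apply: (@continuous_subspaceT _ _ _ disc) => s.
  rewrite /disc; apply: continuous_comp; last exact: continuous_expR.
  by apply: continuousN; apply: continuousM => //; exact: cst_continuous.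
- move=> s t s0 t0; have /andP[a1 a2] := q01 s0; have := v_ge0 t0.
  by move: c0 a2; lra.
Qed.

(** A bound linear in the envelope with a constant independent of path and mesh, as dominated
    convergence over the probability space requires; 1 <= G absorbs the additive constants. *)
Lemma dcost_bound j : 1 <= G ->
  `|dcost y v j| <= (lam * Phi 0 * (1 + 2 * mu) * (expR b / b) + 1) * G.
Proof.
move=> G1; rewrite dcostE (le_trans (ler_normD _ _))// mulrDl mul1r; apply: lerD.
  have m0 := @msh_gt0 R j; have m1 := @msh_le1 R j.
  apply: le_trans (ler_norm_sum _ _ _) _.
  pose C := lam * Phi 0 * (1 + 2 * mu) * G.
  have C0 : 0 <= C by rewrite !mulr_ge0 ?(ltW lam0)// addr_ge0// mulr_ge0// ltW.
  (* The geometric sum is made telescoping: h e^{-b t_k} <= (e^b / b) (e^{-b t_k} - e^{-b t_(k+1)}),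
     uniformly for h <= 1. *)
  apply: (@le_trans _ _ (\sum_(0 <= k < j * 2 ^ j) C * (expR b / b) *
     (expR (- (b * (k%:R * msh j))) - expR (- (b * (k.+1%:R * msh j)))))).
    rewrite !big_nat; apply: ler_sum => k _.
    rewrite normrM (gtr0_norm m0).
    have h1 : lam * Phi 0 * (G + 2 * mu) <= C.
      rewrite /C -[leRHS]mulrA; apply: ler_wpM2l; first by rewrite mulr_ge0// ltW.
      rewrite [leRHS]mulrDl mul1r lerD2l.
      by rewrite ler_peMr// mulr_ge0// ltW.
    apply: le_trans (ler_wpM2r (ltW m0) (aC j k)) _.
    apply: (@le_trans _ _ (C * (expR (- (b * (k%:R * msh j))) * msh j))).
      by rewrite [leRHS]mulrA ler_wpM2r ?(ltW m0)// ler_wpM2r ?expR_ge0.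
    rewrite -[leRHS]mulrA ler_wpM2l//.
    have -> : expR (- (b * (k.+1%:R * msh j))) = expR (- (b * (k%:R * msh j))) * expR (- (b * msh j)).
      by rewrite -expRD; congr expR; rewrite -natr1; ring.
    have e1 := expR_ge1Dx (b * msh j).
    have e2 : expR (b * msh j) <= expR b by rewrite ler_expR ler_piMr// ltW.
    have e3 : expR (b * msh j) * expR (- (b * msh j)) = 1 by rewrite -expRD subrr expR0.
    have -> (u w : R) : expR b / b * (u - u * w) = u * (expR b * (1 - w) / b).
      by field; rewrite gt_eqF.
    rewrite ler_wpM2l ?expR_ge0// ler_pdivlMr//.
    have w1 : 0 <= 1 - expR (- (b * msh j)).
      by rewrite subr_ge0 -[leRHS]expR0 ler_expR oppr_le0 mulr_ge0// ltW.
    have := ler_wpM2r w1 e2; rewrite mulrBr e3; lra.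
  rewrite -mulr_sumr; apply: (@le_trans _ _ (C * (expR b / b) * 1)); last first.
    by rewrite mulr1 /C le_eqVlt; apply/orP; left; apply/eqP; ring.
  apply: ler_wpM2l; first by apply: mulr_ge0 => //; apply: divr_ge0; [exact: expR_ge0|exact: ltW].
  rewrite -[X in X <= _]opprK -sumrN.
  under eq_bigr do rewrite opprB.
  rewrite (telescope_sumr (fun k => expR (- (b * (k%:R * msh j)))))// opprB mul0r mulr0 oppr0 expR0.
  by rewrite lerBlDr lerDl expR_ge0.
have h := @grid_sum_bound _ (fun k => disc (k.+1%:R * msh j) * y (k.+1%:R * msh j)) v (msh j) 0 (j * 2 ^ j) G.
apply: le_trans (h _ _ _) _ => //.
- by move=> k _; apply: vm => //; rewrite ler_wpM2r ?ler_nat// ltW ?msh_gt0.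
- move=> k _; apply: le_trans (fG (kh0 _ _)) _; rewrite ler_piMr// -[leRHS]expR0 ler_expR oppr_le0.
  by rewrite mulr_ge0// ltW.
- rewrite mul0r v0 subr0 ler_piMr//.
  have /andP[_ a2] := q01 (kh0 j (j * 2 ^ j)); move: c0 a2; lra.
Qed.
End path.

(** The resolvent integrates over all times; cut at h, it is the cell contribution plus the
    discounted resolvent at the mean. *)
Lemma ou_weightE h y : ou_weight h y =
  ou_resolvent theta mu lam y - disc h * ou_resolvent theta mu lam (ou_mean theta mu h y).
Proof.
rewrite /ou_weight /ou_resolvent /ou_mean /disc.
have -> : expR (- ((lam + theta) * h)) = expR (- (lam * h)) * expR (- (theta * h)).
  by rewrite -expRD; congr expR; ring.
by move: (expR _) (expR _) => u w; field; rewrite !gt_eqF.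
Qed.

(** Summation by parts holds along each path. The last sum carries the one-step noise and disappears
    only in expectation, because its coefficient Phi(q_k) is known at t_k. *)
Lemma dcost_partialE y v h n (q := fun k => c + v (k%:R * h)) (Y := fun k => y (k%:R * h)) 
    (d := fun k => disc (k%:R * h)) :
  \sum_(0 <= k < n) dcost_term y v h k =
  lam * Phi (q 0%N) * ou_resolvent theta mu lam (Y 0%N)
  - lam * Phi (q n) * d n * ou_resolvent theta mu lam (Y n)
  + \sum_(0 <= k < n) d k.+1 * (gain theta mu lam Phi (q k) (Y k.+1) - gain theta mu lam Phi (q k.+1) (Y k.+1))
  + \sum_(0 <= k < n) lam * Phi (q k) * d k.+1 / (lam + theta) * (Y k.+1 - ou_mean theta mu h (Y k)).
Proof.
elim: n => [|n IH].
  by rewrite !big_geq// /d mul0r /disc mulr0 oppr0 expR0; ring.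
rewrite big_nat_recr//= IH !big_nat_recr//=.
have dS : d n.+1 = d n * disc h by rewrite /d /disc -expRD -natr1; congr expR; ring.
have -> : dcost_term y v h n = lam * Phi (q n) * d n * ou_weight h (Y n) + d n.+1 * Y n.+1 * (q n.+1 - q n).
  by rewrite /dcost_term /q /d /Y; congr (_ + _ * _); ring.
rewrite ou_weightE /gain dS.
have E : ou_resolvent theta mu lam (Y n.+1) - ou_resolvent theta mu lam (ou_mean theta mu h (Y n)) =
   (Y n.+1 - ou_mean theta mu h (Y n)) / (lam + theta).
  by rewrite /ou_resolvent; field; rewrite !gt_eqF.
have -> : lam * Phi (q n) * (d n * disc h) / (lam + theta) * (Y n.+1 - ou_mean theta mu h (Y n)) =
   lam * Phi (q n) * (d n * disc h) * ((Y n.+1 - ou_mean theta mu h (Y n)) / (lam + theta)).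
  by field; rewrite gt_eqF.
by rewrite -E; ring.
Qed.

End discrete_cost.

Lemma cvg_minl {R : realType} {I : Type} {F : set_system I} {FF : Filter F} (f : I -> R) (l k : R) :
  f @ F --> l -> Num.min (f i) k @[i --> F] --> Num.min l k.
Proof.
have H (a b : R) : `|Num.min a k - Num.min b k| <= `|a - b|.
  wlog ab : a b / a <= b.
    by move=> H; case: (leP a b) => [/H//|/ltW/H]; rewrite distrC [X in _ <= X]distrC.
  rewrite distrC ger0_norm; last by rewrite subr_ge0 le_min !ge_min ab lexx orbT.
  rewrite distrC [leRHS]ger0_norm ?subr_ge0//; have [ak|ka] := leP a k.
    by rewrite lerB// ge_min lexx.
  by rewrite [Num.min b k]min_r ?subrr ?subr_ge0// (le_trans (ltW ka)).
move=> /cvgrPdist_lt fl; apply/cvgrPdist_lt => e e0; apply: filterS (fl e e0) => i.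
exact: le_lt_trans.
Qed.

(** * Expected cost of a control *)

Section expectation.
Context {R : realType} {d : measure_display} {T : measurableType d}.
Variable P : probability T R.
Local Notation Int f := (P.-integrable setT (EFin \o f)).
Local Notation Ex f := (Rintegral P setT f).

Lemma Rintegral_sum_nat (f : nat -> T -> R) n : (forall k, Int (f k)) ->
  Int (fun w => \sum_(0 <= k < n) f k w) /\
  Ex (fun w => \sum_(0 <= k < n) f k w) = \sum_(0 <= k < n) Ex (f k).
Proof.
move=> fi; elim: n => [|n [IH1 IH2]].
  rewrite big_geq//; have -> : (fun w => \sum_(0 <= k < 0) f k w) = cst 0.
    by apply/funext => w; rewrite big_geq.
  by rewrite Rintegral_cst// mul0r; split => //; exact: integrable0.
have -> : (fun w => \sum_(0 <= k < n.+1) f k w) = (fun w => \sum_(0 <= k < n) f k w + f n w).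
  by apply/funext => w; rewrite big_nat_recr.
split; first exact: (integrableD measurableT IH1 (fi n)).
by rewrite big_nat_recr//= -IH2 RintegralD.
Qed.

Lemma EFin_Rintegral (f : T -> R) : Int f -> (\int[P]_w (f w)%:E = (Ex f)%:E)%E.
Proof. by move=> fi; rewrite fineK//; exact: (integrable_fin_num _ fi). Qed.

Lemma Rintegral_const (k : R) : Ex (fun=> k) = k.
Proof.
have PT : P setT = 1%E by exact: probability_setT.
by rewrite Rintegral_cst// [X in fine X]PT mulr1.
Qed.

Lemma integrable_bounded_cst (k : R) : Int (fun=> k).
Proof.
apply/integrableP; split; first exact/measurable_EFinP/measurable_cst.
rewrite integral_cst//.
have PT : P setT = 1%E by exact: probability_setT.
by rewrite [X in (_ * X)%E]PT mule1 ltry.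
Qed.
End expectation.

Section expected_cost.
Context {R : realType} {d : measure_display} {T : measurableType d}.
Variables (P : probability T R) (B : R -> T -> R).
Hypothesis cP : measure_is_complete P.
Hypothesis hB : standard_BM P B.
Variables (theta sigma mu x : R) (Y : R -> T -> R).
Hypotheses (th0 : 0 < theta) (sg0 : 0 < sigma) (mu0 : 0 < mu).
Hypothesis cY : forall w, {within `[0, +oo[, continuous (fun t => Y t w)}.
Hypothesis sdeY : forall w t, 0 <= t ->
  Y t w = x + Rintegral lebesgue_measure `[0, t] (fun s => theta * (mu - Y s w)) + sigma * B t w.
Variables (lam : R) (Phi : R -> R).
Hypothesis lam0 : 0 < lam.
Hypothesis dPhi : forall y : R, derivable Phi y 1.
Hypothesis Phi_ni : forall y z, y <= z -> Phi z <= Phi y.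
Hypothesis Phi_cvx : forall y z s, y != z -> 0 < s -> s < 1 ->
  Phi (s * y + (1 - s) * z) < s * Phi y + (1 - s) * Phi z.
Hypothesis Phi1 : Phi 1 = 0.
Hypothesis k_lt0 : forall c, 0 <= c -> c <= 1 -> kfun theta lam Phi c < 0.

Let cPhi : continuous Phi.
Proof. by move=> y; apply: differentiable_continuous; apply/derivable1_diffP; exact: dPhi. Qed.
Let mPhi : measurable_fun setT Phi.
Proof. exact: continuous_measurable_fun. Qed.
Let lt0 : 0 < lam + theta. Proof. exact: addr_gt0. Qed.
Let mY t : 0 <= t -> measurable_fun setT (Y t).
Proof. exact: (Y_meas cP hB th0 cY sdeY). Qed.
Let G := ou_sup theta sigma mu Y lam.
Let GI : P.-integrable setT G.
Proof. exact: (ou_sup_integrable cP hB th0 cY sdeY lam0). Qed.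
Let G1 w : (1 <= G w)%E. Proof. exact: ou_sup_ge1. Qed.
Let A := ou_resolvent theta mu lam.
Let g := gain theta mu lam Phi.
Let S := saving theta sigma mu lam Phi.

(** The fuel constraint holds on every path instead of almost every one; truncating an admissible
    control at 1 - c achieves this without changing its cost. *)
Definition strict_control c (nu : R -> T -> R) : Prop :=
  [/\ (forall w s t, 0 <= s -> s <= t -> nu s w <= nu t w),
      (forall w t, 0 < t -> (fun s => nu s w) @ t^'- --> nu t w),
      (forall t, 0 <= t -> meas_wrt (past_gen P B t) (nu t)),
      (forall w, nu 0 w = 0) &
      (forall w t, 0 <= t -> c + nu t w <= 1)].

Definition path_cost c (nu : R -> T -> R) w : \bar R :=
  (\int[lebesgue_measure]_(s in `[0%R, +oo[)
          (expR (- (lam * s)) * lam * Y s w * Phi (c + nu s w))%:E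
   + (stieltjes_int (fun s => expR (- (lam * s)) * Y s w)%R (fun s => nu s w))%:E)%E.

Lemma admissible_trunc c nu : c <= 1 -> admissible P B c nu ->
  strict_control c (fun t w => Num.min (nu t w) (1 - c)).
Proof.
move=> c1 [nm nl na n0 [nz _]]; split.
- by move=> w s t s0 st; rewrite le_min !ge_min nm// lexx orbT.
- by move=> w t t0; exact: cvg_minl (nl w t t0).
- move=> t t0; have ma : meas_wrt (past_gen P B t) (nu t) by apply/meas_wrtE => E mE; exact: na.
  by apply: (@measurable_minr _ (g_sigma_algebraType (past_gen P B t))) => //; exact: measurable_cst.
- by move=> w; rewrite nz min_l// subr_ge0.
- by move=> w t t0; rewrite -lerBrDl ge_min lexx orbT.
Qed.

Section strict.
Variables (c : R) (nu : R -> T -> R).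
Hypotheses (c0 : 0 <= c) (hnu : strict_control c nu).

Lemma strict_measurable t : 0 <= t -> measurable_fun setT (nu t).
Proof.
case: hnu => _ _ na _ _ t0.
exact: (meas_wrt_measurable (past_gen_measurable cP hB (s:=t)) (na t t0)).
Qed.

Lemma strict_ge0 w t : 0 <= t -> 0 <= nu t w.
Proof. by case: hnu => nm _ _ n0 _ t0; rewrite -(n0 w); exact: nm. Qed.

Lemma strict_itv w t : 0 <= t -> 0 <= c + nu t w <= 1.
Proof. by move=> t0; rewrite addr_ge0 ?strict_ge0//=; case: hnu => _ _ _ _; apply. Qed.

Definition ecost j w := dcost theta mu lam Phi c (fun t => Y t w) (fun t => nu t w) j.

Lemma ou_resolvent_measurable : measurable_fun setT A.
Proof. by apply: measurable_funD => //; apply: measurable_funM => //; exact: measurable_funB. Qed.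

Lemma ecost_measurable j : measurable_fun setT (ecost j).
Proof.
have m0 := @msh_gt0 R j.
apply: measurable_sum => k.
have k0 n : 0 <= n%:R * msh j :> R by rewrite mulr_ge0// ltW.
have mn n := strict_measurable (k0 n).
apply: measurable_funD.
  apply: measurable_funM.
    apply: measurable_funM => //; apply: measurable_funM => //.
    have mc : measurable_fun setT (fun w => c + nu (k%:R * msh j) w) by exact: measurable_funD.
    exact: (measurableT_comp mPhi mc).
  apply: measurable_funD => //; apply: measurable_funM => //.
  by apply: measurable_funB => //; exact: mY.
apply: measurable_funM; first by apply: measurable_funM => //; exact: mY.
by apply: measurable_funB; exact: mn.
Qed.

(** Wherever the envelope is finite the discrete costs converge along the path and are bounded by a
    constant times the envelope, which is integrable. *)
Lemma path_cost_cvg :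
  measurable_fun setT (path_cost c nu) /\
  (\int[P]_w (ecost j w)%:E)%E @[j --> \oo] --> (\int[P]_w path_cost c nu w)%E.
Proof.
have [nm nl na n0 n1] := hnu.
pose C := lam * Phi 0 * (1 + 2 * mu) * (expR (lam / 2) / (lam / 2)) + 1.
have aeG : {ae P, forall w, setT w -> G w \is a fin_num} by exact: (integrable_ae measurableT GI).
have good w : G w \is a fin_num ->
    ((ecost j w)%:E @[j --> \oo] --> path_cost c nu w) /\
    forall j, (`|(ecost j w)%:E| <= C%:E * G w)%E.
  move=> Gf; have Gw1 : 1 <= fine (G w) by rewrite -lee_fin fineK.
  have yG s : 0 <= s -> expR (- (lam * s / 2)) * `|Y s w| <= fine (G w).
    by move=> s0; rewrite -lee_fin fineK//; exact: ou_sup_ub.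
  split.
    exact: (@dcost_cvg _ theta mu lam Phi c th0 mu0 lam0 cPhi Phi_ni Phi1 c0 (Y ^~ w) (nu ^~ w) (fine (G w)) (@cY w) yG (nm w) (nl w) (n0 w) (n1 w)).
  move=> j; rewrite -(fineK Gf) -EFinM lee_fin.
  exact: (@dcost_bound _ theta mu lam Phi c th0 mu0 lam0 Phi_ni Phi1 c0 (Y ^~ w) (nu ^~ w) (fine (G w)) yG (nm w) (n0 w) (n1 w) j Gw1).
have me j : measurable_fun setT (fun w => (ecost j w)%:E).
  by apply/measurable_EFinP; exact: ecost_measurable.
have mp : measurable_fun setT (path_cost c nu).
  (* [path_cost] contains iterated limits; it is measurable because it agrees almost everywhere with
     the limsup of measurable discrete costs and P is complete. *)
  apply: (ae_measurable_fun cP _ (measurable_fun_limn_esup me)).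
  apply: filterS aeG => w /(_ I) /good[cv _] _.
  rewrite is_cvg_limn_esupE; last by apply/cvg_ex; exists (path_cost c nu w).
  exact: cvg_lim.
split => //.
have := @dominated_convergence _ _ _ P setT measurableT (fun j w => (ecost j w)%:E) (path_cost c nu) (fun w => C%:E * G w)%E me mp.
case.
- by apply: filterS aeG => w /(_ I) /good[cv _] _.
- by apply: integrableZl.
- by apply: filterS aeG => w /(_ I) /good[_ cv] j _.
- by move=> _ _; exact.
Qed.

End strict.

Local Notation Int f := (P.-integrable setT (EFin \o f)).
Local Notation Ex f := (Rintegral P setT f).

Lemma Y_le_sup t w : 0 <= t -> (`|Y t w|%:E <= (expR (lam * t / 2))%:E * G w)%E.
Proof.
move=> t0; have e0 : (0 <= (expR (lam * t / 2))%:E)%E by rewrite lee_fin expR_ge0.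
have := lee_wpmul2l e0 (@ou_sup_ub _ _ _ theta sigma mu Y th0 cY lam lam0 w t t0); rewrite -EFinM mulrA -expRD subrr expR0 mul1r.
exact.
Qed.

Lemma integrable_lin (f : T -> R) C t : 0 <= t -> 0 <= C -> measurable_fun setT f ->
  (forall w, `|f w| <= C * (1 + `|Y t w|)) -> Int f.
Proof.
move=> t0 C0 mf fb.
have I1 := integrableZl measurableT (C * (1 + expR (lam * t / 2))) GI.
apply: le_integrable I1 => //; first exact/measurable_EFinP.
move=> w _ /=; rewrite [leRHS]gee0_abs; last first.
  by rewrite mule_ge0 ?lee_fin ?mulr_ge0 ?addr_ge0 ?expR_ge0// (le_trans _ (G1 w)).
apply: (@le_trans _ _ (C%:E * (1%:E + `|Y t w|%:E))%E).
  by rewrite -EFinD -EFinM lee_fin fb.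
rewrite EFinM -muleA lee_wpmul2l ?lee_fin// EFinD.
rewrite ge0_muleDl ?lee_fin ?expR_ge0// mul1e leeD// ?G1//.
exact: Y_le_sup.
Qed.

Lemma gain_growth : exists2 C, 0 <= C & forall q y, 0 <= q -> q <= 1 -> `|g q y| <= C * (1 + `|y|).
Proof.
have Phi0 : 0 <= Phi 0 by rewrite -[leLHS]Phi1 Phi_ni.
have L0 : 0 <= 1 + lam * Phi 0 / (lam + theta).
  by apply: addr_ge0 => //; apply: divr_ge0; [apply: mulr_ge0 => //|]; exact: ltW.
have A0 : 0 <= lam * Phi 0 * `|A 0| by rewrite !mulr_ge0// ltW.
exists (lam * Phi 0 * `|A 0| + (1 + lam * Phi 0 / (lam + theta))); first exact: addr_ge0.
move=> q y q0 q1; have := gain_lip mu th0 lam0 Phi_ni Phi1 y 0 q0 q1.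
rewrite subr0 => h.
have h0 : `|g q 0| <= lam * Phi 0 * `|A 0|.
  rewrite /g /gain mul0r sub0r normrN normrM [`|lam * _|]ger0_norm.
    by rewrite ler_wpM2r// ler_pM2l// Phi_ni.
  by rewrite mulr_ge0 ?(ltW lam0)// -[leLHS]Phi1 Phi_ni.
have -> : g q y = g q 0 + (g q y - g q 0) by rewrite addrC subrK.
apply: le_trans (ler_normD _ _) _; apply: le_trans (lerD h0 h) _.
have -> (u v z : R) : (u + v) * (1 + z) = u + v * z + (v + u * z) by ring.
by rewrite lerDl; apply: addr_ge0 => //; exact: mulr_ge0.
Qed.

Lemma resolvent_growth : exists2 C, 0 <= C & forall y, `|A y| <= C * (1 + `|y|).
Proof.
have il : 0 <= (lam + theta)^-1 by rewrite invr_ge0 ltW.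
exists ((lam + theta)^-1 + `|A 0|); first exact: addr_ge0.
move=> y; have -> : A y = y / (lam + theta) + A 0.
  by rewrite /A /ou_resolvent; field; rewrite !gt_eqF.
apply: le_trans (ler_normD _ _) _; rewrite normrM [`|_^-1|]ger0_norm//.
have a0 := normr_ge0 (A 0); have y0 := normr_ge0 y.
have := mulr_ge0 a0 y0; move: il a0; move: (_^-1) `|A 0| `|y| => u v w; nra.
Qed.

(** Half of the discount exponent makes |Y_t| bounded by the envelope, uniformly in t; the other
    half remains as decay. *)
Lemma terminal_bound : exists K0, forall t (Q : T -> R), 0 <= t -> measurable_fun setT Q ->
  (forall w, 0 <= Q w <= 1) ->
  Int (fun w => lam * Phi (Q w) * disc lam t * A (Y t w)) /\
  `|Ex (fun w => lam * Phi (Q w) * disc lam t * A (Y t w))| <= K0 * expR (- (lam * t / 2)).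
Proof.
have [CA CA0 hA] := resolvent_growth.
have Phi0 : 0 <= Phi 0 by rewrite -[leLHS]Phi1 Phi_ni.
pose K1 := lam * Phi 0 * (CA * 2).
have K10 : 0 <= K1 by rewrite !mulr_ge0// ltW.
exists (K1 * fine (\int[P]_w G w)%E) => t Q t0 mQ Q01.
set f := fun w => _.
have mf : measurable_fun setT f.
  apply: measurable_funM; last exact: (measurableT_comp ou_resolvent_measurable (mY t0)).
  by apply: measurable_funM => //; apply: measurable_funM => //; exact: (measurableT_comp mPhi mQ).
have fb w : `|f w| <= lam * Phi 0 * (disc lam t * (CA * (1 + `|Y t w|))).
  have /andP[q0 q1] := Q01 w.
  have p0 : 0 <= Phi (Q w) by rewrite -[leLHS]Phi1 Phi_ni.
  rewrite /f !normrM (gtr0_norm lam0) (ger0_norm p0) [`|disc lam t|]ger0_norm ?expR_ge0//.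
  rewrite -[leLHS]mulrA; apply: ler_pM => //; [by rewrite mulr_ge0// ltW|by rewrite mulr_ge0 ?expR_ge0|by rewrite ler_pM2l// Phi_ni|].
  by rewrite ler_wpM2l ?expR_ge0.
have fG w : (`|(f w)%:E| <= (K1 * expR (- (lam * t / 2)))%:E * G w)%E.
  have Gub := @ou_sup_ub _ _ _ theta sigma mu Y th0 cY lam lam0 w t t0.
  have e1 : expR (- (lam * t / 2)) <= 1.
    by rewrite -[leRHS]expR0 ler_expR oppr_le0 divr_ge0// mulr_ge0// ltW.
  have dE : disc lam t = expR (- (lam * t / 2)) * expR (- (lam * t / 2)).
    by rewrite -expRD /disc; congr expR; field.
  apply: (@le_trans _ _ ((lam * Phi 0 * CA * expR (- (lam * t / 2)))%:E * (1%:E + (expR (- (lam * t / 2)) * `|Y t w|)%:E))%E).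
    rewrite -EFinD -EFinM lee_fin (le_trans (fb w))// dE.
    have -> (u v z y' : R) : u * (v * v * (z * (1 + y'))) = u * z * v * (v + v * y') by ring.
    by rewrite ler_wpM2l ?lerD2r// !mulr_ge0 ?expR_ge0// ltW.
  have -> : (K1 * expR (- (lam * t / 2)))%:E = ((lam * Phi 0 * CA * expR (- (lam * t / 2)))%:E * 2%:E)%E.
    by rewrite -EFinM; congr EFin; rewrite /K1; ring.
  rewrite -muleA; apply: lee_wpmul2l; first by rewrite lee_fin !mulr_ge0 ?expR_ge0// ltW.
  have -> : (2%:E * G w = G w + G w)%E by rewrite mule_natl mule2n.
  by rewrite leeD// G1.
have I1 := integrableZl measurableT (K1 * expR (- (lam * t / 2))) GI.
have fI : Int f.
  apply: le_integrable I1 => //; first exact/measurable_EFinP.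
  move=> w _ /=; rewrite [leRHS]gee0_abs; first exact: fG.
  exact: le_trans (abse_ge0 _) (fG w).
split => //.
apply: le_trans (le_normr_Rintegral measurableT fI) _.
rewrite -lee_fin -EFin_Rintegral; last exact: (integrable_norm fI).
apply: (@le_trans _ _ (\int[P]_w ((K1 * expR (- (lam * t / 2)))%:E * G w))%E).
  apply: ge0_le_integral => //.
  - by apply/measurable_EFinP; exact: measurableT_comp.
  - by case/integrableP: I1.
  - by move=> w _; have := fG w.
rewrite integralZl// -[X in (_ <= X)%E](_ : ((K1 * expR (- (lam * t / 2)))%:E * (fine (\int[P]_w G w))%:E)%E = _).
  by rewrite fineK//; exact: integrable_fin_num.
by rewrite -EFinM; congr EFin; ring.
Qed.

(** Freezing is stated for nonnegative functions while the noise is signed, so its positive and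
    negative parts are treated separately; centering makes their means equal. *)
Lemma noise_orthogonal s h (Z : T -> R) M : 0 <= s -> 0 < h ->
  meas_wrt (past_gen P B s) Z -> (forall w, 0 <= Z w <= M) ->
  Int (fun w => Z w * ou_noise theta mu Y s h w) /\
  Ex (fun w => Z w * ou_noise theta mu Y s h w) = 0.
Proof.
move=> s0 h0 mZp Z01; set xi := ou_noise theta mu Y s h.
have mZ : measurable_fun setT Z := meas_wrt_measurable (past_gen_measurable cP hB (s:=s)) mZp.
have mx : measurable_fun setT xi := xi_mfun hB th0 cY sdeY s0 h0.
have ix : Int xi := ou_noise_integrable cP hB th0 cY sdeY s0 h0.
have M0 (w : T) : 0 <= M by have /andP[a b] := Z01 w; exact: le_trans b.
have Ib (u : T -> R) : measurable_fun setT u -> (forall w, `|u w| <= `|xi w|) ->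
    Int u /\ Int (fun w => Z w * u w).
  move=> mu' hu; split.
    apply: le_integrable ix => //; first exact/measurable_EFinP.
    by move=> w _ /=; rewrite lee_fin.
  have I1 := integrableZl measurableT M ix.
  apply: le_integrable I1 => //; first by apply/measurable_EFinP; exact: measurable_funM.
  move=> w _ /=; rewrite lee_fin !normrM (ger0_norm (M0 w)); have /andP[z0 z1] := Z01 w.
  by rewrite ger0_norm//; exact: ler_pM.
pose up (r : R) := Num.max 0 r.
have mup : measurable_fun setT up by exact: measurable_maxr.
have up0 r : 0 <= up r by rewrite /up le_max lexx.
have upb r : `|up r| <= `|r|.
  by rewrite ger0_norm// /up ge_max normr_ge0 ler_norm.
have mxp : measurable_fun setT (fun w => up (xi w)) by exact: (measurableT_comp mup mx).
have mxn : measurable_fun setT (fun w => up (- xi w)).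
  have mN : measurable_fun setT (fun w => - xi w) by exact: measurable_funN.
  exact: (measurableT_comp mup mN).
have [Ip Izp] := Ib _ mxp (fun w => upb _).
have [In' Izn] := Ib _ mxn (fun w => ltac:(by rewrite -[leRHS]normrN; exact: upb)).
have split_ r : r = up r - up (- r).
  rewrite /up; case: (leP 0 r) => h1; first by rewrite max_l ?subr0// oppr_le0.
  by rewrite max_r ?oppr_ge0 ?(ltW h1)// sub0r opprK.
(* The parameter sg is the identity or the opposite, so one computation serves both parts. *)
have frz (sg : R -> R) : measurable_fun setT sg ->
   (\int[P]_w (Z w * up (sg (xi w)))%:E = \int[P]_w (Z w)%:E * \int[P]_w (up (sg (xi w)))%:E)%E.
  move=> msg.
  have mus : measurable_fun setT (fun u => up (sg u)) by exact: (measurableT_comp mup msg).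
  have mf : measurable_fun setT (fun z : R * R => (up z.1 * up (sg z.2))%:E).
    apply/measurable_EFinP; apply: measurable_funM; first exact: (measurableT_comp mup measurable_fst).
    exact: (measurableT_comp mus measurable_snd).
  have := @ou_freeze _ _ _ P B cP hB theta sigma mu x Y th0 cY sdeY s h _ _ Z (fun z : R * R => (up z.1 * up (sg z.2))%:E) s0 h0 mZp mf.
  move=> /(_ (fun z => ltac:(by rewrite lee_fin mulr_ge0)))/=.
  have upZ w : up (Z w) = Z w by have /andP[z0 _] := Z01 w; rewrite /up max_r.
  under eq_integral => w _ do rewrite upZ.
  move=> ->; rewrite -ge0_integralZr//; last 3 first.
  - by apply/measurable_EFinP.
  - by move=> w _; have /andP[z0 _] := Z01 w; rewrite lee_fin.
  - by apply: integral_ge0 => w _; rewrite lee_fin.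
  apply: eq_integral => w _; have /andP[z0 _] := Z01 w.
  under eq_integral => v _ do rewrite upZ EFinM.
  rewrite ge0_integralZl//.
  - by apply/measurable_EFinP; exact: (measurableT_comp mus mx).
  - by move=> v _; rewrite lee_fin.
have Ix : Ex xi = 0.
  by rewrite /Rintegral (ou_noise_mean cP hB th0 cY sdeY s0 h0).
have Epn : Ex (fun w => up (xi w)) = Ex (fun w => up (- xi w)).
  apply/eqP; rewrite -subr_eq0 -RintegralB//; rewrite -[X in _ == X]Ix; apply/eqP.
  by apply: eq_Rintegral => w _; rewrite -split_.
split; first by have [_] := Ib xi mx (fun w => lexx _).
rewrite (_ : (fun w => Z w * xi w) = (fun w => Z w * up (xi w) - Z w * up (- xi w))); last first.
  by apply/funext => w; rewrite -mulrBr -split_.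
rewrite RintegralB//; apply/eqP; rewrite subr_eq0; apply/eqP.
rewrite /Rintegral (frz id (@measurable_id _ _ _)) (frz -%R (measurable_funN (@measurable_id _ _ _))).
by congr (fine (_ * _)%E); rewrite (EFin_Rintegral Ip) (EFin_Rintegral In') Epn.
Qed.

Section strict_expectation.
Variables (c : R) (nu : R -> T -> R).
Hypotheses (c0 : 0 <= c) (hnu : strict_control c nu).
Variable j : nat.
Let h := @msh R j.
Let h0 : 0 < h. Proof. exact: msh_gt0. Qed.
Let t k : R := k%:R * h.
Let t0 k : 0 <= t k. Proof. by rewrite mulr_ge0// ltW. Qed.
Let tS k : t k.+1 = t k + h. Proof. by rewrite /t -natr1 mulrDl mul1r. Qed.
Let q k w := c + nu (t k) w.
Let q01 k w : 0 <= q k w <= 1. Proof. exact: (strict_itv c0 hnu). Qed.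
Let mq k : measurable_fun setT (q k).
Proof. by apply: measurable_funD => //; exact: (strict_measurable hnu). Qed.
Let mqp k : meas_wrt (past_gen P B (t k)) (q k).
Proof.
case: hnu => _ _ na _ _.
by apply: (@measurable_funD _ (g_sigma_algebraType (past_gen P B (t k)))); [exact: measurable_cst|exact: na].
Qed.

Lemma gain_integrable i k : Int (fun w => g (q i w) (Y (t k) w)).
Proof.
have [C C0 hC] := gain_growth; apply: (integrable_lin (t0 k) C0); last first.
  by move=> w; have /andP[a b] := q01 i w; exact: hC.
have mYk := mY (t0 k).
apply: measurable_funB; first by apply: measurable_funM => //; exact: measurable_funB.
apply: measurable_funM; first by apply: measurable_funM => //; exact: (measurableT_comp mPhi (mq i)).
exact: (measurableT_comp ou_resolvent_measurable mYk).
Qed.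

Lemma ecostE :
  Int (ecost c nu j) /\
  Ex (ecost c nu j) = lam * Phi c * A x
    - Ex (fun w => lam * Phi (q (j * 2 ^ j)%N w) * disc lam (t (j * 2 ^ j)%N) * A (Y (t (j * 2 ^ j)%N) w))
    + \sum_(0 <= k < j * 2 ^ j) disc lam (t k.+1) *
        Ex (fun w => g (q k w) (Y (t k.+1) w) - g (q k.+1 w) (Y (t k.+1) w)).
Proof.
set n := (j * 2 ^ j)%N.
have [K0 HK] := terminal_bound; have [I1 _] := HK (t n) (q n) (t0 n) (mq n) (q01 n).
set f1 := fun w => lam * Phi (q n w) * _ * _ in I1 *.
pose f2 k w := disc lam (t k.+1) * (g (q k w) (Y (t k.+1) w) - g (q k.+1 w) (Y (t k.+1) w)).
pose f3 k w := lam * disc lam (t k.+1) / (lam + theta) * (Phi (q k w) * ou_noise theta mu Y (t k) h w).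
have ID k : Int (fun w => g (q k w) (Y (t k.+1) w) - g (q k.+1 w) (Y (t k.+1) w)).
  exact: (integrableB measurableT (gain_integrable k k.+1) (gain_integrable k.+1 k.+1)).
have I2 k : Int (f2 k) by exact: (integrableZl measurableT (disc lam (t k.+1)) (ID k)).
have N k : Int (fun w => Phi (q k w) * ou_noise theta mu Y (t k) h w) /\
    Ex (fun w => Phi (q k w) * ou_noise theta mu Y (t k) h w) = 0.
  apply: (@noise_orthogonal (t k) h (fun w => Phi (q k w)) (Phi 0)) => //.
    apply: (@measurableT_comp _ _ _ (g_sigma_algebraType (past_gen P B (t k))) _ _ Phi) => //.
    exact: mqp.
  by move=> w; have /andP[a b] := q01 k w; rewrite -{1}Phi1 !Phi_ni.
have I3 k : Int (f3 k).
  by have [Nk _] := N k; exact: (integrableZl measurableT (lam * disc lam (t k.+1) / (lam + theta)) Nk).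
have [S2 E2] := Rintegral_sum_nat n I2; have [S3 E3] := Rintegral_sum_nat n I3.
have Ic : Int (fun=> lam * Phi c * A x) := integrable_bounded_cst P _.
have F : ecost c nu j = (fun w => ((lam * Phi c * A x - f1 w) + \sum_(0 <= k < n) f2 k w) + \sum_(0 <= k < n) f3 k w).
  apply/funext => w; rewrite /ecost /dcost (dcost_partialE mu Phi c th0 lam0 (Y ^~ w) (nu ^~ w) (msh j) (j * 2 ^ j)) -/n -/h.
  congr (_ + _ + _).
  - congr (_ - _); rewrite mul0r (Y0E hB sdeY).
    by case: hnu => _ _ _ -> _; rewrite addr0.
  - apply: eq_bigr => k _; rewrite /f3 /ou_noise -/(t k) -/(t k.+1) -tS -/(q k w) /ou_mean.
    by field; rewrite gt_eqF.
have I1' : Int (fun w => lam * Phi c * A x - f1 w) := integrableB measurableT Ic I1.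
have I12 : Int (fun w => lam * Phi c * A x - f1 w + \sum_(0 <= k < n) f2 k w) := integrableD measurableT I1' S2.
have Iall : Int (fun w => lam * Phi c * A x - f1 w + \sum_(0 <= k < n) f2 k w + \sum_(0 <= k < n) f3 k w) := integrableD measurableT I12 S3.
rewrite F; split => //.
rewrite (RintegralD measurableT I12 S3) (RintegralD measurableT I1' S2) (RintegralB measurableT Ic I1).
rewrite Rintegral_const E2 E3 [X in _ + X = _]big1 ?addr0; last first.
  by move=> k _; rewrite /f3 RintegralZl//; [have [_ ->] := N k; rewrite mulr0|have [] := N k].
by congr (_ + _); apply: eq_bigr => k _; rewrite /f2 RintegralZl.
Qed.

Lemma saving_integrable i k : Int (fun w => S (q i w) (Y (t k) w)).
Proof.
have [C C0 hC] := saving_growth th0 sg0 mu0 lam0 dPhi Phi_ni Phi_cvx Phi1 k_lt0.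
apply: (integrable_lin (t0 k) C0); last first.
  move=> w; have /andP[a b] := q01 i w.
  by rewrite ger0_norm ?hC//; exact: saving_ge0.
have mS := saving_measurable th0 sg0 mu0 lam0 dPhi Phi_ni Phi_cvx Phi1 k_lt0.
have mp : measurable_fun setT (fun w => (q i w, Y (t k) w)).
  by apply/measurable_fun_pairP; split; [exact: mq|exact: mY].
have := measurableT_comp mS mp; apply: eq_measurable_fun => w _ /=.
by have /andP[a b] := q01 i w; rewrite clip01_id.
Qed.

(** The level q_k is known at t_k, so it acts as companion in the Markov step and stays frozen while
    the supermartingale inequality moves the state. *)
Lemma saving_step k :
  disc lam h * Ex (fun w => S (q k w) (Y (t k.+1) w)) <= Ex (fun w => S (q k w) (Y (t k) w)).
Proof.
have mS := saving_measurable th0 sg0 mu0 lam0 dPhi Phi_ni Phi_cvx Phi1 k_lt0.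
have S0 r y : 0 <= r -> r <= 1 -> 0 <= S r y by move=> *; exact: saving_ge0.
have c01 (r : R) : 0 <= clip01 r /\ clip01 r <= 1 by have /andP[] := clip01_itv r.
have qE w : clip01 (q k w) = q k w by have /andP[a b] := q01 k w; exact: clip01_id.
have Ik := saving_integrable k k; have IS := saving_integrable k k.+1.
rewrite /disc -[leLHS]mulrC -ler_pdivlMr ?expR_gt0// -expRN opprK mulrC.
rewrite -lee_fin EFinM -!EFin_Rintegral//.
rewrite -integralZl//.
have := @ou_step_le _ _ _ P B cP hB theta sigma mu x Y th0 cY sdeY (t k) h _ _ (q k)
  (fun z : R * R => (S (clip01 z.1) z.2)%:E) (fun w => (expR (lam * h))%:E * (S (q k w) (Y (t k) w))%:E)%E
  (t0 k) h0 (@mqp k).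
move=> /(_ _ _ _ _)/=; rewrite -tS.
under eq_integral => w _ do rewrite qE.
apply.
- by apply/measurable_EFinP.
- by move=> z; have [a b] := c01 z.1; rewrite lee_fin S0.
- by case/integrableP: (integrableZl measurableT (expR (lam * h)) Ik).
move=> w; rewrite -EFinM; have /andP[a b] := q01 k w.
under eq_integral => u _ do rewrite qE.
apply: saving_kernel => //.
- exact: (xi_mfun hB th0 cY sdeY).
- by move=> b'; exact: (ou_noise_mgf cP hB th0 cY sdeY).
Qed.

Lemma ecost_ge : c <= 1 ->
  lam * Phi c * A x - S c x
    - Ex (fun w => lam * Phi (q (j * 2 ^ j)%N w) * disc lam (t (j * 2 ^ j)%N) * A (Y (t (j * 2 ^ j)%N) w))
  <= Ex (ecost c nu j).
Proof.
move=> c1; have [_ ->] := ecostE; set n := (j * 2 ^ j)%N.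
(* [a] is the discounted expected saving. Monotonicity of gain + saving exchanges the level at fixed
   state, then [saving_step] moves the state at fixed level; so each summand is at least a (k+1) - a
   k, and a n >= 0. *)
pose a k := disc lam (t k) * Ex (fun w => S (q k w) (Y (t k) w)).
have a0 : a 0%N = S c x.
  rewrite /a /t mul0r /disc mulr0 oppr0 expR0 mul1r -[RHS](Rintegral_const P).
  apply: eq_Rintegral => w _; rewrite /q /t mul0r (Y0E hB sdeY).
  by case: hnu => _ _ _ -> _; rewrite addr0.
have an : 0 <= a n.
  rewrite mulr_ge0 ?expR_ge0//; apply: Rintegral_ge0 => w _.
  by have /andP[b b'] := q01 n w; exact: saving_ge0.
rewrite [leLHS]addrAC lerD2l.
apply: (@le_trans _ _ (a n - a 0%N)); first by rewrite a0; lra.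
rewrite -(telescope_sumr a)//; apply: ler_sum => k _.
have I1 := saving_integrable k k.+1; have I2 := saving_integrable k.+1 k.+1.
have h1 : Ex (fun w => S (q k.+1 w) (Y (t k.+1) w)) - Ex (fun w => S (q k w) (Y (t k.+1) w)) <=
   Ex (fun w => g (q k w) (Y (t k.+1) w) - g (q k.+1 w) (Y (t k.+1) w)).
  rewrite -RintegralB//; apply: le_Rintegral => //.
  - exact: (integrableB measurableT I2 I1).
  - exact: (integrableB measurableT (gain_integrable k k.+1) (gain_integrable k.+1 k.+1)).
  move=> w _; have /andP[b b'] := q01 k w; have /andP[e e'] := q01 k.+1 w.
  have qq : q k w <= q k.+1 w.
    by rewrite lerD2l; case: hnu => nm _ _ _ _; apply: nm => //; rewrite tS lerDl ltW.
  have := gain_saving_ni th0 sg0 mu0 lam0 dPhi Phi_cvx Phi1 k_lt0 (Y (t k.+1) w) b qq e'.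
  by rewrite -/S -/g; lra.
have h2 := ler_wpM2l (expR_ge0 (- (lam * t k.+1))) h1.
apply: le_trans h2; rewrite /a mulrBr lerB//.
have dS : disc lam (t k.+1) = disc lam (t k) * disc lam h.
  by rewrite /disc -expRD tS; congr expR; ring.
by rewrite -/(disc lam (t k.+1)) dS -mulrA ler_wpM2l ?expR_ge0// saving_step.
Qed.

End strict_expectation.

Lemma path_cost_trunc c nu : 0 <= c -> c <= 1 -> admissible P B c nu ->
  (\int[P]_w path_cost c nu w =
   \int[P]_w path_cost c (fun t w => Num.min (nu t w) (1 - c))%R w)%E.
Proof.
move=> c0 c1 anu; have [mp _] := path_cost_cvg c0 (admissible_trunc c1 anu).
have [nm nl na n0 [nz nae]] := anu.
have E : ae_eq P setT (path_cost c (fun t w => Num.min (nu t w) (1 - c))) (path_cost c nu).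
  apply: filterS nae => w nw _.
  have e s : 0 <= s -> Num.min (nu s w) (1 - c) = nu s w.
    by move=> s0; rewrite min_l// lerBrDl nw.
  congr (_ + _%:E)%E.
    by apply: eq_integral => s; rewrite inE/= in_itv/= andbT => s0; rewrite e.
  rewrite /stieltjes_int; congr (limn _); apply/funext => m; congr (limn _).
  apply/funext => n; rewrite /RS_sum; apply: eq_bigr => k _.
  by rewrite !e ?mulr_ge0 ?invr_ge0.
apply/esym/ae_eq_integral => //.
exact: (ae_measurable_fun cP E).
Qed.

End expected_cost.

(** * The candidate control *)

Section overshoot.
Context {R : realType}.
Variables (theta sigma mu lam : R).
Hypotheses (th0 : 0 < theta) (sg0 : 0 < sigma) (lam0 : 0 < lam).
Let psi := psi_lam theta sigma mu lam.

(* On [xi > 1/2] the indicator is dominated by an exponential of rate [1 / (2 v)], whose tilt makes the tail [O(h^2)]. *)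
Lemma psi_overshoot (g : R) : exists2 h1, 0 < h1 & exists2 C, 0 <= C &
  forall d (T : measurableType d) (P : probability T R) (xi : T -> R) (h y : R),
  0 < h -> h <= h1 -> y <= g -> measurable_fun setT xi ->
  (forall b, \int[P]_w (expR (b * xi w))%:E = (expR (b ^+ 2 * ou_var theta sigma h / 2))%:E)%E ->
  (\int[P]_w (psi (ou_mean theta mu h y + xi w) * (g + 1 < ou_mean theta mu h y + xi w)%R%:R)%:E
    <= (C * h ^+ 2)%:E)%E.
Proof.
have th2 : 0 < 2 * theta * (1 + `|mu - g|) by rewrite !mulr_gt0// ltr_wpDr.
exists (Num.min 1 (2 * theta * (1 + `|mu - g|))^-1); first by rewrite lt_min ltr01 invr_gt0.
exists (128 * sigma ^+ 4 * (expR lam * psi (g + 1))).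
  by apply: mulr_ge0; [rewrite mulr_ge0// exprn_ge0// ltW|rewrite mulr_ge0 ?expR_ge0// ltW// psi_gt0].
move=> d T P xi h y h0; rewrite le_min => /andP[h1 h2] yg mxi mgf.
have tail z : 0 < z -> z <= sigma ^+ 2 * h -> expR (- (8 * z)^-1) <= 128 * sigma ^+ 4 * h ^+ 2.
  move=> v0 vh; have z0 : 0 <= (8 * z)^-1 by rewrite invr_ge0 mulr_ge0// ltW.
  have := expR_ge1Dxn 1 z0; rewrite (_ : 2`!%:R = 2)// => h3.
  have h4 : (8 * z)^-1 ^+ 2 / 2 <= expR (8 * z)^-1 by rewrite (le_trans _ h3)// lerDr.
  rewrite expRN; apply: (@le_trans _ _ (128 * z ^+ 2)).
    rewrite -[leRHS]invrK lef_pV2 ?posrE ?expR_gt0 ?invr_gt0 ?mulr_gt0 ?exprn_gt0//.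
    by apply: le_trans h4; rewrite le_eqVlt; apply/orP; left; apply/eqP; field; rewrite gt_eqF.
  have -> : 128 * sigma ^+ 4 * h ^+ 2 = 128 * (sigma ^+ 2 * h) ^+ 2 by ring.
  by rewrite ler_pM2l// ler_pXn2r// ?nnegrE ?(ltW v0)// mulr_ge0 ?sqr_ge0// ltW.
set v := ou_var theta sigma h in mgf *; set r := expR (- (theta * h)).
have r0 : 0 < r by exact: expR_gt0.
have hth : theta * h * (1 + `|mu - g|) <= 2^-1.
  by have := ler_wpM2r (ltW th2) h2; rewrite mulVf ?gt_eqF//; lra.
have ab0 := normr_ge0 (mu - g).
have thh : 0 < theta * h by rewrite mulr_gt0.
have hth1 : theta * h <= 2^-1 by apply: le_trans hth; rewrite ler_peMr ?(ltW thh)// lerDl.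
have r12 : 2^-1 <= r by rewrite /r; have := expR_ge1Dx (- (theta * h)); lra.
have r1 : r < 1 by rewrite expR_lt1 oppr_lt0.
have v0 : 0 < v.
  rewrite /v /ou_var divr_gt0 ?mulr_gt0// ?exprn_gt0// subr_gt0 -/r exprn_ilt1//; exact: ltW.
have vh : v <= sigma ^+ 2 * h by apply: ou_var_le => //; exact: ltW.
have mg : ou_mean theta mu h g <= g + 2^-1.
  rewrite /ou_mean -/r.
  have -> : mu + (g - mu) * r = g + (mu - g) * (1 - r) by ring.
  rewrite lerD2l; apply: le_trans (ler_wpM2r _ (ler_norm _)) _; first by rewrite subr_ge0 ltW.
  have e1 : 1 - r <= theta * h by have := expR_ge1Dx (- (theta * h)); rewrite -/r; lra.
  apply: le_trans (ler_wpM2l ab0 e1) _; apply: le_trans hth.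
  by rewrite mulrC ler_wpM2l ?(ltW thh)// lerDr.
have my : ou_mean theta mu h y <= ou_mean theta mu h g.
  by rewrite /ou_mean lerD2l ler_wpM2r ?(ltW r0)// lerD2r.
pose b := (2 * v)^-1.
have b0 : 0 < b by rewrite invr_gt0 mulr_gt0.
have mm z : measurable_fun setT (fun w => ou_mean theta mu h z + xi w) by exact: measurable_funD.
have mpsi := psi_measurable mu th0 sg0 lam0.
have mpz z : measurable_fun setT (fun w => psi (ou_mean theta mu h z + xi w)) by exact: (measurableT_comp mpsi (mm z)).
apply: (@le_trans _ _ (\int[P]_w ((expR (- (b / 2)))%:E * (expR (b * xi w) * psi (ou_mean theta mu h g + xi w))%:E))%E).
  apply: ge0_le_integral => //.
  - by move=> w _; rewrite lee_fin mulr_ge0// ltW// psi_gt0.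
  - apply/measurable_EFinP; apply: measurable_funM => //.
    have mi : measurable_fun setT (\1_(`]g + 1, +oo[%classic : set R) : R -> R) by exact: measurable_indic.
    have := measurableT_comp mi (mm y); apply: eq_measurable_fun => w _ /=.
    rewrite indicE.
    have -> // : (ou_mean theta mu h y + xi w \in (`]g + 1, +oo[%classic : set R)) = (g + 1 < ou_mean theta mu h y + xi w).
    by apply/idP/idP; rewrite inE/= in_itv/= andbT.
  - apply: emeasurable_funM => //; apply/measurable_EFinP; apply: measurable_funM => //.
    by apply: measurableT_comp => //; exact: measurable_funM.
  move=> w _; rewrite -EFinM lee_fin mulrA -expRD [leRHS]mulrC.
  apply: ler_pM => //; [by rewrite ltW// psi_gt0|by apply: psi_le => //; rewrite lerD2r|].
  case: ltP => /= hw; last by rewrite expR_ge0.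
  rewrite -[leLHS]expR0 ler_expR; have xw : 2^-1 < xi w by move: mg my hw; lra.
  have := ler_wpM2l (ltW b0) (ltW xw); lra.
rewrite ge0_integralZl//; last 2 first.
- apply/measurable_EFinP; apply: measurable_funM => //.
  by apply: measurableT_comp => //; exact: measurable_funM.
- by move=> w _; rewrite lee_fin mulr_ge0 ?expR_ge0// ltW// psi_gt0.
rewrite (psi_tilt mu th0 sg0 lam0 b g mxi mgf) -/v -/r -EFinM lee_fin [leLHS]mulrA -[expR (- (b / 2)) * expR _]expRD.
have -> : - (b / 2) + b ^+ 2 * v / 2 = - (8 * v)^-1 by rewrite /b; field; rewrite gt_eqF.
have -> : b * v = 2^-1 by rewrite /b; field; rewrite gt_eqF.
have p1 : psi (g + 2^-1 / r) <= psi (g + 1).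
  by apply: psi_le => //; rewrite lerD2l ler_pdivrMr// mul1r.
have e1 : expR (lam * h) <= expR lam by rewrite ler_expR ler_piMr// ltW.
have e2 := tail v v0 vh.
apply: (@le_trans _ _ ((128 * sigma ^+ 4 * h ^+ 2) * (expR lam * psi (g + 1)))); last first.
  by rewrite le_eqVlt; apply/orP; left; apply/eqP; ring.
have P0 z : 0 <= psi z by apply: ltW; exact: psi_gt0.
apply: ler_pM e2 _; [exact: expR_ge0|by rewrite mulr_ge0 ?expR_ge0|].
by apply: ler_pM e1 p1; rewrite ?expR_ge0.
Qed.
End overshoot.

(** * The hitting time read on grids *)

Section hitting.
Context {R : realType} {d : measure_display} {T : measurableType d}.
Variables (P : probability T R) (B : R -> T -> R).
Hypothesis cP : measure_is_complete P.
Hypothesis hB : standard_BM P B.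
Variables (theta sigma mu x : R) (X : R -> R -> T -> R).
Let Y := X x.
Hypothesis th0 : 0 < theta.
Hypothesis cY : forall w, {within `[0, +oo[, continuous (fun t => Y t w)}.
Hypothesis sdeY : forall w t, 0 <= t ->
  Y t w = x + Rintegral lebesgue_measure `[0, t] (fun s => theta * (mu - Y s w)) + sigma * B t w.
Variable g : R.

(** The inequality being non-strict, the event concerns only times before t: this makes the control
    left-continuous and adapted to the augmented filtration itself. *)
Definition unhit t w := (t%:E <= tau_star X x g w)%E.

Lemma unhitP t w : unhit t w <-> forall s, 0 <= s -> s < t -> Y s w < g.
Proof.
rewrite /unhit /tau_star; split => [h s s0 st|h].
  rewrite ltNge; apply/negP => gs.
  suff : (t%:E <= s%:E)%E by rewrite lee_fin leNgt st.
  by apply: le_trans h _; apply: ereal_inf_lbound; exists s.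
apply: le_ereal_inf_tmp => _ [s [s0 gs] <-]; rewrite lee_fin leNgt; apply/negP => st.
by have := h s s0 st; rewrite ltNge gs.
Qed.

Lemma unhit_le s t w : s <= t -> unhit t w -> unhit s w.
Proof. by move=> st; apply: le_trans; rewrite lee_fin. Qed.

Lemma unhit0 w : unhit 0 w.
Proof. by apply/unhitP => s s0; rewrite ltNge s0. Qed.

Lemma past_gen_le s t : s <= t -> past_gen P B s `<=` past_gen P B t.
Proof.
move=> st E [[r [A [r0 rs mA ->]]]|nE]; last by right.
by left; exists r, A; split => //; exact: le_trans st.
Qed.

(* By continuity and compactness, [Y < g] on [0, t) is a countable condition on dyadic times. *)
Lemma unhit_adapted t : 0 <= t -> <<s past_gen P B t >> [set w | unhit t w].
Proof.
move=> t0.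
pose E n m j k : set T := if k%:R * msh j <= t - n.+1%:R^-1
  then Y (k%:R * msh j) @^-1` [set y | y <= g - m.+1%:R^-1] else setT.
have -> : [set w | unhit t w] = \bigcap_n \bigcup_m \bigcap_j \bigcap_k E n m j k.
  apply/seteqP; split => w /=.
    move=> /unhitP h n _; set tn := t - n.+1%:R^-1.
    have tnt : tn < t by rewrite ltrBlDr ltrDl invr_gt0.
    have [tn0|tn0] := leP 0 tn; last first.
      exists 0%N => // j _ k _; rewrite /E -/tn ifF//; apply/negbTE; rewrite -ltNge.
      by apply: lt_le_trans tn0 _; rewrite mulr_ge0// ltW ?msh_gt0.
    have cYn : {within `[0, tn], continuous (fun s => Y s w)}.
      apply: continuous_subspaceW (@cY w) => s /=; rewrite !in_itv/= => /andP[-> _]//.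
    have [s] := EVT_max tn0 cYn; rewrite in_itv/= => /andP[s0 st] smax.
    have Ys : Y s w < g by apply: h => //; exact: le_lt_trans tnt.
    have [m hm] := ltr_add_invr Ys; exists m => // j _ k _; rewrite /E -/tn.
    case: ifP => // kt /=; rewrite lerBrDr ltW// (le_lt_trans _ hm)// lerD2r.
    by apply: smax; rewrite in_itv/= kt andbT mulr_ge0// ltW ?msh_gt0.
  move=> h; apply/unhitP => s s0 st.
  have [n hn] := ltr_add_invr st; have [m _ hm] := h n I.
  suff : Y s w <= g - m.+1%:R^-1 by move/le_lt_trans; apply; rewrite ltrBlDr ltrDl invr_gt0.
  rewrite leNgt; apply/negP => gY.
  have e0 : 0 < Y s w - (g - m.+1%:R^-1) by rewrite subr_gt0.
  have [dl dl0 H] := within_itvcyP_eps (@cY w) s0 e0.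
  have [j _ Hj] := grid_near s0 dl0.
  have {Hj} := Hj j (leqnn j) => sj; have /andP[sj0 _] := grid_le j s0.
  set k := Num.truncn (s / msh j) in sj sj0.
  have := hm j I k I; rewrite /E ifT; last first.
    by rewrite lerBrDr ltW// (le_lt_trans _ hn)// lerD2r -subr_ge0.
  move=> /= hY.
  have := H (k%:R * msh j); rewrite distrC ger0_norm// => /(_ _ sj).
  have k0 : 0 <= k%:R * msh j :> R by rewrite mulr_ge0// ltW ?msh_gt0.
  move=> /(_ k0).
  rewrite distrC => h1; have h2 := ler_norm (Y s w - Y (k%:R * msh j) w).
  by move: (le_lt_trans h2 h1); rewrite ltrD2l ltrN2 ltNge hY.
have mE n m j k : @measurable _ (g_sigma_algebraType (past_gen P B t)) (E n m j k).
  rewrite /E; case: ifP => // kt.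
  have k0 : 0 <= k%:R * msh j :> R by rewrite mulr_ge0// ltW ?msh_gt0.
  have := ou_adapted hB th0 cY sdeY k0.
  have kt' : k%:R * msh j <= t by rewrite (le_trans kt)// gerBl invr_ge0.
  move=> /(meas_wrt_sub (subset_trans (past_gen_le kt') (@sub_sigma_algebra _ _ _))).
  move=> /meas_wrtE; apply.
  have -> : [set y | y <= g - m.+1%:R^-1] = `]-oo, g - m.+1%:R^-1]%classic by apply/seteqP; split => y /=; rewrite in_itv.
  exact: measurable_itv.
apply: (@bigcapT_measurable _ (g_sigma_algebraType (past_gen P B t))) => n.
apply: (@bigcupT_measurable _ (g_sigma_algebraType (past_gen P B t))) => m.
apply: (@bigcapT_measurable _ (g_sigma_algebraType (past_gen P B t))) => j.
by apply: (@bigcapT_measurable _ (g_sigma_algebraType (past_gen P B t))) => k.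
Qed.

Lemma unhit_meas (a b t : R) : 0 <= t ->
  meas_wrt (past_gen P B t) (fun w => if unhit t w then a else b).
Proof.
move=> t0; have mU : @measurable _ (g_sigma_algebraType (past_gen P B t)) [set w | unhit t w] := unhit_adapted t0.
apply: (@measurable_fun_ifT _ _ (g_sigma_algebraType (past_gen P B t))); try exact: measurable_cst.
apply: (measurable_fun_bool true); rewrite setTI.
by have -> : (fun w => unhit t w) @^-1` [set true] = [set w | unhit t w].
Qed.

Lemma nu_star_strict c : c <= 1 -> strict_control P B c (nu_star X x c g).
Proof.
move=> c1; have c10 : 0 <= 1 - c by rewrite subr_ge0.
have nuE t w : nu_star X x c g t w = if unhit t w then 0 else 1 - c by [].
split.
- move=> w s t s0 st; rewrite !nuE; case: ifP => us; case: ifP => ut //.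
  by rewrite (unhit_le st ut) in us.
- move=> w t t0; apply/cvgrPdist_lt => e e0.
  have [ut|ut] := boolP (unhit t w).
    near=> s; rewrite !nuE ut ifT ?subrr ?normr0//.
    by apply: unhit_le ut; near: s; exact: nbhs_left_le.
  (* A hit at some s0 < t leaves the control constant on (s0, t], which gives the left limit. *)
  have [s0 [s00 s0t gs]] : exists s, [/\ 0 <= s, s < t & g <= Y s w].
    apply: contrapT => hn; move/negP: ut; apply; apply/unhitP => s s0 st.
    by rewrite ltNge; apply/negP => gs; apply: hn; exists s.
  near=> s; rewrite !nuE (negbTE ut) ifF ?subrr ?normr0//.
  apply/negbTE/negP => /unhitP/(_ s0 s00) H.
  have /H : s0 < s by near: s; exact: nbhs_left_gt.
  by rewrite ltNge gs.
- by move=> t t0; exact: unhit_meas.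
- by move=> w; rewrite nuE unhit0.
- move=> w t t0; rewrite nuE; case: ifP => _; first by rewrite addr0.
  by rewrite addrC subrK.
Unshelve. all: by end_near. Qed.

(** Strictly before t the path is below g, and continuity extends the weak inequality to t; at t = 0
    it comes from x < g. *)
Lemma unhit_le_level t w : x < g -> 0 <= t -> unhit t w -> Y t w <= g.
Proof.
move=> xg t0 /unhitP h; have [->|tn0] := eqVneq t 0; first by rewrite (Y0E hB sdeY) ltW.
have tp : 0 < t by rewrite lt_neqAle eq_sym tn0.
rewrite leNgt; apply/negP => gY.
have e0 : 0 < Y t w - g by rewrite subr_gt0.
have [dl dl0 H] := within_itvcyP_eps (@cY w) t0 e0.
pose s := Num.max 0 (t - dl / 2).
have s0 : 0 <= s by rewrite le_max lexx.
have st : s < t by rewrite gt_max tp ltrBlDr ltrDl divr_gt0.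
have sd : t - s < dl.
  have : t - dl / 2 <= s by rewrite le_max lexx orbT.
  by move: dl0; lra.
have := H s s0; rewrite distrC ger0_norm ?subr_ge0 ?(ltW st)// => /(_ sd).
have := h s s0 st; rewrite distrC; have := ler_norm (Y t w - Y s w); lra.
Qed.

Section stopped_sum.
Variables (a : nat -> R) (z : nat -> R).

(** The increments of a decreasing z with values in [0, 1] are weights of total at most 1. For
    indicators z of not having been hit, only the cell of the hit counts. *)
Lemma stopped_sum_bound n M : (forall k, z k.+1 <= z k) -> 0 <= z n -> z 0%N <= 1 -> 0 <= M ->
  (forall k, z k.+1 < z k -> `|a k| <= M) ->
  `|\sum_(0 <= k < n) a k * (z k - z k.+1)| <= M.
Proof.
move=> zd zn z0 M0 aM; apply: le_trans (ler_norm_sum _ _ _) _.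
apply: (@le_trans _ _ (\sum_(0 <= k < n) M * (z k - z k.+1))).
  apply: ler_sum => k _; have := zd k; rewrite le_eqVlt => /predU1P[->|zk].
    by rewrite subrr !mulr0 normr0.
  by rewrite normrM ler_pM ?aM// ger0_norm// subr_ge0 zd.
rewrite -mulr_sumr ler_piMr//.
under eq_bigr do rewrite -opprB.
rewrite sumrN (telescope_sumr z)// opprB lerBlDr (le_trans z0)//.
by rewrite lerDl.
Qed.
End stopped_sum.

(** At most one cell is nonzero. There the path is at or below g at the left end and reaches g
    inside, so at the right end it is close to g by uniform continuity, and D is small. *)
Lemma overstep_cvg0 (D : R -> R) w : x < g -> continuous D -> D g = 0 ->
  (fun j => \sum_(0 <= k < j * 2 ^ j) (D (Y (k.+1%:R * msh j) w)) *
     ((unhit (k%:R * msh j) w)%:R - (unhit (k.+1%:R * msh j) w)%:R)) @ \oo --> (0 : R).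
Proof.
move=> xg cD Dg; apply/cvgrPdist_le => e e0.
have kh0 j k : 0 <= k%:R * msh j :> R by rewrite mulr_ge0// ltW ?msh_gt0.
have [hit|nohit] := pselect (exists s, 0 <= s /\ g <= Y s w); last first.
  apply: nearW => j; rewrite sub0r normrN big1 ?normr0 ?(ltW e0)// => k _.
  have U t : unhit t w.
    apply/unhitP => s s0 _; rewrite ltNge; apply/negP => gs; apply: nohit; by exists s.
  by rewrite !U subrr mulr0.
have [s0 [s00 gs0]] := hit.
have /cvgrPdist_le/(_ e e0)[rho /= rho0 Hrho] := cD g.
have r2 : 0 < rho / 2 by rewrite divr_gt0.
(* The right end of the hit cell may exceed s0 by one mesh, hence by at most 1. *)
have [dl dl0 U] := unif_cont_segment (s0 + 1) (@cY w) r2.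
have /cvgrPdist_lt/(_ _ dl0)[N _ HN] := @msh_cvg R.
exists N => // j /= Nj; rewrite sub0r normrN.
have hdl : msh j < dl by have := HN j Nj; rewrite sub0r normrN; exact: le_lt_trans (ler_norm _).
apply: (@stopped_sum_bound (fun k => D (Y (k.+1%:R * msh j) w)) (fun k => (unhit (k%:R * msh j) w)%:R)).
- move=> k; rewrite ler_nat; case: (boolP (unhit (k.+1%:R * msh j) w)) => // u1.
  by rewrite (unhit_le _ u1)// ler_wpM2r ?ler_nat// ltW ?msh_gt0.
- by [].
- by case: (unhit _ w).
- exact: ltW.
move=> k; rewrite ltr_nat; case: (boolP (unhit (k%:R * msh j) w)) => uk; last by rewrite ltn0.
case: (boolP (unhit (k.+1%:R * msh j) w)) => // uk1 _.
have [s [ss sk gs]] : exists s, [/\ 0 <= s, s < k.+1%:R * msh j & g <= Y s w].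
  apply: contrapT => hn; move/negP: uk1; apply; apply/unhitP => s ss sk.
  by rewrite ltNge; apply/negP => gs; apply: hn; exists s.
have ks : k%:R * msh j <= s.
  by rewrite leNgt; apply/negP => sk'; have := (unhitP _ _).1 uk s ss sk'; rewrite ltNge gs.
have ks0 : k%:R * msh j <= s0.
  by rewrite leNgt; apply/negP => sk'; have := (unhitP _ _).1 uk s0 s00 sk'; rewrite ltNge gs0.
have kS : k.+1%:R * msh j = k%:R * msh j + msh j :> R by rewrite -natr1 mulrDl mul1r.
have m0 := @msh_gt0 R j; have m1 := @msh_le1 R j.
have kb : k.+1%:R * msh j <= s0 + 1 by rewrite kS lerD.
have d1 : `|Y (k.+1%:R * msh j) w - Y (k%:R * msh j) w| < rho / 2.
  by apply: U => //; rewrite kS addrAC subrr add0r gtr0_norm.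
have d2 : `|Y (k.+1%:R * msh j) w - Y s w| < rho / 2.
  apply: U => //; rewrite ger0_norm ?subr_ge0 ?(ltW sk)// kS.
  by apply: le_lt_trans hdl; rewrite lerBlDl lerD2r.
have yk := unhit_le_level xg (kh0 j k) uk.
have yg : `|g - Y (k.+1%:R * msh j) w| < rho.
  move: d1 d2; rewrite !ltr_norml => /andP[a1 a2] /andP[b1 b2].
  by apply/andP; split; lra.
by have := Hrho _ yg; rewrite Dg sub0r normrN.
Qed.

End hitting.

(** This is the total far overshoot: j 2^j cells, each losing O(4^-j). *)
Lemma msh_lin_cvg {R : realType} : (fun j => j%:R * msh j) @ \oo --> (0 : R).
Proof.
have key j : (j * j.+1 <= 4 * 2 ^ j)%N.
  elim: j => // j IH; rewrite expnS; have := ltn_expl j (ltnSn 1) => h.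
  rewrite (_ : (j.+1 * j.+2 = j * j.+1 + 2 * j.+1)%N); last by rewrite -mulnDl addn2 mulnC.
  have h2 : (2 * j.+1 <= 4 * 2 ^ j)%N.
    by apply: (@leq_trans (2 * 2 ^ j)%N); rewrite ?leq_mul2l ?h// leq_mul2r orbT.
  by rewrite [(4 * (2 * _))%N]mulnCA [(2 * (4 * _))%N]mul2n -addnn leq_add.
apply: (@squeeze_cvgr _ _ _ _ (fun=> 0) (fun j => 4 * j.+1%:R^-1)).
- apply: nearW => j; rewrite mulr_ge0 ?(ltW (msh_gt0 j))//= /msh.
  rewrite ler_pdivrMr ?ltr0n ?expn_gt0// mulrAC ler_pdivlMr ?ltr0n// -natrM.
  by have := key j; rewrite -(ler_nat R) [X in _ <= X]natrM.
- exact: cvg_cst.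
- rewrite -[X in _ --> X](mulr0 4); apply: cvgM; first exact: cvg_cst.
  exact: cvg_harmonic.
Qed.

Lemma disc_cvg {R : realType} (b : R) : 0 < b -> (fun j => expR (- (b * j%:R))) @ \oo --> (0 : R).
Proof.
move=> b0; have -> : (fun m => expR (- (b * m%:R)) : R) = (fun m => expR (- b) ^+ m).
  by apply/funext => m; rewrite -expRM_natl mulrN mulrC.
by apply: cvg_expr; rewrite ger0_norm ?expR_ge0// expR_lt1 oppr_lt0.
Qed.

Lemma msh_horizon {R : realType} j : (j * 2 ^ j)%:R * msh j = j%:R :> R.
Proof. by rewrite /msh natrM mulfK// pnatr_eq0 -lt0n expn_gt0. Qed.

(** * Passage to the limit and the lower bound *)

Section cost_limit.
Context {R : realType} {d : measure_display} {T : measurableType d}.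
Variables (P : probability T R) (B : R -> T -> R).
Hypothesis cP : measure_is_complete P.
Hypothesis hB : standard_BM P B.
Variables (theta sigma mu x : R) (Y : R -> T -> R).
Hypotheses (th0 : 0 < theta) (sg0 : 0 < sigma) (mu0 : 0 < mu).
Hypothesis cY : forall w, {within `[0, +oo[, continuous (fun t => Y t w)}.
Hypothesis sdeY : forall w t, 0 <= t ->
  Y t w = x + Rintegral lebesgue_measure `[0, t] (fun s => theta * (mu - Y s w)) + sigma * B t w.
Variables (lam : R) (Phi : R -> R).
Hypothesis lam0 : 0 < lam.
Hypothesis dPhi : forall y : R, derivable Phi y 1.
Hypothesis Phi_ni : forall y z, y <= z -> Phi z <= Phi y.
Hypothesis Phi_cvx : forall y z s, y != z -> 0 < s -> s < 1 ->
  Phi (s * y + (1 - s) * z) < s * Phi y + (1 - s) * Phi z.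
Hypothesis Phi1 : Phi 1 = 0.
Hypothesis k_lt0 : forall c, 0 <= c -> c <= 1 -> kfun theta lam Phi c < 0.
Variables (c : R) (nu : R -> T -> R).
Hypotheses (c0 : 0 <= c) (c1 : c <= 1) (hnu : strict_control P B c nu).
Let A := ou_resolvent theta mu lam.

Lemma terminal_cvg :
  Rintegral P setT (fun w => lam * Phi (c + nu ((j * 2 ^ j)%:R * msh j) w) * disc lam ((j * 2 ^ j)%:R * msh j)
    * A (Y ((j * 2 ^ j)%:R * msh j) w)) @[j --> \oo] --> (0 : R).
Proof.
have [K0 HK] := terminal_bound cP hB th0 cY sdeY lam0 dPhi Phi_ni Phi1.
pose b j := K0 * expR (- (lam / 2 * j%:R)).
have b0 : b j @[j --> \oo] --> (0 : R).
  rewrite -(mulr0 K0); apply: cvgM; first exact: cvg_cst.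
  by apply: disc_cvg; rewrite divr_gt0.
apply: (@squeeze_cvgr _ _ _ _ (fun j => - b j) b) => //; last first.
  by rewrite -[X in _ --> X]oppr0; exact: cvgN.
apply: nearW => j; rewrite -ler_norml msh_horizon /b.
have -> : lam / 2 * j%:R = lam * j%:R / 2 by rewrite mulrAC.
have [_] := HK j%:R (fun w => c + nu j%:R w) (ler0n _ _)
  (measurable_funD (measurable_cst _) (strict_measurable cP hB hnu (ler0n _ _)))
  (fun w => strict_itv c0 hnu w (ler0n _ _)).
exact.
Qed.

Lemma cost_limit l :
  \sum_(0 <= k < j * 2 ^ j) disc lam (k.+1%:R * msh j) *
      Rintegral P setT (fun w => gain theta mu lam Phi (c + nu (k%:R * msh j) w) (Y (k.+1%:R * msh j) w)
                   - gain theta mu lam Phi (c + nu (k.+1%:R * msh j) w) (Y (k.+1%:R * msh j) w))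
    @[j --> \oo] --> l ->
  (\int[P]_w path_cost Y lam Phi c nu w)%E = (lam * Phi c * A x + l)%:E.
Proof.
move=> gl; have [_ H] := path_cost_cvg cP hB th0 mu0 cY sdeY lam0 dPhi Phi_ni Phi1 c0 hnu.
apply: (cvg_unique _ H) => //.
have I1 j := (ecostE cP hB th0 cY sdeY lam0 dPhi Phi_ni Phi1 c0 hnu j).1.
have E1 j := (ecostE cP hB th0 cY sdeY lam0 dPhi Phi_ni Phi1 c0 hnu j).2.
have -> : (fun j => \int[P]_w (ecost theta mu Y lam Phi c nu j w)%:E)%E =
    (fun j => (Rintegral P setT (ecost theta mu Y lam Phi c nu j))%:E).
  by apply/funext => j; exact: EFin_Rintegral.
have EX : Rintegral P setT (ecost theta mu Y lam Phi c nu j) @[j --> \oo] --> lam * Phi c * A x + l.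
  rewrite (funext E1); apply: cvgD gl; rewrite -[X in _ --> X]subr0.
  by apply: cvgB terminal_cvg; exact: cvg_cst.
by apply: cvg_EFin; [exact: nearW|exact: EX].
Qed.

Lemma cost_lower_bound :
  ((Wfun theta sigma mu lam Phi x c)%:E <= \int[P]_w path_cost Y lam Phi c nu w)%E.
Proof.
have [_ H] := path_cost_cvg cP hB th0 mu0 cY sdeY lam0 dPhi Phi_ni Phi1 c0 hnu.
rewrite (WfunE mu th0 sg0 lam0 dPhi Phi1 k_lt0 x c0 c1).
set W := _ - _; have WE : W%:E @[j --> \oo] --> W%:E by exact: cvg_cst.
have W0 : (W - Rintegral P setT (fun w => lam * Phi (c + nu ((j * 2 ^ j)%:R * msh j) w) * disc lam ((j * 2 ^ j)%:R * msh j)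
    * A (Y ((j * 2 ^ j)%:R * msh j) w)))%:E @[j --> \oo] --> W%:E.
  apply: cvg_EFin; first exact: nearW.
  by rewrite -[X in _ --> X]subr0; apply: cvgB terminal_cvg; exact: cvg_cst.
rewrite -(cvg_lim _ H)// -(cvg_lim _ W0)//; apply: lee_lim.
- by apply/cvg_ex; exists W%:E.
- by apply/cvg_ex; eexists; exact: H.
apply: nearW => j; have [I1 _] := ecostE cP hB th0 cY sdeY lam0 dPhi Phi_ni Phi1 c0 hnu j.
rewrite EFin_Rintegral// lee_fin.
exact: (ecost_ge cP hB th0 sg0 mu0 cY sdeY lam0 dPhi Phi_ni Phi_cvx Phi1 k_lt0 c0 hnu j c1).
Qed.

End cost_limit.

(** * Cost of the candidate control *)

Section optimal_control.
Context {R : realType} {d : measure_display} {T : measurableType d}.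
Variables (P : probability T R) (B : R -> T -> R).
Hypothesis cP : measure_is_complete P.
Hypothesis hB : standard_BM P B.
Variables (theta sigma mu x : R) (X : R -> R -> T -> R).
Let Y := X x.
Hypotheses (th0 : 0 < theta) (sg0 : 0 < sigma) (mu0 : 0 < mu).
Hypothesis cY : forall w, {within `[0, +oo[, continuous (fun t => Y t w)}.
Hypothesis sdeY : forall w t, 0 <= t ->
  Y t w = x + Rintegral lebesgue_measure `[0, t] (fun s => theta * (mu - Y s w)) + sigma * B t w.
Variables (lam : R) (Phi : R -> R).
Hypothesis lam0 : 0 < lam.
Hypothesis dPhi : forall y : R, derivable Phi y 1.
Hypothesis Phi_ni : forall y z, y <= z -> Phi z <= Phi y.
Hypothesis Phi_cvx : forall y z s, y != z -> 0 < s -> s < 1 ->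
  Phi (s * y + (1 - s) * z) < s * Phi y + (1 - s) * Phi z.
Hypothesis Phi1 : Phi 1 = 0.
Hypothesis k_lt0 : forall c, 0 <= c -> c <= 1 -> kfun theta lam Phi c < 0.
Variable c : R.
Hypotheses (c0 : 0 <= c) (c1 : c < 1).

Local Notation Int f := (P.-integrable setT (EFin \o f)).
Local Notation Ex f := (Rintegral P setT f).
Let p := psi_lam theta sigma mu lam.
Let gm := gam theta sigma mu lam Phi c.
Let K := xbar0 theta mu lam Phi c.
Let al := (gm - K) / p gm.
Let kp := - zeta theta lam Phi c / (lam + theta).
Let G := ou_sup theta sigma mu Y lam.
Let nu := nu_star X x c gm.
Let U t w := unhit x X gm t w.
Let hnu : strict_control P B c nu.
Proof. exact: (nu_star_strict hB th0 cY sdeY gm (ltW c1)). Qed.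
Let Kg : K < gm. Proof. by have [] := gam_spec mu th0 sg0 lam0 Phi c. Qed.
Let gE : p gm = psi' theta sigma mu lam gm * (gm - K).
Proof. by have [] := gam_spec mu th0 sg0 lam0 Phi c. Qed.
Let p_gt0 y : 0 < p y. Proof. exact: psi_gt0. Qed.
Let p_le y z : y <= z -> p y <= p z. Proof. exact: psi_le. Qed.
Let al0 : 0 < al. Proof. by rewrite divr_gt0// subr_gt0. Qed.
Let p_tan y : y - K <= al * p y.
Proof. exact: (stop_val_tangent (psi_gt0 mu th0 sg0 lam0) (psi'_gt0 mu th0 sg0 lam0) (psi_tangent mu th0 sg0 lam0) Kg gE). Qed.
Let p_cont : continuous p.
Proof.
by move=> y; apply: differentiable_continuous; apply/derivable1_diffP; have := psi_is_derive mu th0 sg0 lam0 y => -[].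
Qed.
Let mp : measurable_fun setT p. Proof. exact: psi_measurable. Qed.
Let mY t : 0 <= t -> measurable_fun setT (Y t).
Proof. exact: (Y_meas cP hB th0 cY sdeY). Qed.

Let qE t w : c + nu t w = if U t w then c else 1.
Proof.
rewrite /nu /nu_star -/(unhit x X gm t w) -/(U t w); case: ifP => _; first by rewrite addr0.
by rewrite addrC subrK.
Qed.

Let u t w : R := (U t w)%:R.
Let uE t w : u t w = if U t w then 1 else 0. Proof. by rewrite /u; case: (U t w). Qed.
Let u01 t w : 0 <= u t w <= 1. Proof. by rewrite uE; case: ifP; rewrite lexx ler01. Qed.
Let u_ge0 t w : 0 <= u t w. Proof. by have /andP[] := u01 t w. Qed.
Let u_le s t w : s <= t -> u t w <= u s w.
Proof.
move=> st; rewrite !uE; case: (boolP (U t w)) => [ut|_]; last by case: ifP.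
by rewrite ifT//; exact: (unhit_le st ut).
Qed.
Let mup t : 0 <= t -> meas_wrt (past_gen P B t) (u t).
Proof.
move=> t0; have := unhit_meas hB th0 cY sdeY gm 1 0 t0.
by rewrite /meas_wrt; under eq_fun do rewrite -uE.
Qed.
Let mu' t : 0 <= t -> measurable_fun setT (u t).
Proof. move=> t0; exact: (meas_wrt_measurable (past_gen_measurable cP hB (s:=t)) (mup t0)). Qed.

Lemma nu_star_gain s t y w : s <= t ->
  gain theta mu lam Phi (c + nu s w) y - gain theta mu lam Phi (c + nu t w) y
  = - kp * (y - K) * (u s w - u t w).
Proof.
move=> st; rewrite !qE !uE.
have g1 : gain theta mu lam Phi 1 y = 0 by rewrite /gain subrr Phi1 !(mulr0, mul0r) subrr.
have gc : gain theta mu lam Phi c y = - kp * (y - K).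
  have := gainE mu th0 lam0 dPhi Phi1 k_lt0 y c0 c1 => ->.
  by rewrite /kp; congr (_ * _); rewrite mulNr opprK.
case: ifP => us; case: ifP => ut; rewrite ?gc ?g1 ?subrr ?mulr0 ?subr0 ?mulr1//.
by have := unhit_le st ut; rewrite -/(U s w) us.
Qed.

Section below_threshold.
Hypothesis xg : x < gm.
Variable j : nat.
Let h := @msh R j.
Let h0 : 0 < h. Proof. exact: msh_gt0. Qed.
Let t k : R := k%:R * h.
Let t0 k : 0 <= t k. Proof. by rewrite mulr_ge0// ltW. Qed.
Let tS k : t k.+1 = t k + h. Proof. by rewrite /t -natr1 mulrDl mul1r. Qed.
Let tle k : t k <= t k.+1. Proof. by rewrite tS lerDl ltW. Qed.
Let Y_le k w : U (t k) w -> Y (t k) w <= gm.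
Proof. exact: (unhit_le_level hB cY sdeY xg (t0 k)). Qed.
Let mpY k : measurable_fun setT (fun w => p (Y (t k) w)).
Proof. exact: (measurableT_comp mp (mY (t0 k))). Qed.

Let Ilin f C k := @integrable_lin _ _ _ P B cP hB theta sigma mu x Y th0 cY sdeY lam lam0 f C (t k) (t0 k).

Lemma stopped_psi_integrable k : Int (fun w => p (Y (t k) w) * u (t k) w).
Proof.
apply: (@Ilin _ (p gm) k); first exact: ltW.
  by apply: measurable_funM => //; exact: mu'.
move=> w; rewrite ger0_norm; last by apply: mulr_ge0 => //; exact: ltW.
rewrite uE; case: ifP => ut; last by rewrite mulr0 mulr_ge0 ?ltW// ltr_pwDl.
rewrite mulr1 -[leLHS]mulr1; apply: ler_pM => //; first exact: ltW.
  by apply: p_le; exact: Y_le.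
by rewrite lerDl.
Qed.

(** The state at t_(k+1) may overshoot the threshold, where psi outgrows the envelope; integrability
    is read off from the kernel identity, which evaluates the expectation as a finite number. *)
Lemma stopped_psi_step k :
  Int (fun w => p (Y (t k.+1) w) * u (t k) w) /\
  Ex (fun w => p (Y (t k.+1) w) * u (t k) w) = expR (lam * h) * Ex (fun w => p (Y (t k) w) * u (t k) w).
Proof.
have Ik := stopped_psi_integrable k.
have mF : measurable_fun setT (fun z : R * R => (`|z.1| * p z.2)%:E).
  apply/measurable_EFinP; apply: measurable_funM.
    by apply: measurableT_comp => //; exact: measurable_fst.
  exact: (measurableT_comp mp measurable_snd).
have F0 (z : R * R) : (0 <= (`|z.1| * p z.2)%:E)%E by rewrite lee_fin mulr_ge0// ltW.
have E : (\int[P]_w (p (Y (t k.+1) w) * u (t k) w)%:E =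
    (expR (lam * h) * Ex (fun w => p (Y (t k) w) * u (t k) w))%:E)%E.
  have := @ou_step _ _ _ P B cP hB theta sigma mu x Y th0 cY sdeY (t k) h _ _ (u (t k))
    (fun z : R * R => (`|z.1| * p z.2)%:E) (t0 k) h0 (mup (t0 k)) mF F0.
  rewrite -tS /=.
  have nu_ w : `|u (t k) w| = u (t k) w by rewrite ger0_norm//; have /andP[] := u01 (t k) w.
  under eq_integral => w _ do rewrite nu_ mulrC.
  move=> ->.
  rewrite EFinM -EFin_Rintegral// -integralZl//.
  apply: eq_integral => w _.
  under eq_integral => v _ do rewrite nu_ EFinM.
  have mx : measurable_fun setT (fun v => ou_mean theta mu h (Y (t k) w) + ou_noise theta mu Y (t k) h v).
    by apply: measurable_funD => //; exact: (xi_mfun hB th0 cY sdeY (t0 k) h0).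
  rewrite ge0_integralZl//; last 3 first.
  - by apply/measurable_EFinP; exact: (measurableT_comp mp mx).
  - by move=> v _; rewrite lee_fin ltW.
  - by rewrite lee_fin; have /andP[] := u01 (t k) w.
  rewrite (psi_kernel mu th0 sg0 lam0 _ (xi_mfun hB th0 cY sdeY (t0 k) h0)).
    by rewrite -!EFinM; congr EFin; rewrite mulrCA; congr (_ * _); exact: mulrC.
  by move=> b; exact: (ou_noise_mgf cP hB th0 cY sdeY b (t0 k) h0).
split; last by rewrite /Rintegral E.
apply/integrableP; split.
  by apply/measurable_EFinP; apply: measurable_funM => //; exact: mu'.
under eq_integral => w _.
  rewrite gee0_abs; last by rewrite lee_fin; apply: mulr_ge0 => //; exact: ltW.
  over.
by rewrite E ltry.
Qed.

(** The loss from stopping at y instead of at the threshold, cut at distance 1 above it. This part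
    grows linearly and can be dominated by the envelope; [far_excess] inherits the growth of psi and
    is estimated in expectation. *)
Definition near_excess (y : R) := (al * p y - (y - K)) * (y <= gm + 1)%R%:R.
Definition far_excess (y : R) := (al * p y - (y - K)) * (gm + 1 < y)%R%:R.

Lemma excess_split y : y - K = al * p y - near_excess y - far_excess y.
Proof.
rewrite /near_excess /far_excess; case: (leP y (gm + 1)) => _; rewrite ?mulr1 ?mulr0; ring.
Qed.

Lemma near_excess_bound : exists2 C, 0 <= C & forall y, 0 <= near_excess y <= C * (1 + `|y|).
Proof.
exists (al * p (gm + 1) + `|K| + 1); first by rewrite !addr_ge0// mulr_ge0// ltW.
move=> y; rewrite /near_excess; have h1 := p_tan y.
have C0 : 0 <= al * p (gm + 1) by rewrite mulr_ge0// ltW.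
have k0 := normr_ge0 K; have y0 := normr_ge0 y.
case: (leP y (gm + 1)) => yg; rewrite ?mulr1 ?mulr0.
  rewrite subr_ge0 h1/=.
  have h2 : al * p y <= al * p (gm + 1) by rewrite ler_pM2l// p_le.
  have h3 := ler_norm K; have h4 := ler_norm (- y); rewrite normrN in h4.
  apply: (@le_trans _ _ (al * p (gm + 1) + `|K| + `|y|)); first by rewrite -[leRHS]addrA opprB; apply: lerD => //; apply: lerD.
  have := mulr_ge0 C0 y0; have := mulr_ge0 k0 y0.
  move: (al * p (gm + 1)) `|K| `|y| C0 k0 y0 => a b e; nra.
by rewrite lexx/= mulr_ge0// !addr_ge0.
Qed.

Lemma near_excess_measurable : measurable_fun setT near_excess.
Proof.
apply: measurable_funM.
  by apply: measurable_funB; [exact: measurable_funM|exact: measurable_funB].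
have mi : measurable_fun setT (\1_(`]-oo, gm + 1]%classic : set R) : R -> R) by exact: measurable_indic.
move: mi; apply: eq_measurable_fun => y _; rewrite indicE.
have -> // : (y \in (`]-oo, gm + 1]%classic : set R)) = (y <= gm + 1).
by apply/idP/idP; rewrite inE/= in_itv.
Qed.

Let I_ k w : R := u (t k) w - u (t k.+1) w.
Let I01 k w : 0 <= I_ k w <= 1.
Proof.
have := u_le w (tle k); have /andP[] := u01 (t k) w; have /andP[] := u01 (t k.+1) w.
by rewrite /I_ => a1 a2 a3 a4 a5; rewrite subr_ge0 a5 lerBlDr (le_trans a4)// lerDl.
Qed.
Let mI k : measurable_fun setT (I_ k).
Proof. by apply: measurable_funB; exact: mu'. Qed.

Let scaled_lin (f : R -> R) C k : 0 <= C -> measurable_fun setT f ->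
  (forall y, `|f y| <= C * (1 + `|y|)) -> Int (fun w => f (Y (t k.+1) w) * I_ k w).
Proof.
move=> C0 mf fC; apply: (@Ilin _ C k.+1) => //.
  by apply: measurable_funM => //; exact: (measurableT_comp mf (mY (t0 _))).
move=> w; have /andP[i0 i1] := I01 k w; rewrite normrM (ger0_norm i0) -[leRHS]mulr1.
by apply: ler_pM.
Qed.

Lemma price_integrable k : Int (fun w => (Y (t k.+1) w - K) * I_ k w).
Proof.
apply: (@scaled_lin (fun y => y - K) (1 + `|K|)) => //.
  exact: measurable_funB.
move=> y; apply: le_trans (ler_normB _ _) _.
have := mulr_ge0 (normr_ge0 K) (normr_ge0 y); have := normr_ge0 y; nra.
Qed.

Lemma near_integrable k : Int (fun w => near_excess (Y (t k.+1) w) * I_ k w).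
Proof.
have [C C0 hC] := near_excess_bound; apply: (scaled_lin k C0); first exact: near_excess_measurable.
by move=> y; have /andP[a b] := hC y; rewrite ger0_norm.
Qed.

Lemma psi_increment k :
  Int (fun w => p (Y (t k.+1) w) * I_ k w) /\
  Ex (fun w => p (Y (t k.+1) w) * I_ k w) =
    expR (lam * h) * Ex (fun w => p (Y (t k) w) * u (t k) w) - Ex (fun w => p (Y (t k.+1) w) * u (t k.+1) w).
Proof.
have [I1 <-] := stopped_psi_step k; have I2 := stopped_psi_integrable k.+1.
have -> : (fun w => p (Y (t k.+1) w) * I_ k w) =
  (fun w => p (Y (t k.+1) w) * u (t k) w - p (Y (t k.+1) w) * u (t k.+1) w).
  by apply/funext => w; rewrite /I_ mulrBr.
by split; [exact: (integrableB measurableT I1 I2)|rewrite RintegralB].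
Qed.

Lemma far_integrable k : Int (fun w => far_excess (Y (t k.+1) w) * I_ k w).
Proof.
have [I1 _] := psi_increment k; have I2 := price_integrable k; have I3 := near_integrable k.
have -> : (fun w => far_excess (Y (t k.+1) w) * I_ k w) =
  (fun w => al * (p (Y (t k.+1) w) * I_ k w) - (Y (t k.+1) w - K) * I_ k w - near_excess (Y (t k.+1) w) * I_ k w).
  by apply/funext => w; rewrite excess_split; ring.
exact: (integrableB measurableT (integrableB measurableT (integrableZl measurableT al I1) I2) I3).
Qed.

Lemma price_expectation k :
  Ex (fun w => (Y (t k.+1) w - K) * I_ k w) =
  al * (expR (lam * h) * Ex (fun w => p (Y (t k) w) * u (t k) w) - Ex (fun w => p (Y (t k.+1) w) * u (t k.+1) w))
  - Ex (fun w => near_excess (Y (t k.+1) w) * I_ k w) - Ex (fun w => far_excess (Y (t k.+1) w) * I_ k w).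
Proof.
have [I1 <-] := psi_increment k; have I3 := near_integrable k; have I4 := far_integrable k.
have I1' := integrableZl measurableT al I1.
rewrite -RintegralZl//.
have -> : (fun w => (Y (t k.+1) w - K) * I_ k w) =
  (fun w => al * (p (Y (t k.+1) w) * I_ k w) - near_excess (Y (t k.+1) w) * I_ k w - far_excess (Y (t k.+1) w) * I_ k w).
  by apply/funext => w; rewrite excess_split; ring.
by rewrite (RintegralB measurableT (integrableB measurableT I1' I3) I4) (RintegralB measurableT I1' I3).
Qed.

Lemma far_excess_ge0 y : 0 <= far_excess y.
Proof. by rewrite /far_excess mulr_ge0// subr_ge0. Qed.

(** Far above the threshold y - K >= 0, so the excess is at most al psi; a hit in the cell requires
    being unhit, hence at or below the threshold, at its left end, where the assumed overshoot bound
    applies. *)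
Lemma far_expectation k C :
  (forall y, y <= gm -> (\int[P]_w (p (ou_mean theta mu h y + ou_noise theta mu Y (t k) h w) *
      (gm + 1 < ou_mean theta mu h y + ou_noise theta mu Y (t k) h w)%R%:R)%:E <= (C * h ^+ 2)%:E)%E) ->
  0 <= C ->
  0 <= Ex (fun w => far_excess (Y (t k.+1) w) * I_ k w) <= al * (C * h ^+ 2).
Proof.
move=> HC C0; have I4 := far_integrable k.
have far_ge w : 0 <= far_excess (Y (t k.+1) w) * I_ k w.
  by have /andP[i0 _] := I01 k w; apply: mulr_ge0 => //; exact: far_excess_ge0.
apply/andP; split; first by apply: Rintegral_ge0 => w _.
have mlt : measurable_fun setT (fun y : R => (gm + 1 < y)%R%:R : R).
  have mi : measurable_fun setT (\1_(`]gm + 1, +oo[%classic : set R) : R -> R) by exact: measurable_indic.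
  move: mi; apply: eq_measurable_fun => y _; rewrite indicE.
  have -> // : (y \in (`]gm + 1, +oo[%classic : set R)) = (gm + 1 < y).
  by apply/idP/idP; rewrite inE/= in_itv/= andbT.
have mpl : measurable_fun setT (fun y : R => p y * (gm + 1 < y)%R%:R) by exact: measurable_funM.
have mF : measurable_fun setT (fun z : R * R => (`|z.1| * (p z.2 * (gm + 1 < z.2)%R%:R))%:E).
  apply/measurable_EFinP; apply: measurable_funM.
    by apply: measurableT_comp => //; exact: measurable_fst.
  exact: (measurableT_comp mpl measurable_snd).
have F0 (z : R * R) : (0 <= (`|z.1| * (p z.2 * (gm + 1 < z.2)%R%:R))%:E)%E.
  by rewrite lee_fin mulr_ge0// mulr_ge0// ltW.
rewrite -lee_fin -(EFin_Rintegral I4).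
apply: (@le_trans _ _ (\int[P]_w (al%:E * (`|u (t k) w| * (p (Y (t k.+1) w) * (gm + 1 < Y (t k.+1) w)%R%:R))%:E))%E).
  have mZ : measurable_fun setT (fun w => (u (t k) w, Y (t k.+1) w)).
    by apply/measurable_fun_pairP; split; [exact: mu'|exact: mY].
  apply: ge0_le_integral => //.
  - by move=> w _; rewrite lee_fin.
  - by case/integrableP: I4.
  - by apply: emeasurable_funM => //; exact: (measurableT_comp mF mZ).
  move=> w _; rewrite -EFinM lee_fin /far_excess; have /andP[i0 i1] := I01 k w.
  have pw : 0 <= p (Y (t k.+1) w) by exact: ltW.
  case: (ltP (gm + 1) (Y (t k.+1) w)) => yg; rewrite ?mulr1 ?mulr0 ?mul0r//=.
  rewrite ger0_norm// [u _ _ * _]mulrC [leRHS]mulrA; apply: ler_pM => //.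
  - by rewrite subr_ge0.
  - have : gm - K <= Y (t k.+1) w - K by rewrite lerD2r (le_trans _ (ltW yg))// lerDl.
    by rewrite gerBl; apply: le_trans; rewrite subr_ge0 ltW.
  - by rewrite /I_ gerBl.
rewrite ge0_integralZl//; last 3 first.
- have mZ : measurable_fun setT (fun w => (u (t k) w, Y (t k.+1) w)).
    by apply/measurable_fun_pairP; split; [exact: mu'|exact: mY].
  exact: (measurableT_comp mF mZ).
- by move=> w _; rewrite lee_fin mulr_ge0// mulr_ge0// ltW.
- by rewrite lee_fin ltW.
rewrite [X in (_ <= X)%E]EFinM; apply: lee_wpmul2l; first by rewrite lee_fin ltW.
have := @ou_step_le _ _ _ P B cP hB theta sigma mu x Y th0 cY sdeY (t k) h _ _ (u (t k))
    (fun z : R * R => (`|z.1| * (p z.2 * (gm + 1 < z.2)%R%:R))%:E) (fun=> (C * h ^+ 2)%:E)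
    (t0 k) h0 (mup (t0 k)) mF F0 (measurable_cst _).
rewrite -tS /=.
have PT : P setT = 1%E by exact: probability_setT.
move=> H; apply: (@le_trans _ _ (\int[P]_(w in setT) (C * h ^+ 2)%:E)%E); last by rewrite integral_cst// [X in (_ * X)%E]PT mule1.
apply: H => w.
rewrite uE; case: ifP => ut; last first.
  rewrite integral0_eq; first by rewrite lee_fin mulr_ge0// sqr_ge0.
  by move=> v _; rewrite normr0 mul0r.
under eq_integral => v _ do rewrite normr1 mul1r.
by apply: HC; exact: Y_le.
Qed.

Lemma stopped_psi_bound k : 0 <= Ex (fun w => p (Y (t k) w) * u (t k) w) <= p gm.
Proof.
have I1 := stopped_psi_integrable k; apply/andP; split.
  by apply: Rintegral_ge0 => w _; apply: mulr_ge0 => //; exact: ltW.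
rewrite -[leRHS](Rintegral_const P); apply: le_Rintegral => //; first exact: integrable_bounded_cst.
move=> w _; rewrite uE; case: ifP => ut; last by rewrite mulr0 ltW.
by rewrite mulr1; apply: p_le; exact: Y_le.
Qed.

Lemma stopped_psi_start : Ex (fun w => p (Y (t 0%N) w) * u (t 0%N) w) = p x.
Proof.
rewrite -[RHS](Rintegral_const P); apply: eq_Rintegral => w _.
rewrite /t mul0r (Y0E hB sdeY) uE; have -> : U 0 w by exact: unhit0.
by rewrite mulr1.
Qed.

Definition near_sum w := \sum_(0 <= k < j * 2 ^ j) disc lam (t k.+1) * near_excess (Y (t k.+1) w) * I_ k w.

Lemma near_sum_integrable : Int near_sum /\
  Ex near_sum = \sum_(0 <= k < j * 2 ^ j) disc lam (t k.+1) * Ex (fun w => near_excess (Y (t k.+1) w) * I_ k w).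
Proof.
have I1 k : Int (fun w => disc lam (t k.+1) * near_excess (Y (t k.+1) w) * I_ k w).
  have := integrableZl measurableT (disc lam (t k.+1)) (near_integrable k).
  by apply: eq_integrable => // w _; rewrite /= -EFinM mulrA.
have [I2 E2] := Rintegral_sum_nat (j * 2 ^ j) I1; split => //.
rewrite E2; apply: eq_bigr => k _; rewrite -RintegralZl//; last exact: near_integrable.
by apply: eq_Rintegral => w _; rewrite mulrA.
Qed.

(** Discounted psi on the unhit event telescopes to psi x minus r1, the mass still unhit at the
    horizon; the near and far excesses are what stopping only at grid times loses. *)
Lemma nu_star_sum C : 0 <= C ->
  (forall k y, y <= gm -> (\int[P]_w (p (ou_mean theta mu h y + ou_noise theta mu Y (t k) h w) *
      (gm + 1 < ou_mean theta mu h y + ou_noise theta mu Y (t k) h w)%R%:R)%:E <= (C * h ^+ 2)%:E)%E) ->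
  exists r1 r2, [/\ 0 <= r1 <= expR (- (lam * j%:R)) * p gm, 0 <= r2 <= al * C * (j%:R * h) &
   \sum_(0 <= k < j * 2 ^ j) disc lam (t k.+1) *
        Ex (fun w => gain theta mu lam Phi (c + nu (t k) w) (Y (t k.+1) w)
                   - gain theta mu lam Phi (c + nu (t k.+1) w) (Y (t k.+1) w))
   = - kp * (al * (p x - r1) - Ex near_sum - r2)].
Proof.
move=> C0 HC; set n := (j * 2 ^ j)%N.
have nh : t n = j%:R by rewrite /t /n /h /msh natrM mulfK// pnatr_eq0 -lt0n expn_gt0.
pose V k := Ex (fun w => p (Y (t k) w) * u (t k) w).
exists (disc lam (t n) * V n), (\sum_(0 <= k < n) disc lam (t k.+1) * Ex (fun w => far_excess (Y (t k.+1) w) * I_ k w)).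
have d1 k : disc lam (t k) <= 1.
  by rewrite /disc -[leRHS]expR0 ler_expR oppr_le0 mulr_ge0// ltW.
split.
- have /andP[v0 v1] := stopped_psi_bound n.
  by rewrite mulr_ge0 ?expR_ge0//= /disc nh ler_wpM2l ?expR_ge0.
- apply/andP; split.
    apply: sumr_ge0 => k _; rewrite mulr_ge0 ?expR_ge0//.
    by have /andP[] := far_expectation (HC k) C0.
  have nE : al * C * (j%:R * h) = \sum_(0 <= k < n) al * (C * h ^+ 2).
    by rewrite sumr_const_nat subn0 -mulr_natr -nh /t; ring.
  rewrite nE; apply: ler_sum => k _; have /andP[f0 f1] := far_expectation (HC k) C0.
  by apply: le_trans f1; rewrite ler_piMl.
have [_ ->] := near_sum_integrable.
have -> : p x - disc lam (t n) * V n = \sum_(0 <= k < n) disc lam (t k.+1) * (expR (lam * h) * V k - V k.+1).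
  have -> : p x = disc lam (t 0%N) * V 0%N.
    by rewrite /V stopped_psi_start /t mul0r /disc mulr0 oppr0 expR0 mul1r.
  have := @telescope_sumr _ 0 n (fun k => - (disc lam (t k) * V k)) (leq0n n).
  rewrite opprK addrC => <-; apply: eq_bigr => k _.
  have -> : disc lam (t k) = disc lam (t k.+1) * expR (lam * h).
    by rewrite /disc -expRD tS; congr expR; ring.
  by ring.
rewrite mulr_sumr -!sumrB mulr_sumr; apply: eq_bigr => k _.
have -> : Ex (fun w => gain theta mu lam Phi (c + nu (t k) w) (Y (t k.+1) w)
                   - gain theta mu lam Phi (c + nu (t k.+1) w) (Y (t k.+1) w)) =
   - kp * Ex (fun w => (Y (t k.+1) w - K) * I_ k w).
  rewrite -RintegralZl//; last exact: price_integrable.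
  by apply: eq_Rintegral => w _; rewrite (nu_star_gain _ _ (tle k)) mulrA.
rewrite price_expectation -/(V k) -/(V k.+1); ring.
Qed.

End below_threshold.

(** The excess al psi - (y - K) vanishes at the threshold, so [overstep_cvg0] gives convergence
    along each path, and linear growth with the discount gives the dominating function 2 C G. *)
Lemma near_sum_cvg : x < gm -> Ex (near_sum j) @[j --> \oo] --> (0 : R).
Proof.
move=> xg; pose D y := al * p y - (y - K).
have cD : continuous D.
  move=> y; apply: cvgB; first by apply: cvgM; [exact: cvg_cst|exact: p_cont].
  by apply: cvgB; [exact: cvg_id|exact: cvg_cst].
have Dg : D gm = 0 by rewrite /D /al divfK ?subrr// gt_eqF.
have kh0 j k : 0 <= k%:R * msh j :> R by rewrite mulr_ge0// ltW ?msh_gt0.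
have d0 t : 0 <= disc lam t by exact: expR_ge0.
have d1 t : 0 <= t -> disc lam t <= 1.
  by move=> t0; rewrite /disc -[leRHS]expR0 ler_expR oppr_le0 mulr_ge0// ltW.
have I0 j k w : 0 <= u (k%:R * msh j) w - u (k.+1%:R * msh j) w.
  by rewrite subr_ge0 u_le// ler_wpM2r ?ler_nat// ltW ?msh_gt0.
have [C C0 hC] := near_excess_bound.
have nD y : 0 <= near_excess y <= D y.
  have /andP[-> _] := hC y; rewrite /near_excess ler_piMr ?subr_ge0//.
  by case: (y <= gm + 1).
have pw w : near_sum j w @[j --> \oo] --> (0 : R).
  have := overstep_cvg0 (X := X) hB cY sdeY w xg cD Dg.
  apply: (squeeze_cvgr _ (@cvg_cst _ 0 _ _ _)); apply: nearW => j; apply/andP; split.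
    apply: sumr_ge0 => k _; have /andP[n0 _] := nD (Y (k.+1%:R * msh j) w).
    by apply: mulr_ge0 (I0 j k w); exact: mulr_ge0.
  apply: ler_sum => k _; have /andP[n0 n1] := nD (Y (k.+1%:R * msh j) w).
  apply: ler_wpM2r; [exact: (I0 j k w)|apply: le_trans n1].
  by rewrite ler_piMl// d1.
have IG : P.-integrable setT G := @ou_sup_integrable _ _ _ P B cP hB theta sigma mu x Y th0 cY sdeY lam lam0.
have aeG : {ae P, forall w, setT w -> G w \is a fin_num} by exact: (integrable_ae measurableT IG).
have dom j w : G w \is a fin_num -> (`|(near_sum j w)%:E| <= (2 * C)%:E * G w)%E.
  move=> fG; rewrite -(fineK fG) -EFinM abse_EFin lee_fin.
  have G1 : 1 <= fine (G w) by rewrite -lee_fin fineK// ou_sup_ge1.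
  apply: (@stopped_sum_bound _ (fun k => disc lam (k.+1%:R * msh j) * near_excess (Y (k.+1%:R * msh j) w))
    (fun k => u (k%:R * msh j) w)) => //.
  - by move=> k; rewrite -subr_ge0.
  - by have /andP[] := u01 (0 * msh j) w.
  - by rewrite !mulr_ge0// (le_trans _ G1).
  move=> k _; set s := _ * msh j; have s0 : 0 <= s := kh0 j k.+1.
  have /andP[n0 n1] := hC (Y s w); rewrite ger0_norm; last exact: mulr_ge0.
  apply: (@le_trans _ _ (disc lam s * (C * (1 + `|Y s w|)))); first exact: ler_wpM2l.
  have h1 := @ou_sup_ub _ _ _ theta sigma mu Y th0 cY lam lam0 w s s0.
  rewrite -/G -(fineK fG) lee_fin in h1.
  have h2 : disc lam s <= expR (- (lam * s / 2)).
    by rewrite /disc ler_expR lerN2 ler_pdivrMr// ler_peMr ?ler1n// mulr_ge0// ltW.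
  have h3 : disc lam s * `|Y s w| <= fine (G w) by apply: le_trans h1; exact: ler_wpM2r.
  have -> : disc lam s * (C * (1 + `|Y s w|)) = C * (disc lam s + disc lam s * `|Y s w|) by ring.
  rewrite [2 * C]mulrC -mulrA ler_wpM2l// mulr_natl mulr2n lerD// (le_trans _ G1)// d1//.
have mn j : measurable_fun setT (fun w => (near_sum j w)%:E).
  by have [In _] := near_sum_integrable j; case/integrableP: In.
have := @dominated_convergence _ _ _ P setT measurableT (fun j w => (near_sum j w)%:E) (fun=> 0%E)
  (fun w => (2 * C)%:E * G w)%E mn (measurable_cst _).
case.
- by apply: aeW => w _; apply: cvg_EFin (pw w); exact: nearW.
- exact: integrableZl.
- by apply: filterS aeG => w /(_ I) fG j _; exact: dom.
move=> _ _; rewrite integral0 => /fine_cvgP[_]; exact.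
Qed.

Let gsum j := \sum_(0 <= k < j * 2 ^ j) disc lam (k.+1%:R * msh j) *
        Ex (fun w => gain theta mu lam Phi (c + nu (k%:R * msh j) w) (Y (k.+1%:R * msh j) w)
                   - gain theta mu lam Phi (c + nu (k.+1%:R * msh j) w) (Y (k.+1%:R * msh j) w)).

Lemma gain_sum_cvg_below : x < gm -> gsum j @[j --> \oo] --> - saving theta sigma mu lam Phi c x.
Proof.
move=> xg.
have -> : saving theta sigma mu lam Phi c x = kp * (al * p x).
  by rewrite /saving lt_eqF// /stop_val -/gm xg.
have [h1 h10 [C C0 HC]] := psi_overshoot mu th0 sg0 lam0 gm.
(* The three errors of [nu_star_sum]: mass unhit at time j, near overshoot, and far overshoot. *)
pose b j := `|kp| * (al * (expR (- (lam * j%:R)) * p gm) + `|Ex (near_sum j)| + al * C * (j%:R * msh j)).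
have b0 : b j @[j --> \oo] --> (0 : R).
  have <- : `|kp| * (al * (0 * p gm) + `|0 : R| + al * C * 0) = 0.
    by rewrite normr0 !(mul0r, mulr0) !addr0 mulr0.
  apply: cvgM; first exact: cvg_cst.
  apply: cvgD; first apply: cvgD.
  - by apply: cvgM; [exact: cvg_cst|apply: cvgM; [exact: disc_cvg|exact: cvg_cst]].
  - by apply: cvg_norm; exact: near_sum_cvg.
  - by apply: cvgM; [exact: cvg_cst|exact: msh_lin_cvg].
suff H : (gsum j + kp * (al * p x)) @[j --> \oo] --> (0 : R).
  rewrite -[X in _ --> X]add0r; have -> : gsum = (fun j => (gsum j + kp * (al * p x)) - kp * (al * p x)).
    by apply/funext => j; rewrite addrK.
  by apply: cvgB H _; exact: cvg_cst.
apply: (@squeeze_cvgr _ _ _ _ (fun j => - b j) b) => //; last first.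
  by rewrite -[X in _ --> X]oppr0; exact: cvgN.
have /cvgrPdist_lt/(_ _ h10)[N _ HN] := @msh_cvg R.
exists N => // j /= Nj; have hh : msh j <= h1.
  by have := HN j Nj; rewrite sub0r normrN => /ltW; apply: le_trans; exact: ler_norm.
have k0 k : 0 <= k%:R * msh j :> R by rewrite mulr_ge0// ltW ?msh_gt0.
rewrite /gsum.
have [|r1 [r2 [/andP[r10 r11] /andP[r20 r21] ->]]] := @nu_star_sum xg j C C0.
  move=> k y yg; apply: HC => //; first exact: msh_gt0.
    exact: (xi_mfun hB th0 cY sdeY (k0 k) (msh_gt0 j)).
  by move=> b'; exact: (ou_noise_mgf cP hB th0 cY sdeY b' (k0 k) (msh_gt0 j)).
rewrite -ler_norml.
have -> : - kp * (al * (p x - r1) - Ex (near_sum j) - r2) + kp * (al * p x) = kp * (al * r1 + Ex (near_sum j) + r2).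
  by move: (Ex _) (p x) => e px; move: kp al => *; ring.
rewrite normrM /b ler_wpM2l//; apply: le_trans (ler_normD _ _) _; apply: lerD; last by rewrite ger0_norm.
apply: le_trans (ler_normD _ _) _; rewrite lerD2r ger0_norm; last by rewrite mulr_ge0// ltW.
by rewrite ler_pM2l.
Qed.

(** Started at or above the threshold, the control spends everything immediately after time 0; only
    the first cell contributes, priced at the state one mesh later, whose mean tends to x. *)
Lemma gain_sum_cvg_above : gm <= x -> gsum j @[j --> \oo] --> - saving theta sigma mu lam Phi c x.
Proof.
move=> gx.
have -> : saving theta sigma mu lam Phi c x = kp * (x - K).
  by rewrite /saving lt_eqF// /stop_val -/gm ltNge gx.
have ut t w : 0 < t -> u t w = 0.
  move=> t0; rewrite uE ifF//; apply/negP => /unhitP/(_ 0 (lexx 0) t0).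
  by have -> : X x 0 w = x := Y0E hB sdeY w; rewrite ltNge gx.
have u0 w : u 0 w = 1 by rewrite uE ifT//; exact: unhit0.
pose v j := disc lam (msh j) * (- kp * (ou_mean theta mu (msh j) x - K)).
have e1 (b : R) : expR (- (b * msh j)) @[j --> \oo] --> (1 : R).
  rewrite -expR0; apply: continuous_cvg; first exact: continuous_expR.
  rewrite -[X in _ --> X]oppr0 -(mulr0 b); apply: cvgN; apply: cvgM; first exact: cvg_cst.
  exact: msh_cvg.
have v0 : v j @[j --> \oo] --> - (kp * (x - K)).
  have <- : 1 * (- kp * (mu + (x - mu) * 1 - K)) = - (kp * (x - K)).
    by rewrite mul1r mulr1 [mu + _]addrC subrK mulNr.
  apply: cvgM; first exact: e1.
  apply: cvgM; first exact: cvg_cst.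
  apply: cvgB; last exact: cvg_cst.
  apply: cvgD; first exact: cvg_cst.
  by apply: cvgM; [exact: cvg_cst|exact: e1].
(* For j = 0 the horizon is empty, so the first cell exists only from j = 1 on. *)
apply: cvg_trans v0; apply: near_eq_cvg; exists 1%N => // -[//|j] _ /=.
have m0 := @msh_gt0 R j.+1.
have n0 : (0 < j.+1 * 2 ^ j.+1)%N by rewrite muln_gt0 expn_gt0.
rewrite /gsum big_ltn// [X in _ + X]big_nat_cond [X in _ + X]big1 ?addr0; last first.
  move=> k; rewrite andbT => /andP[k0 _]; rewrite -[RHS](mulr0 (disc lam (k.+1%:R * msh j.+1))); congr (_ * _).
  rewrite -[RHS](Rintegral_const P); apply: eq_Rintegral => w _.
  rewrite nu_star_gain ?ler_wpM2r ?ler_nat ?(ltW m0)//.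
  by rewrite !ut ?subrr ?mulr0// mulr_gt0 ?ltr0n.
rewrite mul1r mul0r /v; congr (_ * _).
have ix := ou_noise_integrable cP hB th0 cY sdeY (lexx 0) m0.
have Ix : Ex (ou_noise theta mu Y 0 (msh j.+1)) = 0.
  by rewrite /Rintegral (ou_noise_mean cP hB th0 cY sdeY (lexx 0) m0).
have E : Ex (fun w => - kp * (ou_mean theta mu (msh j.+1) x - K) + - kp * ou_noise theta mu Y 0 (msh j.+1) w) =
    - kp * (ou_mean theta mu (msh j.+1) x - K).
  rewrite RintegralD ?Rintegral_const ?RintegralZl ?Ix ?mulr0 ?addr0//.
    exact: integrable_bounded_cst.
  exact: (integrableZl measurableT (- kp) ix).
rewrite -[LHS]E; apply: eq_Rintegral => w _.
rewrite nu_star_gain ?(ltW m0)// u0 ut// subr0 mulr1.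
have := Y_step theta mu Y 0 (msh j.+1) w; rewrite add0r (Y0E hB sdeY) => ->; ring.
Qed.

Lemma nu_star_cost : (\int[P]_w path_cost Y lam Phi c nu w)%E = (Wfun theta sigma mu lam Phi x c)%:E.
Proof.
rewrite (WfunE mu th0 sg0 lam0 dPhi Phi1 k_lt0 x c0 (ltW c1)).
rewrite (cost_limit (l := - saving theta sigma mu lam Phi c x) cP hB th0 mu0 cY sdeY lam0 dPhi Phi_ni Phi1 c0 hnu)//.
by case: (ltP x gm) => xg; [exact: gain_sum_cvg_below|exact: gain_sum_cvg_above].
Qed.

End optimal_control.

(** * Value and optimality *)

Lemma strict_admissible {R : realType} {d : measure_display} {T : measurableType d}
    (P : probability T R) (B : R -> T -> R) c nu : strict_control P B c nu -> admissible P B c nu.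
Proof.
move=> [nm nl na n0 n1]; split => //.
- by move=> t t0 E mE; exact: ((meas_wrtE _ _).1 (na t t0) E mE).
- by move=> w t t0; rewrite -(n0 w); exact: nm.
- by split => //; apply: aeW => w t t0; exact: n1.
Qed.

Lemma strict_zero {R : realType} {d : measure_display} {T : measurableType d}
    (P : probability T R) (B : R -> T -> R) c : c <= 1 -> strict_control P B c (fun _ _ => 0).
Proof.
move=> c1; split => //.
- by move=> w t _; exact: cvg_cst.
- by move=> t _; exact: measurable_cst.
- by move=> w t _; rewrite addr0.
Qed.

Unset Implicit Arguments.
Set Strict Implicit.
Set Printing Implicit Defensive.

Theorem mainTheorem12 (R : realType) (d : measure_display) (T : measurableType d)
    (P : probability T R) (B : R -> T -> R) (X : R -> R -> T -> R)
    (theta sigma mu lam : R) (Phi : R -> R) :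
  measure_is_complete P ->
  standard_BM P B ->
  0 < theta -> 0 < sigma -> 0 < mu -> 0 < lam ->
  (* X^x solves dX = theta (mu - X) dt + sigma dB, X_0 = x (pathwise) *)
  (forall x w, {within `[0, +oo[, continuous (fun t => X x t w)}) ->
  (forall x w t, 0 <= t ->
     X x t w = x + Rintegral lebesgue_measure `[0, t] (fun s => theta * (mu - X x s w))
               + sigma * B t w) ->
  (* Phi in C^2, nonincreasing, strictly convex, Phi(1) = 0 *)
  (forall y, derivable Phi y 1) ->
  (forall y, derivable (derive1 Phi) y 1) ->
  continuous (derive1 (derive1 Phi)) ->
  (forall y z, y <= z -> Phi z <= Phi y) ->
  (forall y z s, y != z -> 0 < s -> s < 1 ->
     Phi (s * y + (1 - s) * z) < s * Phi y + (1 - s) * Phi z) ->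
  Phi 1 = 0 ->
  (* k(c) < 0 on [0,1] *)
  (forall c, 0 <= c -> c <= 1 -> kfun theta lam Phi c < 0) ->
  (forall x c, 0 <= c -> c <= 1 ->
     Uvalue P B X lam Phi x c = (Wfun theta sigma mu lam Phi x c)%:E) /\
  (forall x c, 0 <= c -> c < 1 ->
     let nus := nu_star X x c (gam theta sigma mu lam Phi c) in
     admissible P B c nus /\ Jcost P X lam Phi x c nus = Uvalue P B X lam Phi x c).
Proof.
move=> cP hB th0 sg0 mu0 lam0 cX sdeX dPhi _ _ Phi_ni Phi_cvx Phi1 k_lt0.
(* Truncation preserves the cost and yields a strict control, to which the discretized lower bound
   applies. *)
have lower x c nu : 0 <= c -> c <= 1 -> admissible P B c nu ->
    ((Wfun theta sigma mu lam Phi x c)%:E <= Jcost P X lam Phi x c nu)%E.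
  move=> c0 c1 anu.
  have -> : Jcost P X lam Phi x c nu = (\int[P]_w path_cost (X x) lam Phi c nu w)%E by [].
  rewrite (path_cost_trunc cP hB th0 mu0 (cX x) (sdeX x) lam0 dPhi Phi_ni Phi1 c0 c1 anu).
  exact: (cost_lower_bound cP hB th0 sg0 mu0 (cX x) (sdeX x) lam0 dPhi Phi_ni Phi_cvx Phi1 k_lt0 c0 c1 (admissible_trunc c1 anu)).
have attained x c nu : 0 <= c -> c <= 1 -> strict_control P B c nu ->
    Jcost P X lam Phi x c nu = (Wfun theta sigma mu lam Phi x c)%:E ->
    Uvalue P B X lam Phi x c = (Wfun theta sigma mu lam Phi x c)%:E.
  move=> c0 c1 /strict_admissible anu E; apply/eqP; rewrite eq_le; apply/andP; split.
    by rewrite -E; apply: ereal_inf_lbound; exists nu.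
  by apply: le_ereal_inf_tmp => _ [v av <-]; exact: lower.
have star x c : 0 <= c -> c < 1 -> Jcost P X lam Phi x c (nu_star X x c (gam theta sigma mu lam Phi c)) =
    (Wfun theta sigma mu lam Phi x c)%:E.
  move=> c0 c1; exact: (nu_star_cost (X := X) cP hB th0 sg0 mu0 (cX x) (sdeX x) lam0 dPhi Phi_ni Phi1 k_lt0 c0 c1).
have starS x c : c < 1 -> strict_control P B c (nu_star X x c (gam theta sigma mu lam Phi c)).
  by move=> c1; exact: (nu_star_strict hB th0 (cX x) (sdeX x) _ (ltW c1)).
have value x c : 0 <= c -> c <= 1 -> Uvalue P B X lam Phi x c = (Wfun theta sigma mu lam Phi x c)%:E.
  move=> c0; rewrite le_eqVlt => /predU1P[->|c1]; last exact: (attained _ _ _ c0 (ltW c1) (starS x c c1) (star x c c0 c1)).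
  (* At c = 1 no fuel is left: the zero control attains 0 = W(x, 1), all its gain differences being
     zero. *)
  have zS := strict_zero P B (lexx (1 : R)).
  apply: (attained _ _ _ ler01 (lexx _) zS).
  have -> : Jcost P X lam Phi x 1 (fun _ _ => 0) = (\int[P]_w path_cost (X x) lam Phi 1 (fun _ _ => 0%R) w)%E by [].
  rewrite (cost_limit (l := 0) cP hB th0 mu0 (cX x) (sdeX x) lam0 dPhi Phi_ni Phi1 ler01 zS).
    by rewrite Phi1 mulr0 mul0r add0r /Wfun eqxx.
  under eq_fun => j.
    rewrite big1; last by move=> k _; under eq_Rintegral do rewrite subrr; rewrite Rintegral_const mulr0.
    over.
  exact: cvg_cst.
split=> // x c c0 c1 nus; split; first exact: (strict_admissible (starS x c c1)).
by rewrite value ?(ltW c1)// star.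
Qed.
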